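(* Assume the standing setup below with $\beta_n\to\infty$ and $\beta_nn^{-\alpha}\to0$. Define $\mathcal Y(q)=\nabla_{\mathbb S^{d-1}}\log\rho(q)-\frac{d-1}{2}q$ and $\Sigma(q)=\frac{c_d}{\rho(q)}\mathbf P_q$ with $c_d=2^{-d}\pi^{-(d-1)/2}$. (1) If $\beta_n^{1+\alpha}n^{-\alpha}\to0$, then $\beta_n\mathcal Y_n(q)\to V\mathcal Y(q)$ in probability. (2) If $\beta_n^{1+\alpha}n^{-\alpha}\to\tau\in(0,\infty)$, then $\beta_n\mathcal Y_n(q)\to V\mathcal Y(q)+G_\tau$ in distribution, where $G_\tau\sim\mathcal N(0,\tau^{1/\alpha}V\Sigma(q)V^\top)$. (3) If $\beta_n^{1+\alpha}n^{-\alpha}\to\infty$, then $\sqrt{n\beta_n^{1-1/\alpha}}\,\mathcal Y_n(q)\to G_1$ in distribution, where $G_1\sim\mathcal N(0,V\Sigma(q)V^\top)$. In all three cases $\mathcal Y_n(q)\to0$ and $\mathrm{ATT}(n)\to Vq$ in probability.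
   Context: Standing setup: Fix an integer $d\ge 2$; let $\mathbb S^{d-1}\subset\mathbb R^d$ be the unit sphere with surface measure $\sigma$. Fix $q\in\mathbb S^{d-1}$. Let $x_1,x_2,\dots$ be i.i.d. random vectors on $\mathbb S^{d-1}$ with law $\rho(x)\,d\sigma(x)$, where $\rho$ is a $C^2$ probability density on $\mathbb S^{d-1}$ with $\rho(q)>0$. Let $(\beta_n)_{n\ge1}$ be positive reals and set $\alpha=2/(d-1)$. Define $T_i=1-\langle q,x_i\rangle$, $Z_n=\sum_{j=1}^n e^{-\beta_nT_j}$, $A_i=e^{-\beta_nT_i}/Z_n$. Let $V\in\mathbb R^{d\times d}$ be fixed, $\mathrm{ATT}(n)=V\sum_{j=1}^nA_jx_j$ and $\mathcal Y_n(q)=\mathrm{ATT}(n)-Vq=V\sum_{i=1}^nA_i(x_i-q)$. $\mathbf P_q=\mathrm{Id}-qq^\top$ is the orthogonal projection onto the tangent space $T_q\mathbb S^{d-1}$, and $\nabla_{\mathbb S^{d-1}}$ is the spherical (Riemannian) gradient, viewed as a vector in $T_q\mathbb S^{d-1}\subset\mathbb R^d$. *)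

(* Defs.v *)
From HB Require Import structures.
From mathcomp Require Import all_boot all_order all_algebra.
From mathcomp Require Import all_classical all_reals all_analysis.
Set Implicit Arguments. Unset Strict Implicit. Unset Printing Implicit Defensive.
Import Order.TTheory GRing.Theory Num.Theory.
Import numFieldNormedType.Exports.
Local Open Scope classical_set_scope.
Local Open Scope ring_scope.

Section Defs.
Context {R : realType} {d : nat}.
Implicit Types (u v q y : 'cV[R]_d).

Definition dotv u v : R := \sum_(j < d) u j 0 * v j 0.
Definition enorm v : R := Num.sqrt (dotv v v).
Definition sphere : set 'cV[R]_d := [set v | enorm v = 1].
Definition projT q : 'M[R]_d := 1%:M - q *m q^T.
Definition ebasis (j : 'I_d) : 'cV[R]_d := delta_mx j 0.
Definition partial (f : 'cV[R]_d -> R) (j : 'I_d) (x : 'cV[R]_d) : R :=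
  'D_(ebasis j) f x.
Definition egrad (f : 'cV[R]_d -> R) (x : 'cV[R]_d) : 'cV[R]_d :=
  \col_(j < d) partial f j x.
Definition C2_on (U : set 'cV[R]_d) (f : 'cV[R]_d -> R) : Prop :=
  forall x, U x ->
    [/\ {for x, continuous f},
        forall i, derivable f x (ebasis i),
        forall i, {for x, continuous (partial f i)},
        forall i j, derivable (partial f i) x (ebasis j)
      & forall i j, {for x, continuous (partial (partial f i) j)}].

Definition borelRd : set (set 'cV[R]_d) := <<s [set A | open A] >>.

Fixpoint iint (n : nat) (F : (nat -> R) -> \bar R) : \bar R :=
  match n with
  | 0 => F (fun _ => 0)
  | n'.+1 => iint n' (fun s : nat -> R =>
      (\int[lebesgue_measure]_(t in [set: R]) F (fun k => if k == n' then t else s k))%E)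
  end.
Definition lebRd (F : 'cV[R]_d -> \bar R) : \bar R :=
  iint d (fun s : nat -> R => F (\col_(j < d) s j)).
Definition sphere_int (g : 'cV[R]_d -> \bar R) : \bar R :=
  ((d%:R)%:E * lebRd (fun y =>
     if ((0 < enorm y) && (enorm y <= 1))%R then g ((enorm y)^-1 *: y) else 0%E))%E.

Definition gaussian_vec {dT : measure_display} {T : measurableType dT}
  (P : probability T R) (G : T -> 'cV[R]_d) (C : 'M[R]_d) : Prop :=
  (forall A, borelRd A -> measurable (G @^-1` A)) /\
  forall t : 'cV[R]_d, forall B : set R, measurable B ->
    let s2 := (t^T *m C *m t) 0 0 in
    P [set w | B (dotv t (G w))] =
      (if s2 == 0 then \d_(0 : R) B else normal_prob 0 (Num.sqrt s2) B).

Definition cvg_prob {dT : measure_display} {T : measurableType dT}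
  (P : probability T R) (Z : nat -> T -> 'cV[R]_d) (c : 'cV[R]_d) : Prop :=
  forall eps : R, 0 < eps ->
    (fun n => P [set w | eps <= enorm (Z n w - c)]) @ \oo --> 0%E.

Definition cvg_dist {dT : measure_display} {T : measurableType dT}
  (P : probability T R) (Z : nat -> T -> 'cV[R]_d)
  {dT' : measure_display} {T' : measurableType dT'}
  (P' : probability T' R) (G : T' -> 'cV[R]_d) : Prop :=
  forall f : 'cV[R]_d -> R, continuous f -> (exists M : R, forall y, `|f y| <= M) ->
    (fun n => \int[P]_w (f (Z n w))%:E)%E @ \oo --> (\int[P']_w (f (G w))%:E)%E.

End Defs.

Definition alpha_d (R : realType) (d : nat) : R := 2 / (d%:R - 1).
Definition c_d (R : realType) (d : nat) : R := (2 ^+ d * pi `^ ((d%:R - 1) / 2))^-1.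

Section Model.
Context {R : realType} {d : nat}.
Local Open Scope ring_scope.


Context {dT : measure_display} {T : measurableType dT}.
Variables (q : 'cV[R]_d) (V : 'M[R]_d) (beta : nat -> R) (x : nat -> T -> 'cV[R]_d).

Definition Tdist (i : nat) (w : T) : R := 1 - dotv q (x i w).
Definition Zsum (n : nat) (w : T) : R := \sum_(j < n) expR (- beta n * Tdist j w).
Definition attw (n i : nat) (w : T) : R := expR (- beta n * Tdist i w) / Zsum n w.
Definition ATT (n : nat) (w : T) : 'cV[R]_d := V *m \sum_(j < n) (attw n j w *: x j w).
Definition Yn (n : nat) (w : T) : 'cV[R]_d := ATT n w - V *m q.
End Model.

Definition Ylim {R : realType} {d : nat} (rho : 'cV[R]_d -> R) (q : 'cV[R]_d) : 'cV[R]_d :=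
  projT q *m egrad (fun y => ln (rho y)) q - ((d%:R - 1) / 2) *: q.
Definition Sigmaq {R : realType} {d : nat} (rho : 'cV[R]_d -> R) (q : 'cV[R]_d) : 'M[R]_d :=
  (c_d R d / rho q) *: projT q.

(* Main.v *)
Require Import Defs.
From HB Require Import structures.
From mathcomp Require Import all_boot all_order all_algebra finmap.
From mathcomp Require Import all_classical all_reals all_analysis.
From mathcomp Require Import perm measurable_realfun ring lra.
Set Implicit Arguments. Unset Strict Implicit. Unset Printing Implicit Defensive.
Import Order.TTheory GRing.Theory Num.Theory.
Import numFieldNormedType.Exports.
Local Open Scope classical_set_scope.
Local Open Scope ring_scope.

(** With [s = beta^(-1/2)] every weight [exp (- beta T)] is a Gaussian of width [s] around [q].  Put
    [y = r x] with [x] on the sphere.  The identity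
      [T / s^2 + (r - 1)^2 / (2 r s^2) = |y - q|^2 / (2 r s^2)]
    shows that integrating the radial factor [r exp (- (r - 1)^2 / (2 r s^2))] against a moment of
    [exp (- beta T)] gives an integral over R^d, which the substitution [y = q + s z] turns into a
    Gaussian integral up to factors converging dominatedly.  Hence, with [m = (d - 1) / 2] and
    [kappa = rho q (2 pi)^m],
      [beta^m E (exp (- beta T)) -> kappa],
      [beta^(m+1) E (exp (- beta T) <u, x - q>) -> kappa <u, Ylim>],
      [beta^(m+1) E (exp (- 2 beta T) <u, x - q>^2) -> kappa 2^(-m-1) |P u|^2].
    A rescaled vector [a_n Y_n] is the quotient of a sum of i.i.d. vectors by the normalised mass
    [Z_n / E Z_n], and the latter tends to 1 in L^2 because [beta n^(-alpha) -> 0].  The summands are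
    bounded by [|u| s], so the characteristic functions of the numerator converge by a second order
    expansion; Levy's theorem and Slutsky's lemma then give the limit law, and the four regimes only
    differ in the limits [mu] of [a_n / beta_n] and [v] of [a_n^2 beta^((d-3)/2) / n]. *)

(** * Lebesgue measure on column vectors *)

(** The law of the samples is given by [sphere_int], an integral over the unit ball of a function of
    the direction, itself computed by iterated one-dimensional integrals. No chart of the sphere is
    used: the radius is integrated out against a weight that may be chosen freely, and the choice
    made in the overview completes the exponent to a quadratic form. This gives identities that are
    exact at each [s]; limits are taken only afterwards. The delicate moment is the first one. At
    its natural order [s] the limit integrand is odd and integrates to 0, so one more order is
    needed: the difference quotient in [s] of the blown-up density brings in the gradient of [rho],
    while the curvature of the sphere yields the component along [q]. In the second moment the power
    of 2 comes from squaring the weight, which doubles [beta]. Characteristic functions are handled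
    as pairs of expectations of cosines and sines. The approximation behind Levy's theorem must be
    close to the test function on a ball and keep its bound on all of R^d; Bernstein's probabilistic
    argument, run with trigonometric step probabilities, gives both. *)

Section integral_functional.
Local Open Scope ereal_scope.
Import HBNNSimple.
Context d (T : measurableType d) (R : realType).
Variables (mu : {measure set T -> \bar R}) (Phi : (T -> \bar R) -> \bar R).

Hypothesis PhiD : forall f g : T -> \bar R, measurable_fun [set: T] f -> measurable_fun [set: T] g ->
  (forall x, 0 <= f x) -> (forall x, 0 <= g x) ->
  Phi (fun x => f x + g x) = Phi f + Phi g.
Hypothesis PhiZ : forall (k : R) (f : T -> \bar R), (0 <= k)%R -> measurable_fun [set: T] f ->
  (forall x, 0 <= f x) -> Phi (fun x => k%:E * f x) = k%:E * Phi f.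
Hypothesis Phi_lim : forall (g : nat -> T -> \bar R) (f : T -> \bar R),
  (forall n, measurable_fun [set: T] (g n)) -> (forall n x, 0 <= g n x) ->
  (forall x m n, (m <= n)%N -> g m x <= g n x) ->
  (forall x, g ^~ x @ \oo --> f x) -> Phi \o g @ \oo --> Phi f.
Hypothesis Phi_indic : forall A, measurable A ->
  Phi (fun x => (\1_A x)%:E) = mu A.

(** Simple functions first, then increasing approximation. It is applied to the iterated integral
    [iint] and to integration against a density, which are thereby recognised as integrals against a
    measure. *)
Lemma ge0_functional_integral (f : T -> \bar R) : measurable_fun [set: T] f ->
  (forall x, 0 <= f x) -> Phi f = \int[mu]_x f x.
Proof.
move=> mf f0.
have Phi0 : Phi (cst 0) = 0.
  have e0 : (fun x => (\1_set0 x)%:E) = cst 0 :> (T -> \bar R).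
    by apply/funext => x; rewrite indic0.
  by rewrite -e0 Phi_indic// measure0.
have H (g : {nnsfun T >-> R}) : Phi (EFin \o g) = \int[mu]_x (g x)%:E.
  have E x : (g x)%:E = \sum_(k <- fset_set (range g))
      (k%:E * (\1_(g @^-1` [set k]) x)%:E).
    by rewrite fimfunE -fsumEFin// fsbig_finite.
  under eq_integral do rewrite E.
  have -> : EFin \o g = (fun x => \sum_(k <- fset_set (range g))
      (k%:E * (\1_(g @^-1` [set k]) x)%:E)) by apply/funext => x; exact: E.
  have : all (fun k => 0 <= k)%R (fset_set (range g)).
    by apply/allP => k; rewrite in_fset_set// inE => -[x _ <-].
  elim: (enum_fset (fset_set (range g))) => [_|k s IH /= /andP[k0 s0]].
    under eq_fun do rewrite big_nil.
    by rewrite integral0 Phi0.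
  under eq_fun do rewrite big_cons.
  have mi k' : measurable_fun [set: T] (fun x => (\1_(g @^-1` [set k']) x)%:E : \bar R).
    by apply/measurable_EFinP; exact: measurable_indic.
  have m1 k' : measurable_fun [set: T] (fun x => k'%:E * (\1_(g @^-1` [set k']) x)%:E).
    exact: measurable_funeM.
  have m2 : measurable_fun [set: T] (fun x => \sum_(j <- s) (j%:E * (\1_(g @^-1` [set j]) x)%:E)).
    by apply: emeasurable_sum => j.
  have p2 x : 0 <= \sum_(j <- s) (j%:E * (\1_(g @^-1` [set j]) x)%:E).
    by rewrite big_seq; apply: sume_ge0 => j js; rewrite mule_ge0 ?lee_fin//; exact: (allP s0).
  have p1 x : 0 <= k%:E * (\1_(g @^-1` [set k]) x)%:E by rewrite mule_ge0 ?lee_fin.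
  rewrite PhiD ?ge0_integralD//.
  rewrite IH// PhiZ ?ge0_integralZl_EFin//.
  by rewrite Phi_indic// integral_indic// setIT.
pose g := nnsfun_approx measurableT mf.
have cg x : EFin \o g^~ x @ \oo --> f x by exact: cvg_nnsfun_approx.
have h1 : (fun n => Phi (EFin \o g n)) @ \oo --> Phi f.
  apply: (@Phi_lim (fun n => EFin \o g n) f) => //.
  - by move=> n; exact/measurable_EFinP.
  - by move=> n x /=; rewrite lee_fin.
  - by move=> x m n mn; rewrite lee_fin; exact/lefP/nd_nnsfun_approx.
have h2 : (fun n => Phi (EFin \o g n)) @ \oo --> \int[mu]_x f x.
  have -> : \int[mu]_x f x = \int[mu]_x (limn (EFin \o g^~ x)).
    by apply: eq_integral => x _; apply/esym/cvg_lim.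
  under eq_fun do rewrite H.
  apply: cvg_monotone_convergence => //.
  - by move=> n; exact/measurable_EFinP.
  - by move=> n x _; rewrite lee_fin.
  - by move=> x _ m n mn; rewrite lee_fin; exact/lefP/nd_nnsfun_approx.
exact: (cvg_unique _ h1 h2).
Qed.

End integral_functional.

(** * Iterated integrals as integrals against a measure on sequences *)

Section iterated_integral.
Local Open Scope ereal_scope.
Context {R : realType}.

(** [iint] evaluates its integrand on functions [nat -> R] whatever the dimension, so measurability
    is set up once on the whole sequence space, with the product sigma-algebra. *)
Definition cylinders : set (set (nat -> R)) :=
  [set A | exists k (B : set R), measurable B /\ A = (fun s => s k) @^-1` B].
Definition seqR : Type := g_sigma_algebraType cylinders.
HB.instance Definition _ := Measurable.on seqR.

Lemma measurable_coord k : measurable_fun [set: seqR] (fun s : seqR => s k).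
Proof.
move=> _ B mB; rewrite setTI; apply: sub_sigma_algebra.
by exists k, B.
Qed.

Lemma measurable_fun_seqR d (T : measurableType d) (f : T -> seqR) :
  (forall k, measurable_fun [set: T] (fun x => f x k)) -> measurable_fun [set: T] f.
Proof.
move=> mf; apply: (@measurability _ _ T seqR setT f cylinders) => //.
move=> _ [_ [k [B [mB ->]] <-]]; exact: (mf k).
Qed.

Definition upd n (s : nat -> R) (t : R) : seqR := fun k => if k == n then t else s k.

Lemma measurable_upd n :
  measurable_fun [set: seqR * R] (fun p : seqR * R => upd n p.1 p.2).
Proof.
apply: measurable_fun_seqR => k; rewrite /upd; case: eqP => _.
  exact: measurable_snd.
exact: (measurableT_comp (measurable_coord k) measurable_fst).
Qed.

Local Notation inner n F :=
  (fun s : seqR => (\int[lebesgue_measure]_(t in [set: R]) F (upd n s t))%E).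

Lemma measurable_upd_section n (F : seqR -> \bar R) s : measurable_fun [set: seqR] F ->
  measurable_fun [set: R] (fun t => F (upd n s t)).
Proof.
move=> mF; apply: measurableT_comp => //.
apply: measurable_fun_seqR => k; rewrite /upd; case: eqP => _ //.
Qed.

Lemma measurable_inner n (F : seqR -> \bar R) : measurable_fun [set: seqR] F ->
  (forall s, 0 <= F s)%E -> measurable_fun [set: seqR] (inner n F).
Proof.
move=> mF F0.
have := @measurable_fun_fubini_tonelli_F _ _ seqR (measurableTypeR R) R lebesgue_measure (fun p => F (upd n p.1 p.2)).
apply => //.
exact: (measurableT_comp mF (measurable_upd n)).
Qed.

Lemma iint_ge0 n (F : seqR -> \bar R) : (forall s, 0 <= F s)%E -> (0 <= iint n F)%E.
Proof.
elim: n F => [|n IH] F F0 //=; apply: IH => s; exact: integral_ge0.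
Qed.

Lemma iintD n (F G : seqR -> \bar R) :
  measurable_fun [set: seqR] F -> measurable_fun [set: seqR] G ->
  (forall s, 0 <= F s)%E -> (forall s, 0 <= G s)%E ->
  iint n (fun s => F s + G s)%E = (iint n F + iint n G)%E.
Proof.
elim: n F G => [|n IH] F G mF mG F0 G0 //=.
rewrite -IH; [|exact: measurable_inner|exact: measurable_inner|
  by move=> s; exact: integral_ge0|by move=> s; exact: integral_ge0].
congr iint; apply/funext => s; rewrite ge0_integralD//;
 exact: measurable_upd_section.
Qed.

Lemma iintZ n (k : R) (F : seqR -> \bar R) : (0 <= k)%R ->
  measurable_fun [set: seqR] F -> (forall s, 0 <= F s)%E ->
  iint n (fun s => k%:E * F s)%E = (k%:E * iint n F)%E.
Proof.
move=> k0; elim: n F => [|n IH] F mF F0 //=.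
rewrite -IH; [|exact: measurable_inner|by move=> s; exact: integral_ge0].
congr iint; apply/funext => s; rewrite ge0_integralZl_EFin//.
exact: measurable_upd_section.
Qed.

(** Monotone convergence in the innermost variable, carried outwards by induction. With [iintD] and
    [iintZ] it makes [iint] an instance of [ge0_functional_integral]. *)
Lemma iint_lim n (g : nat -> seqR -> \bar R) (f : seqR -> \bar R) :
  (forall n, measurable_fun [set: seqR] (g n)) -> (forall n x, 0 <= g n x)%E ->
  (forall x m n, (m <= n)%N -> g m x <= g n x)%E ->
  (forall x, g ^~ x @ \oo --> f x) -> (fun k => iint n (g k)) @ \oo --> iint n f.
Proof.
elim: n g f => [|n IH] g f mg g0 ndg gf /=; first exact: gf.
apply: IH => [k|k s|s i j ij|s].
- exact: measurable_inner.
- exact: integral_ge0.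
- apply: ge0_le_integral => //=; [exact: measurable_upd_section|
    exact: measurable_upd_section|by move=> *; exact: ndg].
- have -> : (\int[lebesgue_measure]_(t in [set: R]) f (upd n s t) =
    \int[lebesgue_measure]_(t in [set: R]) limn (g ^~ (upd n s t)))%E.
    by apply: eq_integral => t _; apply/esym/cvg_lim => //; exact: gf.
  apply: cvg_monotone_convergence => //.
  + by move=> k; exact: measurable_upd_section.
  + by move=> t _ i j ij; exact: ndg.
Qed.

Variable n : nat.
(** Lebesgue measure on the first [n] coordinates times the Dirac mass at 0 on all the others. *)
Definition iint_measure (A : set seqR) : \bar R := iint n (fun s => (\1_A s)%:E).

Let mu0 : iint_measure set0 = 0%E.
Proof.
have -> : iint_measure set0 = iint n (fun s : seqR => 0%:E * (cst 0 s))%E.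
  by congr iint; apply/funext => s; rewrite indic0 mule0.
by rewrite (iintZ n (lexx 0) (measurable_cst _))// mul0e.
Qed.

Let mu_ge0 A : (0 <= iint_measure A)%E.
Proof. by apply: iint_ge0 => s; rewrite lee_fin. Qed.

Let mu_additive : semi_sigma_additive iint_measure.
Proof.
move=> A mA tA mUA.
have mi k : measurable_fun [set: seqR] (fun s => (\1_(A k) s)%:E : \bar R).
  by apply/measurable_EFinP; exact: measurable_indic.
have E k : (\sum_(0 <= i < k) iint_measure (A i) =
    iint n (fun s => \sum_(0 <= i < k) (\1_(A i) s)%:E))%E.
  elim: k => [|k IH].
    by rewrite big_nil -mu0; congr iint; apply/funext => s; rewrite indic0 big_nil.
  rewrite big_nat_recr//= IH -iintD//.
  - by congr iint; apply/funext => s; rewrite big_nat_recr.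
  - exact: emeasurable_sum.
  - by move=> s; apply: sume_ge0 => *; rewrite lee_fin.
under eq_fun do rewrite E.
apply: iint_lim => //.
- by move=> k; exact: emeasurable_sum.
- by move=> k s; apply: sume_ge0 => *; rewrite lee_fin.
- move=> s i j ij; apply: lee_sum_nneg_natr => // *; exact: lee_fin.
- move=> s.
  (* At a fixed point [s], convergence of the partial sums of indicators is the sigma-additivity of
     the Dirac mass at [s]. *)
  have := @measure_semi_sigma_additive _ _ _ (dirac s : {measure set seqR -> \bar R}) A mA tA mUA.
  by rewrite /dirac/=.
Qed.

HB.instance Definition _ := isMeasure.Build _ _ _ iint_measure mu0 mu_ge0 mu_additive.

Lemma iintE (F : seqR -> \bar R) : measurable_fun [set: seqR] F ->
  (forall s, 0 <= F s)%E -> iint n F = (\int[iint_measure]_s F s)%E.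
Proof.
apply: (ge0_functional_integral (mu := iint_measure)).
- exact: iintD.
- by move=> *; exact: iintZ.
- exact: iint_lim.
- by [].
Qed.

End iterated_integral.

Section image_measure.
Local Open Scope ereal_scope.
Context d1 d2 (X : measurableType d1) (Y : measurableType d2) (R : realType).
Variables (mu : {measure set X -> \bar R}) (f : X -> Y).
Hypothesis mf : measurable_fun [set: X] f.

Definition image_measure : {measure set Y -> \bar R} :=
  measure_function_pushforward__canonical__measure_function_Measure mu mf.

Lemma image_measureE A : image_measure A = mu (f @^-1` A).
Proof. by []. Qed.

Lemma ge0_integral_image_measure (F : Y -> \bar R) : measurable_fun [set: Y] F ->
  (forall y, 0 <= F y) -> \int[image_measure]_y F y = \int[mu]_x F (f x).
Proof. by move=> mF F0; rewrite (ge0_integral_pushforward mf)// => y _. Qed.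

End image_measure.

(** * Borel structure and Lebesgue measure on column vectors *)

Section borel_vectors.
Context {R : realType} {d : nat}.

(** An alias carrying the Borel structure; its measurable sets are by definition those of [borelRd],
    so hypotheses on [borelRd] apply without conversion. *)
Definition vecB : Type := g_sigma_algebraType [set A : set 'cV[R]_d | open A].
HB.instance Definition _ := Measurable.on vecB.

Lemma measurable_borelRd (A : set 'cV[R]_d) :
  borelRd A -> measurable (A : set vecB).
Proof. by []. Qed.

Lemma open_borelRd (A : set 'cV[R]_d) : open A -> borelRd A.
Proof. by move=> oA; apply: sub_sigma_algebra. Qed.

Lemma for_continuous_measurable (D : set vecB) (f : vecB -> R) :
  open (D : set 'cV[R]_d) ->
  (forall x, D x -> {for x, continuous (f : 'cV[R]_d -> R)}) ->
  measurable_fun D f.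
Proof.
move=> oD cf mD; apply: (@measurability _ _ vecB R D f (@RGenOpens.G R)) => //.
  exact: RGenOpens.measurableE.
move=> _ [_ [a [b ->] <-]]; apply: open_borelRd.
suff : open ((D : set 'cV[R]_d) `&` (f : 'cV[R]_d -> R) @^-1` `]a, b[) by [].
rewrite openE => x [Dx fx] /=.
apply: filterI; first exact: open_nbhs_nbhs.
have := cf x Dx; apply; apply: open_nbhs_nbhs; split => //; exact: interval_open.
Qed.

Lemma continuous_measurable (f : vecB -> R) : continuous (f : 'cV[R]_d -> R) ->
  measurable_fun [set: vecB] f.
Proof. by move=> cf; apply: for_continuous_measurable => [|x _]; [exact: (@openT 'cV[R]_d)|exact: cf]. Qed.

Lemma measurable_entry j : measurable_fun [set: vecB] (fun y : vecB => (y : 'cV[R]_d) j 0).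
Proof. by apply: continuous_measurable; exact: coord_continuous. Qed.

Lemma rat_approx (y e : R) : 0 < e -> exists q : rat, `|y - ratr q| < e.
Proof.
move=> e0; have [|q] := @rat_in_itvoo R (y - e) (y + e); first by lra.
by rewrite in_itv/= => /andP[h1 h2]; exists q; rewrite ltr_norml; apply/andP; split; lra.
Qed.

(** An open set is the countable union of the boxes with rational centre and half-width [1 / k.+1]
    that it contains, and the preimage of a box is a finite intersection of preimages under the
    coordinates. *)
Lemma measurable_fun_vecB dT (T : measurableType dT) (f : T -> vecB) :
  (forall j, measurable_fun [set: T] (fun x => (f x : 'cV[R]_d) j 0)) ->
  measurable_fun [set: T] f.
Proof.
move=> mf; apply: (@measurability _ _ T vecB setT f [set A : set 'cV[R]_d | open A]) => //.
move=> _ [A oA <-]; rewrite setTI.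
pose box (p : 'cV[rat]_d * nat) : set 'cV[R]_d :=
  [set y | forall j, `|y j 0 - ratr (p.1 j 0)| < p.2.+1%:R^-1].
pose F (p : 'cV[rat]_d * nat) : set T := [set w | box p (f w) /\ box p `<=` A].
have -> : f @^-1` A = \bigcup_p F p.
  apply/seteqP; split => w /=; last by move=> [p _ [bp]]; exact.
  move=> Afw; have /nbhs_ballP[e /= e0 beA] : nbhs (f w : 'cV[R]_d) A by exact: open_nbhs_nbhs.
  (* Half of [e], because [f w] and an arbitrary point of the box are each within [1 / k.+1] of the
     centre, coordinate by coordinate. *)
  have [k ke] : exists k : nat, k.+1%:R^-1 < e / 2.
    have [k _ kP] := near_infty_natSinv_lt (PosNum (divr_gt0 e0 (ltr0n R 2))).
    by exists k; exact: (kP k (leqnn k)).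
  have /choice[c cP] : forall j : 'I_d, exists q : rat, `|(f w : 'cV[R]_d) j 0 - ratr q| < k.+1%:R^-1.
    by move=> j; apply: rat_approx; rewrite invr_gt0.
  exists (\col_j c j, k) => //; split => [j|y yP] /=; first by rewrite mxE; exact: cP.
  apply: beA; split => // i j; rewrite (ord1 j) /ball/=.
  have := yP i; rewrite /= mxE => h1; have h2 := cP i.
  rewrite (le_lt_trans (ler_distD (ratr (c i)) _ _))// [X in _ < X]splitr ltrD//.
    exact: lt_trans h2 ke.
  by rewrite distrC; exact: lt_trans h1 ke.
apply: countable_bigcupT_measurable => [|[c k]]; first exact: countableP.
have [AF|AF] := pselect (box (c, k) `<=` A); last first.
  by rewrite (_ : F _ = set0)//; apply/seteqP; split => // w [].
have -> : F (c, k) = \bigcap_(j in [set: 'I_d])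
    ((fun w => `|(f w : 'cV[R]_d) j 0 - ratr (c j 0)|) @^-1` `]-oo, k.+1%:R^-1[).
  apply/seteqP; split => w /=.
    by move=> [h _] j _; rewrite /= in_itv/=; exact: h.
  by move=> h; split => // j; have := h j I; rewrite /= in_itv.
apply: fin_bigcap_measurable => // j _.
rewrite -[X in measurable X]setTI.
have mg : measurable_fun [set: T] (fun w => `|(f w : 'cV[R]_d) j 0 - ratr (c j 0)|).
  by apply: measurableT_comp => //; exact: measurable_funB (mf j) (measurable_cst _).
by apply: mg.
Qed.

Definition seq_col (s : seqR (R := R)) : vecB := \col_(j < d) s j.

Lemma measurable_seq_col : measurable_fun [set: seqR] seq_col.
Proof.
apply: measurable_fun_vecB => j.
rewrite (_ : (fun x => _) = (fun s : seqR => s j)); first exact: measurable_coord.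
by apply/funext => s; rewrite mxE.
Qed.

Definition Leb : {measure set vecB -> \bar R} :=
  image_measure (iint_measure d) measurable_seq_col.

Lemma lebRdE (F : vecB -> \bar R) : measurable_fun [set: vecB] F ->
  (forall y, 0 <= F y)%E -> lebRd F = (\int[Leb]_y F y)%E.
Proof.
move=> mF F0; rewrite ge0_integral_image_measure// -iintE//.
exact: (measurableT_comp mF measurable_seq_col).
Qed.

End borel_vectors.

(** * Affine changes of variables in one and several dimensions *)

Section affine_change_of_variables.
Context {R : realType}.
Local Notation lam := (@lebesgue_measure R).

(** The right-hand side is a measure in [A] that gives half-open intervals their length, and this
    determines Lebesgue measure. For negative [c] the preimage of a half-open interval is closed at
    the other end, with the same length. *)
Lemma lebesgue_measure_affine (a c : R) (A : set R) : c != 0 -> measurable A ->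
  lam A = (`|c|%:E * lam ((fun t => (a + c * t)%R) @^-1` A))%E.
Proof.
move=> c0 mA.
have maff : measurable_fun [set: measurableTypeR R] (fun t : measurableTypeR R => (a + c * t)%R : measurableTypeR R).
  by apply: measurable_funD => //; exact: measurable_funM.
pose k : {nonneg R} := NngNum (normr_ge0 c).
have := @lebesgue_measure_unique R (mscale k (image_measure lam maff)).
apply => // _ [[x y] _ <-] /=.
rewrite lebesgue_measure_itv /= /mscale/= image_measureE.
have [cp|cn|ce] := ltrgtP 0 c; last by rewrite -ce eqxx in c0.
- have -> : (fun t : R => a + c * t) @^-1` `]x, y] = `](x - a) / c, (y - a) / c]%classic.
    apply/seteqP; split => t /=; rewrite !in_itv/= ltr_pdivrMr// ler_pdivlMr//;
    by move=> /andP[h1 h2]; apply/andP; split; lra.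
  rewrite [X in (_ * X)%E]lebesgue_measure_itv/= !lte_fin ltr_pM2r ?invr_gt0// ltrD2r.
  case: ifP => _; last by rewrite mule0.
  rewrite -EFinB -EFinM gtr0_norm//; congr EFin; field; lra.
- have -> : (fun t : R => a + c * t) @^-1` `]x, y] = `[(y - a) / c, (x - a) / c[%classic.
    apply/seteqP; split => t /=; rewrite !in_itv/= ltr_ndivlMr// ler_ndivrMr//;
    by move=> /andP[h1 h2]; apply/andP; split; lra.
  rewrite [X in (_ * X)%E]lebesgue_measure_itv/= !lte_fin ltr_nM2r ?invr_lt0// ltrD2r.
  case: ifP => _; last by rewrite mule0.
  rewrite -EFinB -EFinM ltr0_norm//; congr EFin; field; lra.
exact: maff.
Qed.

Lemma ge0_integral_affine (a c : R) (F : R -> \bar R) : c != 0 ->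
  measurable_fun [set: R] F -> (forall t, 0 <= F t)%E ->
  (\int[lam]_t F t = `|c|%:E * \int[lam]_t F (a + c * t)%R)%E.
Proof.
move=> c0 mF F0.
have maff : measurable_fun [set: measurableTypeR R] (fun t : measurableTypeR R => (a + c * t)%R : measurableTypeR R).
  by apply: measurable_funD => //; exact: measurable_funM.
pose k : {nonneg R} := NngNum (normr_ge0 c).
rewrite (@eq_measure_integral _ _ _ _ (mscale k (image_measure lam maff))).
  by rewrite ge0_integral_mscale//= ge0_integral_image_measure.
by move=> A mA _; exact: (lebesgue_measure_affine a c0 mA).
Qed.

Definition seq_affine n (a c : nat -> R) (s : seqR) : seqR :=
  fun k => if (k < n)%N then a k + c k * s k else s k.

Lemma measurable_seq_affine n a c : measurable_fun [set: seqR] (seq_affine n a c).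
Proof.
apply: measurable_fun_seqR => k; rewrite /seq_affine.
case: (k < _)%N; last exact: measurable_coord.
by apply: measurable_funD => //; apply: measurable_funM => //; exact: measurable_coord.
Qed.

(** Each coordinate has its own factor, so that one formula serves both the dilations [q + s z] and
    the reflections [flip]. *)
Lemma iint_affine n (a c : nat -> R) (F : seqR -> \bar R) :
  (forall k, c k != 0) -> measurable_fun [set: seqR] F -> (forall s, 0 <= F s)%E ->
  iint n F = ((\prod_(k < n) `|c k|)%:E * iint n (fun s => F (seq_affine n a c s)))%E.
Proof.
move=> c0; elim: n F => [|n IH] F mF F0 /=; first by rewrite big_ord0 mul1e.
rewrite IH; [|exact: (measurable_inner n)|by move=> s; exact: integral_ge0].
rewrite big_ord_recr/= EFinM -muleA; congr (_ * _)%E.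
rewrite -iintZ//; first last.
- by move=> s; exact: integral_ge0.
- apply: (measurable_inner n (F := fun s => F (seq_affine n.+1 a c s))) => //.
  exact: (measurableT_comp mF (measurable_seq_affine n.+1 a c)).
congr iint; apply/funext => s.
rewrite (ge0_integral_affine (a n) (c0 n))//; last first.
  exact: (measurable_upd_section n (seq_affine n a c s) mF).
congr (_ * _)%E; apply: eq_integral => t _; congr F; apply/funext => k.
by rewrite /seq_affine ltnS; case: (ltngtP k n) => [//|//|->].
Qed.

Lemma iint_prod n (f : nat -> R -> R) (m : nat -> R) :
  (forall k, measurable_fun [set: R] (f k)) -> (forall k t, 0 <= f k t) ->
  (forall k, \int[lam]_t (f k t)%:E = (m k)%:E)%E ->
  iint n (fun s => (\prod_(k < n) f k (s k))%:E) = (\prod_(k < n) m k)%:E.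
Proof.
move=> mf f0 fm.
have m0 k : 0 <= m k by rewrite -lee_fin -fm integral_ge0// => t _; rewrite lee_fin.
elim: n => [|n IH] /=; first by rewrite !big_ord0.
rewrite [in RHS]big_ord_recr/= mulrC EFinM -IH -iintZ//.
- congr iint; apply/funext => s; rewrite muleC -fm -ge0_integralZl_EFin//.
  + apply: eq_integral => t _; rewrite big_ord_recr/= eqxx -EFinM; congr (_ * _)%:E.
    by apply: eq_bigr => i _; rewrite ltn_eqF.
  + by move=> t _; rewrite lee_fin.
  + by have /measurable_EFinP mfn := mf n; exact: mfn.
  + by apply: prodr_ge0 => i _.
- apply/measurable_EFinP; apply: measurable_prod => i _.
  exact: measurableT_comp (mf _) (measurable_coord _).
- by move=> s; rewrite lee_fin; apply: prodr_ge0.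
Qed.

End affine_change_of_variables.

(** * Gaussian integrals *)

Section elementary_bounds.
Context {R : realType}.
Implicit Types x y a b c u : R.

(** Phrased by distances to [a]: both orders of [a] and [b] are covered, and the derivative is
    required only on the interval around [a] that reaches [b], which is what [taylor1] can offer. *)
Lemma mean_value_local (f df : R -> R) a b :
  (forall x, `|x - a| <= `|b - a| -> is_derive x 1 f (df x)) ->
  exists c, (`|c - a| <= `|b - a|) /\ f b - f a = df c * (b - a).
Proof.
move=> fdf.
have [ab|ba] := leP a b.
  have ine x : x \in `[a, b] -> `|x - a| <= `|b - a|.
    by rewrite in_itv/= => /andP[ax xb]; rewrite !ger0_norm; lra.
  have [c ci E] := @MVT_segment R f df a b ab (fun x xi => fdf x (ine x (subset_itv_oo_cc xi)))
    (derivable_within_continuous (fun x xi => @ex_derive _ _ _ _ _ _ _ (fdf x (ine x xi)))).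
  by exists c; split => //; exact: ine.
have ine x : x \in `[b, a] -> `|x - a| <= `|b - a|.
  by rewrite in_itv/= => /andP[ax xb]; rewrite !ler0_norm; lra.
have [c ci E] := @MVT_segment R f df b a (ltW ba) (fun x xi => fdf x (ine x (subset_itv_oo_cc xi)))
  (derivable_within_continuous (fun x xi => @ex_derive _ _ _ _ _ _ _ (fdf x (ine x xi)))).
exists c; split; first exact: ine.
by rewrite -[LHS]opprB E; ring.
Qed.

Lemma mean_value (f df : R -> R) a b : (forall x, is_derive x 1 f (df x)) ->
  exists c, (`|c - a| <= `|b - a|) /\ f b - f a = df c * (b - a).
Proof. by move=> fdf; apply: mean_value_local. Qed.

Lemma dist_sin x y : `|sin x - sin y| <= `|x - y|.
Proof.
have [c [_ ->]] := @mean_value sin cos y x.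
by rewrite normrM ler_piMl// cos_max.
Qed.

(** [dist_sin], this bound, [sin_sub_id] and [cos_taylor2] each follow from the previous one by the
    mean value theorem. The constants are not sharp; only the powers matter later. *)
Lemma cos_sub1 x : `|cos x - 1| <= x ^+ 2.
Proof.
have [c [cx E]] := @mean_value cos (fun z => - sin z) 0 x.
rewrite !subr0 cos0 in cx E.
rewrite E normrM normrN -real_normK ?num_real// expr2 ler_wpM2r//.
by have := dist_sin c 0; rewrite sin0 !subr0 => /le_trans; apply.
Qed.

Lemma sin_sub_id x : `|sin x - x| <= `|x| ^+ 3.
Proof.
have [c [cx E]] := @mean_value (fun z => sin z - z) (fun z => cos z - 1) 0 x.
rewrite !subr0 sin0 !subr0 in cx E.
rewrite E normrM exprSr ler_wpM2r//.
rewrite (le_trans (cos_sub1 c))// -real_normK ?num_real//.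
by rewrite ler_pXn2r// nnegrE.
Qed.

Lemma cos_taylor2 x : `|cos x - 1 + x ^+ 2 / 2| <= `|x| ^+ 4.
Proof.
have [|c [cx E]] := @mean_value (fun z => cos z - 1 + z ^+ 2 / 2) (fun z => - sin z + z) 0 x.
  move=> z; apply: is_derive_eq.
  by rewrite /GRing.scale/= mulr1; field.
rewrite !subr0 cos0 expr0n/= mul0r addr0 subrr subr0 in cx E.
rewrite E normrM exprSr ler_wpM2r// -normrN opprD opprK.
rewrite (le_trans (sin_sub_id c))//.
by rewrite ler_pXn2r// nnegrE.
Qed.

Lemma expRN_taylor1 x : 0 <= x -> `|expR (- x) - (1 - x)| <= x ^+ 2.
Proof.
move=> x0; have h := expR_ge1Dx (- x).
rewrite ger0_norm; last by lra.
have h2 := expR_ge1Dx x.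
have : expR (- x) * (1 + x) <= 1.
  by rewrite -[leRHS](expRxMexpNx_1 x) mulrC ler_wpM2r// expR_ge0.
have := expR_ge0 (- x); nra.
Qed.

(** Keeping the factor [expR (- c)] lets the difference of two Gaussian weights stay dominated by a
    Gaussian, as needed in [tilted_slope_le]. *)
Lemma expRN_dist a b c : c <= a -> c <= b -> `|expR (- a) - expR (- b)| <= `|a - b| * expR (- c).
Proof.
wlog ab : a b / a <= b.
  move=> H ca cb; have [ab|ba] := leP a b; first exact: H.
  by rewrite distrC (distrC a); apply: H => //; exact: ltW.
move=> ca cb.
rewrite ger0_norm; last by rewrite subr_ge0 ler_expR lerN2.
rewrite ler0_norm; last by lra.
have h1 := expR_ge1Dx (- (b - a)).
have h2 : expR (- a) <= expR (- c) by rewrite ler_expR lerN2.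
have h3 : 0 < expR (- a) by exact: expR_gt0.
have -> : expR (- b) = expR (- a) * expR (- (b - a)) by rewrite -expRD; congr expR; ring.
have : expR (- (b - a)) <= 1 by rewrite -expR0 ler_expR; lra.
nra.
Qed.

Lemma poly_le_expR k (e : R) : 0 < e ->
  exists2 C, 0 < C & forall u, 0 <= u -> (1 + u) ^+ k <= C * expR (e * u).
Proof.
(* With this [M], [1 + u <= M * expR (e * u / k.+1)], and the [k]-th power has exponent at most
   [e * u]. The successor avoids a division by 0 when [k = 0]. *)
move=> e0; pose M := 1 + k.+1%:R / e.
have k0 : (0 : R) < k.+1%:R by [].
have M1 : 1 <= M by rewrite lerDl divr_ge0// ltW.
exists (M ^+ k); first by rewrite exprn_gt0//; lra.
move=> u u0.
pose v := e * u / k.+1%:R.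
have v0 : 0 <= v by rewrite divr_ge0// mulr_ge0// ltW.
have h : 1 + u <= M * expR v.
  apply: (@le_trans _ _ (M * (1 + v))); last by rewrite ler_wpM2l ?expR_ge1Dx//; lra.
  have -> : M * (1 + v) = 1 + u + (v + k.+1%:R / e).
    by rewrite /M /v; field; apply/andP; split; lra.
  by rewrite lerDl addr_ge0// divr_ge0// ltW.
apply: (@le_trans _ _ ((M * expR v) ^+ k)); first by rewrite lerXn2r// nnegrE; lra.
rewrite exprMn ler_wpM2l ?exprn_ge0//; first lra.
rewrite -expRM_natl ler_expR /v.
rewrite mulrA ler_pdivrMr// mulrC ler_wpM2l ?ler_nat//.
by rewrite mulr_ge0// ltW.
Qed.

End elementary_bounds.

Section dominated_real.
Context d (T : measurableType d) (R : realType) (mu : {measure set T -> \bar R}).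

Lemma integrable_dominated (f g : T -> R) : measurable_fun [set: T] f ->
  mu.-integrable [set: T] (EFin \o g) -> (forall x, `|f x| <= g x) ->
  mu.-integrable [set: T] (EFin \o f).
Proof.
move=> mf ig fg; apply: (le_integrable _ _ _ ig) => //; first exact/measurable_EFinP.
by move=> x _; rewrite /= lee_fin (le_trans (fg x))// ler_norm.
Qed.

Lemma dominated_convergence_real (f_ : nat -> T -> R) (f g : T -> R) :
  (forall n, measurable_fun [set: T] (f_ n)) ->
  (forall x, f_ ^~ x @ \oo --> f x) ->
  mu.-integrable [set: T] (EFin \o g) -> (forall n x, `|f_ n x| <= g x) ->
  mu.-integrable [set: T] (EFin \o f) /\
  (fun n => \int[mu]_x f_ n x) @ \oo --> \int[mu]_x f x.
Proof.
move=> mf_ cf ig fg.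
have mf : measurable_fun [set: T] f by apply: (measurable_fun_cvg mf_) => x _; exact: cf.
have [|||//||int_f _ cvg_f] := @dominated_convergence _ T R mu setT measurableT
  (fun n => EFin \o f_ n) (EFin \o f) (EFin \o g).
- by move=> n; exact/measurable_EFinP.
- exact/measurable_EFinP.
- by apply/aeW => x _; apply: cvg_EFin; [exact: nearW|exact: cf].
- by apply/aeW => x n _; rewrite /= lee_fin.
split => //.
apply: fine_cvg; rewrite fineK; first exact: cvg_f.
exact: integrable_fin_num.
Qed.

End dominated_real.

(** * Gaussian integrals on the line *)

Section gaussian_line.
Context {R : realType}.
Local Notation mu := (@lebesgue_measure R).
Implicit Types (f F : R -> R).

Lemma measurable_gauss c : measurable_fun [set: R] (fun t : R => expR (- (c * t ^+ 2))).
Proof.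
apply: measurableT_comp => //; apply: measurableT_comp => //.
by apply: measurable_funM => //; exact: measurable_funX.
Qed.

Lemma integral_gauss c : 0 < c ->
  (\int[mu]_t (expR (- (c * t ^+ 2)))%:E = (Num.sqrt (pi / c))%:E)%E.
Proof.
move=> c0; have s0 : Num.sqrt c != 0 by rewrite gt_eqF// sqrtr_gt0.
have := @integralT_gauss R.
rewrite (ge0_integral_affine 0 s0); first last.
- by move=> t; rewrite lee_fin gauss_fun_ge0.
- by apply/measurable_EFinP; exact: measurable_gauss_fun.
under eq_integral => t _.
  rewrite /gauss_fun add0r exprMn sqr_sqrtr; last exact: ltW.
  over.
move=> H.
rewrite -[LHS]mul1e -(@mulVf R `|Num.sqrt c|) ?normr_eq0// EFinM -muleA H -EFinM.
by rewrite ger0_norm ?sqrtr_ge0// mulrC sqrtrM ?pi_ge0// sqrtrV// ltW.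
Qed.

Lemma integrable_gauss c : 0 < c ->
  mu.-integrable [set: R] (fun t => (expR (- (c * t ^+ 2)))%:E).
Proof.
move=> c0; apply/integrableP; split; first by apply/measurable_EFinP; exact: measurable_gauss.
under eq_integral do rewrite /= ger0_norm ?expR_ge0//.
by rewrite integral_gauss// ltry.
Qed.

(** Half of the exponent absorbs the polynomial and the other half remains for integrability; this
    is the source of every dominating function below. *)
Lemma poly_gauss_le k (c : R) : 0 < c -> exists2 C, 0 < C & forall u, 0 <= u ->
  (1 + u) ^+ k * expR (- (c * u)) <= C * expR (- (c / 2 * u)).
Proof.
move=> c0; have [C C0 CP] := @poly_le_expR R k (c / 2) (divr_gt0 c0 (ltr0n _ 2)).
exists C => // u u0.
have -> : expR (- (c * u)) = expR (- (c / 2 * u)) * expR (- (c / 2 * u)).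
  by rewrite -expRD; congr expR; field.
rewrite mulrA ler_wpM2r ?expR_ge0//.
have : (1 + u) ^+ k * expR (- (c / 2 * u)) <= C * expR (c / 2 * u) * expR (- (c / 2 * u)).
  by rewrite ler_wpM2r ?expR_ge0// CP.
by rewrite -[X in _ <= X]mulrA expRxMexpNx_1 mulr1.
Qed.

Lemma integrable_poly_gauss f k (c K : R) : 0 < c -> measurable_fun [set: R] f ->
  (forall t, `|f t| <= K * ((1 + t ^+ 2) ^+ k * expR (- (c * t ^+ 2)))) ->
  mu.-integrable [set: R] (EFin \o f).
Proof.
move=> c0 mf fK; have c20 : 0 < c / 2 by rewrite divr_gt0.
have K0 : 0 <= K.
  by have := fK 0; rewrite expr0n/= mulr0 oppr0 expR0 addr0 expr1n !mulr1; apply: le_trans.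
have [C C0 CP] := poly_gauss_le k c0.
apply: (@integrable_dominated _ (measurableTypeR R) R mu f (fun t => K * C * expR (- (c / 2 * t ^+ 2)))) => //.
  have := integrableZl measurableT (K * C) (integrable_gauss c20).
  by apply: eq_integrable => // t _; rewrite EFinM.
by move=> t; rewrite (le_trans (fK t))// -mulrA ler_wpM2l// CP// sqr_ge0.
Qed.

(** The sign [s] treats both ends of the line at once. The rate [1 / n], from [1 + y <= expR y], is
    enough. *)
Lemma gauss_decay F k (c K : R) (s : R) : 0 < c -> `|s| = 1 ->
  (forall t, `|F t| <= K * ((1 + t ^+ 2) ^+ k * expR (- (c * t ^+ 2)))) ->
  (fun n : nat => F (s * n%:R)) @ \oo --> 0.
Proof.
move=> c0 s1 FK; have c20 : 0 < c / 2 by rewrite divr_gt0.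
have K0 : 0 <= K.
  by have := FK 0; rewrite expr0n/= mulr0 oppr0 expR0 addr0 expr1n !mulr1; apply: le_trans.
have [C C0 CP] := poly_gauss_le k c0.
rewrite -cvg_shiftS.
apply: (@squeeze_cvgr _ _ _ _ (fun n => - (K * C * (2 / c) * harmonic n)) (fun n => K * C * (2 / c) * harmonic n)).
- apply: nearW => n; rewrite -ler_norml (le_trans (FK _))//.
  set t := s * n.+1%:R.
  have tn : t ^+ 2 = n.+1%:R ^+ 2.
    by rewrite /t exprMn -[s ^+ 2]real_normK ?num_real// s1 expr1n mul1r.
  have E2 : expR (- (c / 2 * t ^+ 2)) <= (2 / c) * harmonic n.
    rewrite tn expRN /harmonic/= -[2 / c]invf_div -invfM lef_pV2 ?posrE ?expR_gt0//.
      have := expR_ge1Dx (c / 2 * n.+1%:R ^+ 2).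
      have : (1 : R) <= n.+1%:R by rewrite ler1n.
      move: (n.+1%:R : R) => m m1 h; rewrite (le_trans _ h)// mulrC.
      rewrite mulrC (@le_trans _ _ (c / 2 * m ^+ 2)) ?lerDr//.
      by rewrite ler_pM2l// expr2 ler_peMl// (le_trans ler01 m1).
    by rewrite mulr_gt0.
  rewrite -!mulrA ler_wpM2l// (le_trans (CP _ (sqr_ge0 t)))//.
  by rewrite ler_pM2l// mulrA.
- rewrite -[X in _ --> X]oppr0 -(mulr0 (K * C * (2 / c))).
  by apply: cvgN; apply: cvgMr; exact: cvg_harmonic.
- rewrite -[X in _ --> X](mulr0 (K * C * (2 / c))).
  by apply: cvgMr; exact: cvg_harmonic.
Qed.

(** The fundamental theorem of calculus on growing symmetric intervals, whose boundary terms vanish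
    by [gauss_decay]. It stands in for integration by parts: it is applied to the antiderivatives
    [- t g] and [- sin (s t) g]. *)
Lemma Rintegral_derivative F f k (c K : R) : 0 < c ->
  (forall t, is_derive t (1 : R) F (f t)) -> continuous f ->
  (forall t, `|F t| <= K * ((1 + t ^+ 2) ^+ k * expR (- (c * t ^+ 2)))) ->
  (forall t, `|f t| <= K * ((1 + t ^+ 2) ^+ k * expR (- (c * t ^+ 2)))) ->
  \int[mu]_t f t = 0.
Proof.
move=> c0 Ff cf FK fK.
have mf : measurable_fun [set: R] f by exact: continuous_measurable_fun.
have cF : continuous F.
  move=> t; apply: differentiable_continuous.
  by apply/derivable1_diffP; exact: (@ex_derive _ _ _ _ _ _ _ (Ff t)).
have intf := integrable_poly_gauss c0 mf fK.
pose f_ (n : nat) t := f t * \1_(`[- n.+1%:R, n.+1%:R]%classic) t.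
have mf_ n : measurable_fun [set: R] (f_ n) by apply: measurable_funM => //; exact: measurable_indic.
have cf_ t : f_ ^~ t @ \oo --> f t.
  apply: cvg_near_cst; near=> n.
  rewrite /f_ indicE mem_set ?mulr1//= in_itv/= -ler_norml.
  rewrite (@le_trans _ _ n%:R) ?ler_nat//.
  by near: n; exact: nbhs_infty_ger.
have nf : mu.-integrable setT (EFin \o (fun t => `|f t|)) by exact: integrable_norm.
have f_f n t : `|f_ n t| <= `|f t|.
  by rewrite normrM indicE; case: (_ \in _); rewrite ?normr1 ?mulr1// normr0 mulr0.
have [_ H] := @dominated_convergence_real _ (measurableTypeR R) R mu f_ f (fun t => `|f t|) mf_ cf_ nf f_f.
have E n : \int[mu]_t f_ n t = F (1 * n.+1%:R) - F (-1 * n.+1%:R).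
  rewrite mul1r mulN1r.
  transitivity (\int[mu]_(t in `[(- n.+1%:R), n.+1%:R]) f t).
    rewrite [RHS]Rintegral_mkcond; apply: eq_Rintegral => t _.
    by rewrite /f_ patchE indicE; case: ifP => _; rewrite ?mulr1 ?mulr0.
  rewrite /Rintegral (@continuous_FTC2 _ f F)//.
  - by rewrite ltrNl; exact: (@lt_trans _ _ 0); rewrite ?oppr_lt0.
  - exact: continuous_subspaceT.
  - split => [t _||].
    + exact: (@ex_derive _ _ _ _ _ _ _ (Ff t)).
    + by apply: cvg_at_right_filter; exact: cF.
    + by apply: cvg_at_left_filter; exact: cF.
  - by move=> t _; rewrite derive1E; exact: (@derive_val _ _ _ _ _ _ _ (Ff t)).
have {}H : (fun n : nat => F (1 * n.+1%:R) - F (-1 * n.+1%:R)) @ \oo --> \int[mu]_t f t.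
  by under eq_fun do rewrite -E.
rewrite -(cvg_lim _ H)//; apply/cvg_lim => //.
rewrite -[X in _ --> X](subr0 0).
have h1 := gauss_decay c0 (normr1 _) FK.
have h2 := gauss_decay c0 (normrN1 _) FK.
by apply: cvgB; [move: h1|move: h2]; rewrite -cvg_shiftS.
Unshelve. all: end_near. Qed.

End gaussian_line.

Section odd_integral.
Context d (T : measurableType d) (R : realType) (mu : {measure set T -> \bar R}).
Variable phi : T -> T.
Hypothesis phi_inv : forall F : T -> \bar R, measurable_fun [set: T] F ->
  (forall x, 0 <= F x)%E -> (\int[mu]_x F (phi x) = \int[mu]_x F x)%E.

(** The measure-preserving map [phi] exchanges the positive and the negative part of [f], and
    integrability allows subtracting their equal integrals. *)
Lemma Rintegral_odd (f : T -> R) : (forall x, f (phi x) = - f x) ->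
  mu.-integrable [set: T] (EFin \o f) -> \int[mu]_x f x = 0.
Proof.
move=> fN intf; have mf := measurable_int _ intf.
rewrite /Rintegral -/(comp EFin f) integralE.
have -> : (\int[mu]_x (EFin \o f)^\- x = \int[mu]_x (EFin \o f)^\+ x)%E.
  rewrite -[RHS]phi_inv//; last exact: measurable_funepos.
  apply: eq_integral => x _.
  by rewrite funeposE funenegE/= fN.
rewrite subee//.
exact: integrable_pos_fin_num.
Qed.

End odd_integral.

(** * Second moment and Fourier transform of the Gaussian *)

Section gaussian_fourier.
Context {R : realType}.
Local Notation mu := (@lebesgue_measure R).
Local Notation g t := (expR (- (2^-1 * t ^+ 2))).

Let half_gt0 : (0 : R) < 2^-1. Proof. by rewrite invr_gt0. Qed.

Let continuous_g : continuous (fun t : R => g t).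
Proof.
move=> t; apply: continuous_comp; last exact: continuous_expR.
apply: cvgN; apply: cvgM; [exact: cvg_cst|exact: exprn_continuous].
Qed.

Lemma integrable_gauss_bounded (f : R -> R) (K : R) : measurable_fun [set: R] f ->
  (forall t, `|f t| <= K * (1 + t ^+ 2)) ->
  mu.-integrable [set: R] (fun t => (f t * g t)%:E).
Proof.
move=> mf fK; apply: (@integrable_poly_gauss _ (fun t => f t * g t) 1 2^-1 K) => //.
  by apply: measurable_funM => //; exact: measurable_gauss.
by move=> t; rewrite normrM mulrA [X in _ * X]ger0_norm ?expR_ge0// expr1 ler_wpM2r ?expR_ge0.
Qed.

Lemma Rintegral_gauss : \int[mu]_t (g t) = Num.sqrt (2 * pi) :> R.
Proof. by rewrite /Rintegral integral_gauss//= invrK mulrC. Qed.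

Lemma Rintegral_gauss2 : \int[mu]_t (t ^+ 2 * g t) = Num.sqrt (2 * pi) :> R.
Proof.
have i1 : mu.-integrable [set: R] (fun t => (t ^+ 2 * g t)%:E).
  apply: (@integrable_gauss_bounded _ 1) => [|t]; first exact: measurable_funX.
  by rewrite ger0_norm ?sqr_ge0// mul1r lerDr.
have i2 := integrable_gauss half_gt0.
have := @Rintegral_derivative R (fun t => - (t * g t)) (fun t => t ^+ 2 * g t - g t) 1 2^-1 1 half_gt0.
rewrite RintegralB// Rintegral_gauss => H; apply/eqP; rewrite -subr_eq0; apply/eqP; apply: H.
- move=> t; apply: is_derive_eq.
  by rewrite /GRing.scale/=; field.
- move=> t; apply: cvgB; last exact: continuous_g.
  by apply: cvgM; [exact: exprn_continuous|exact: continuous_g].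
- move=> t; rewrite normrN normrM mul1r expr1 [X in _ * X]ger0_norm ?expR_ge0// ler_wpM2r ?expR_ge0//.
  have := sqr_ge0 (`|t| - 1); rewrite sqrrB1 real_normK ?num_real// mulr2n; have := normr_ge0 t; lra.
- move=> t; rewrite -{2}[g t]mul1r -mulrBl normrM mul1r expr1 [X in _ * X]ger0_norm ?expR_ge0// ler_wpM2r ?expR_ge0//.
  have := sqr_ge0 t; rewrite ler_norml => ?; apply/andP; split; lra.
Qed.

Let mcos s : measurable_fun [set: R] (fun t : R => cos (s * t)).
Proof.
apply: continuous_measurable_fun => t; apply: continuous_comp; last exact: continuous_cos.
exact: mulrl_continuous.
Qed.

Let msin s : measurable_fun [set: R] (fun t : R => sin (s * t)).
Proof.
apply: continuous_measurable_fun => t; apply: continuous_comp; last exact: continuous_sin.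
exact: mulrl_continuous.
Qed.

Let icos s : mu.-integrable [set: R] (fun t => (cos (s * t) * g t)%:E).
Proof.
apply: (@integrable_gauss_bounded _ 1) => // t.
by rewrite mul1r (le_trans (cos_max _))// lerDl sqr_ge0.
Qed.

Let itsin s : mu.-integrable [set: R] (fun t => (t * sin (s * t) * g t)%:E).
Proof.
apply: (@integrable_gauss_bounded _ 1) => [|t]; first exact: measurable_funM.
rewrite mul1r normrM (@le_trans _ _ `|t|) ?ler_piMr ?sin_max//.
have := sqr_ge0 (`|t| - 1); rewrite sqrrB1 real_normK ?num_real// mulr2n; have := normr_ge0 t; lra.
Qed.

Let phi s := \int[mu]_t (cos (s * t) * g t).

Let Rintegral_tsin s : \int[mu]_t (t * sin (s * t) * g t) = s * phi s.
Proof.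
have iz : mu.-integrable [set: R] (fun t => (s * (cos (s * t) * g t))%:E).
  by have := integrableZl measurableT s (icos s); apply: eq_integrable => // t _; rewrite EFinM.
suff H : \int[mu]_t (t * sin (s * t) * g t - s * (cos (s * t) * g t)) = 0.
  have Z : \int[mu]_t (s * (cos (s * t) * g t)) = s * phi s.
    exact: (RintegralZl s measurableT (icos s)).
  have /eqP := etrans (esym (RintegralB measurableT (itsin s) iz)) H.
  by rewrite subr_eq0 => /eqP ->; exact: Z.
have lt1 (t : R) : `|t| <= 1 + t ^+ 2.
  have := sqr_ge0 (`|t| - 1); rewrite sqrrB1 real_normK ?num_real// mulr2n; have := normr_ge0 t; lra.
apply: (@Rintegral_derivative _ (fun t => - (sin (s * t) * g t)) _ 1 2^-1 (1 + `|s|)) => //.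
- move=> t; apply: is_derive_eq.
  by rewrite /GRing.scale/=; field.
- move=> t; apply: cvgB; first (apply: cvgM; last exact: continuous_g).
    apply: cvgM; first exact: cvg_id.
    apply: continuous_comp; last exact: continuous_sin; exact: mulrl_continuous.
  apply: cvgM; first exact: cvg_cst.
  apply: cvgM; last exact: continuous_g.
  apply: continuous_comp; last exact: continuous_cos; exact: mulrl_continuous.
- move=> t; rewrite normrN normrM mulrA expr1 [X in _ * X]ger0_norm ?expR_ge0// ler_wpM2r ?expR_ge0//.
  have := sin_max (s * t); have := sqr_ge0 t; have := normr_ge0 s; nra.
- move=> t; rewrite mulrA -mulrBl normrM mulrA expr1 [X in _ * X]ger0_norm ?expR_ge0// ler_wpM2r ?expR_ge0//.
  rewrite (le_trans (ler_normB _ _))// !normrM.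
  have := sin_max (s * t); have := cos_max (s * t); have := lt1 t; have := sqr_ge0 t; have := normr_ge0 s; have := normr_ge0 t.
  have := normr_ge0 (sin (s * t)); have := normr_ge0 (cos (s * t)); nra.
Qed.

Let cos_diff (a b : R) : `|cos (a + b) - cos a + b * sin a| <= 3 * b ^+ 2.
Proof.
have -> : cos (a + b) - cos a + b * sin a = cos a * (cos b - 1) - sin a * (sin b - b).
  by rewrite cosD; ring.
have sb : `|sin b - b| <= 2 * b ^+ 2.
  rewrite -[b ^+ 2]real_normK ?num_real//.
  have [b1|b1] := leP `|b| 1.
    rewrite (le_trans (sin_sub_id b))// exprS mulrC.
    have := sqr_ge0 `|b|; have := normr_ge0 b; nra.
  have := dist_sin b 0; rewrite sin0 !subr0 => h.
  rewrite (le_trans (ler_normB _ _))//; nra.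
rewrite (le_trans (ler_normB _ _))// !normrM.
have := cos_sub1 b; have := cos_max a; have := sin_max a; move: sb.
have := normr_ge0 (cos a); have := normr_ge0 (sin a); have := normr_ge0 (cos b - 1); have := normr_ge0 (sin b - b).
nra.
Qed.

(** Differentiation under the integral sign: by [cos_diff] the error of the difference quotient is
    at most [3 * |h|] times the second Gaussian moment. *)
Let is_derive_phi s : is_derive s (1 : R) phi (- (s * phi s)).
Proof.
suff H : h^-1 *: (phi (h *: (1 : R) + s) - phi s) @[h --> (0 : R)^'] --> - (s * phi s).
  by apply: DeriveDef; [apply/cvg_ex; exists (- (s * phi s))|exact: cvg_lim H].
apply/cvgrPdist_le => e e0; near=> h.
have h0 : h != 0 by near: h; exact: nbhs_dnbhs_neq.
pose M := 3 * Num.sqrt (2 * pi) : R.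
pose D t := cos ((h + s) * t) * g t - cos (s * t) * g t + h * (t * sin (s * t) * g t).
have iz : mu.-integrable [set: R] (fun t => (h * (t * sin (s * t) * g t))%:E).
  by have := integrableZl measurableT h (itsin s); apply: eq_integrable => // t _; rewrite EFinM.
have ib : mu.-integrable [set: R] (fun t => (cos ((h + s) * t) * g t - cos (s * t) * g t)%:E).
  by have := integrableB measurableT (icos (h + s)) (icos s); apply: eq_integrable.
have iD : mu.-integrable [set: R] (fun t => (D t)%:E).
  by have := integrableD measurableT ib iz; apply: eq_integrable.
have i3 : mu.-integrable [set: R] (fun t => ((3 * h ^+ 2) * (t ^+ 2 * g t))%:E).
  have : mu.-integrable [set: R] (fun t => (t ^+ 2 * g t)%:E).
    apply: (@integrable_gauss_bounded _ 1) => [|t]; first exact: measurable_funX.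
    by rewrite ger0_norm ?sqr_ge0// mul1r lerDr.
  by move=> /(integrableZl measurableT (3 * h ^+ 2)); apply: eq_integrable => // t _; rewrite EFinM.
have ED : \int[mu]_t D t = phi (h + s) - phi s + h * (s * phi s).
  have Z : \int[mu]_t (h * (t * sin (s * t) * g t)) = h * (s * phi s).
    by rewrite (RintegralZl h measurableT (itsin s)) Rintegral_tsin.
  apply: (etrans (RintegralD measurableT ib iz)); congr (_ + _); last exact: Z.
  exact: (RintegralB measurableT (icos (h + s)) (icos s)).
have -> : - (s * phi s) - h^-1 *: (phi (h *: 1 + s) - phi s) = - (h^-1 * \int[mu]_t D t).
  by rewrite ED /GRing.scale/= mulr1; field.
rewrite normrN normrM normfV ler_pdivrMl ?normr_gt0//.
rewrite (le_trans (le_normr_Rintegral _ iD))//.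
apply: (@le_trans _ _ (\int[mu]_t ((3 * h ^+ 2) * (t ^+ 2 * g t)))).
  apply: le_Rintegral => //; first exact: integrable_norm.
  move=> t _; rewrite /D.
  have -> : cos ((h + s) * t) * g t - cos (s * t) * g t + h * (t * sin (s * t) * g t) =
    (cos (s * t + h * t) - cos (s * t) + (h * t) * sin (s * t)) * g t.
    by have -> : (h + s) * t = s * t + h * t; ring.
  rewrite normrM [X in _ * X]ger0_norm ?expR_ge0// [leRHS]mulrA ler_wpM2r ?expR_ge0//.
  by rewrite (le_trans (cos_diff _ _))// exprMn mulrA.
have i2 : mu.-integrable [set: R] (fun t => (t ^+ 2 * g t)%:E).
  apply: (@integrable_gauss_bounded _ 1) => [|t]; first exact: measurable_funX.
  by rewrite ger0_norm ?sqr_ge0// mul1r lerDr.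
rewrite (RintegralZl (3 * h ^+ 2) measurableT i2) Rintegral_gauss2 mulrAC -/M -real_normK ?num_real// expr2 mulrA mulrC ler_wpM2l//.
rewrite mulrC -ler_pdivlMr//; last by rewrite /M mulr_gt0// sqrtr_gt0 mulr_gt0// pi_gt0.
near: h; apply: dnbhs0_le.
by rewrite divr_gt0// mulr_gt0// sqrtr_gt0 mulr_gt0// pi_gt0.
Unshelve. all: end_near. Qed.

(** The equation [phi' = - s phi] makes [expR (s ^+ 2 / 2) * phi s] constant, and its value is read
    at 0. *)
Lemma Rintegral_cos_gauss s : phi s = Num.sqrt (2 * pi) * expR (- (2^-1 * s ^+ 2)).
Proof.
have d0 t : is_derive t (1 : R) (fun t => expR (2^-1 * t ^+ 2) * phi t) 0.
  have := is_derive_phi t => ?.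
  apply: is_derive_eq.
  by rewrite /GRing.scale/=; field.
have := @is_derive_0_is_cst R _ s 0 d0.
rewrite expr0n/= mulr0 expR0 mul1r {2}/phi.
under [in X in _ = X -> _]eq_Rintegral do rewrite mul0r cos0 mul1r.
rewrite Rintegral_gauss => <-.
by rewrite mulrAC expRxMexpNx_1 mul1r.
Qed.

Lemma Rintegral_sin_gauss s : \int[mu]_t (sin (s * t) * g t) = 0.
Proof.
apply: (@Rintegral_odd _ (measurableTypeR R) R mu -%R) => //.
- move=> F mF F0.
  have N1 : (-1 : R) != 0 by rewrite oppr_eq0 oner_eq0.
  rewrite [RHS](ge0_integral_affine 0 N1)// normrN1 mul1e.
  by apply: eq_integral => t _; rewrite add0r mulN1r.
- by move=> t; rewrite mulrN sinN sqrrN mulNr.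
- apply: (@integrable_gauss_bounded _ 1) => // t.
  by rewrite mul1r (le_trans (sin_max _))// lerDl sqr_ge0.
Qed.

End gaussian_fourier.

Lemma continuous_sumr (R : realType) (T : topologicalType) (I : Type) (r : seq I)
  (f : I -> T -> R) : (forall i, continuous (f i)) ->
  continuous (fun x => \sum_(i <- r) f i x).
Proof.
move=> cf; elim: r => [|i r IH] x.
  by rewrite (_ : (fun x => _) = cst 0); [exact: cvg_cst|apply/funext => y; rewrite big_nil].
rewrite (_ : (fun x => _) = (fun x => f i x + \sum_(j <- r) f j x)).
  by apply: cvgD; [exact: cf|exact: IH].
by apply/funext => y; rewrite big_cons.
Qed.

(** * Euclidean scalar product and norm *)

Section euclidean_vectors.
Context {R : realType} {d : nat}.
Implicit Types (u v w : 'cV[R]_d) (a b : R).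

Lemma dotvC u v : dotv u v = dotv v u.
Proof. by apply: eq_bigr => j _; rewrite mulrC. Qed.

Lemma dotvDr u v w : dotv u (v + w) = dotv u v + dotv u w.
Proof. by rewrite -big_split/=; apply: eq_bigr => j _; rewrite mxE mulrDr. Qed.

Lemma dotvZr a u v : dotv u (a *: v) = a * dotv u v.
Proof. by rewrite mulr_sumr; apply: eq_bigr => j _; rewrite mxE mulrCA. Qed.

Lemma dotvNr u v : dotv u (- v) = - dotv u v.
Proof. by rewrite -scaleN1r dotvZr mulN1r. Qed.

Lemma dotvBr u v w : dotv u (v - w) = dotv u v - dotv u w.
Proof. by rewrite dotvDr dotvNr. Qed.

Lemma dotvDl u v w : dotv (u + v) w = dotv u w + dotv v w.
Proof. by rewrite !(dotvC _ w) dotvDr. Qed.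

Lemma dotvZl a u v : dotv (a *: u) v = a * dotv u v.
Proof. by rewrite !(dotvC _ v) dotvZr. Qed.

Lemma dotvNl u v : dotv (- u) v = - dotv u v.
Proof. by rewrite !(dotvC _ v) dotvNr. Qed.

Lemma dotvBl u v w : dotv (u - v) w = dotv u w - dotv v w.
Proof. by rewrite !(dotvC _ w) dotvBr. Qed.

Lemma dotv0r u : dotv u 0 = 0.
Proof. by rewrite -(scale0r 0) dotvZr mul0r. Qed.

Lemma dotv_sumr u (I : Type) (r : seq I) (F : I -> 'cV[R]_d) :
  dotv u (\sum_(i <- r) F i) = \sum_(i <- r) dotv u (F i).
Proof. by elim/big_ind2: _ => [|x s y t <- <-|//]; rewrite ?dotv0r ?dotvDr. Qed.

Lemma dotv_mxE u v : dotv u v = (u^T *m v) 0 0.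
Proof. by rewrite mxE; apply: eq_bigr => j _; rewrite mxE. Qed.

Lemma dotv_mulmx (A : 'M[R]_d) u v : dotv u (A *m v) = dotv (A^T *m u) v.
Proof. by rewrite !dotv_mxE trmx_mul trmxK mulmxA. Qed.

Lemma dotvv_ge0 u : 0 <= dotv u u.
Proof. by apply: sumr_ge0 => j _; rewrite -expr2 sqr_ge0. Qed.

Lemma enorm_ge0 u : 0 <= enorm u. Proof. exact: sqrtr_ge0. Qed.

Lemma enorm_sqr u : enorm u ^+ 2 = dotv u u.
Proof. by rewrite sqr_sqrtr// dotvv_ge0. Qed.

Lemma normr_coord_le u j : `|u j 0| <= enorm u.
Proof.
rewrite -sqrtr_sqr ler_sqrt ?dotvv_ge0// /dotv (bigD1 j)//= -expr2 lerDl.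
by apply: sumr_ge0 => i _; rewrite -expr2 sqr_ge0.
Qed.

Lemma dotvv_eq0 u : dotv u u = 0 -> u = 0.
Proof.
move=> u0; apply/matrixP => i j; rewrite (ord1 j) mxE; apply/eqP.
by rewrite -normr_le0 (le_trans (normr_coord_le u i))// /enorm u0 sqrtr0.
Qed.

Lemma enormZ a u : enorm (a *: u) = `|a| * enorm u.
Proof. by rewrite /enorm dotvZl dotvZr mulrA -expr2 sqrtrM ?sqr_ge0// sqrtr_sqr. Qed.

Lemma enormN u : enorm (- u) = enorm u.
Proof. by rewrite -scaleN1r enormZ normrN1 mul1r. Qed.

Lemma dotv_le_enorm u v : dotv u v <= enorm u * enorm v.
Proof.
have [u0|u0] := eqVneq (enorm u) 0.
  have /dotvv_eq0-> : dotv u u = 0 by rewrite -enorm_sqr u0 expr0n.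
  by rewrite dotvC dotv0r mulr_ge0// enorm_ge0.
have [v0|v0] := eqVneq (enorm v) 0.
  have /dotvv_eq0-> : dotv v v = 0 by rewrite -enorm_sqr v0 expr0n.
  by rewrite dotv0r mulr_ge0// enorm_ge0.
have ua : 0 < enorm u by rewrite lt_neqAle eq_sym u0 enorm_ge0.
have va : 0 < enorm v by rewrite lt_neqAle eq_sym v0 enorm_ge0.
have := dotvv_ge0 (enorm v *: u - enorm u *: v).
rewrite dotvBr !dotvBl !dotvZl !dotvZr -!enorm_sqr (dotvC v u) => h.
have uv : 0 < enorm u * enorm v by rewrite mulr_gt0.
rewrite -(ler_pM2l uv); lra.
Qed.

Lemma normr_dotv_le u v : `|dotv u v| <= enorm u * enorm v.
Proof.
by rewrite ler_norml dotv_le_enorm andbT lerNl -dotvNl -(enormN u) dotv_le_enorm.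
Qed.

Lemma ler_enormD u v : enorm (u + v) <= enorm u + enorm v.
Proof.
rewrite -(@ler_pXn2r _ 2)// ?nnegrE ?enorm_ge0 ?addr_ge0 ?enorm_ge0//.
rewrite sqrrD !enorm_sqr dotvDr !dotvDl (dotvC v u) -mulr_natr.
have := dotv_le_enorm u v; lra.
Qed.

Lemma enormB u v : enorm (u - v) = enorm (v - u).
Proof. by rewrite -opprB enormN. Qed.

Lemma ler_dist_enorm u v : `|enorm u - enorm v| <= enorm (u - v).
Proof.
have h1 := ler_enormD (u - v) v; have h2 := ler_enormD (v - u) u.
rewrite !subrK in h1 h2; rewrite (enormB v) in h2.
by rewrite ler_norml; apply/andP; split; lra.
Qed.

Lemma enorm_le_sum u : enorm u <= \sum_(j < d) `|u j 0|.
Proof.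
rewrite -(@ler_pXn2r _ 2)// ?nnegrE ?enorm_ge0 ?sumr_ge0// enorm_sqr expr2 big_distrl/=.
apply: ler_sum => j _; rewrite -expr2 -real_normK ?num_real// expr2 ler_wpM2l//.
by rewrite (bigD1 j)//= lerDl sumr_ge0.
Qed.

Lemma dotv_continuous u : continuous (fun v : 'cV[R]_d => dotv u v).
Proof.
apply: continuous_sumr => j v.
have c := @coord_continuous R d 1 j 0 v; exact: (cvgM (cvg_cst (u j 0)) c).
Qed.

Lemma dotvv_continuous : continuous (fun v : 'cV[R]_d => dotv v v).
Proof.
apply: continuous_sumr => j v; have c := @coord_continuous R d 1 j 0 v; exact: (cvgM c c).
Qed.

Lemma enorm_continuous : continuous (fun v : 'cV[R]_d => enorm v).
Proof.
move=> v; apply: (@cvg_comp _ _ _ (fun v => dotv v v) Num.sqrt); first exact: dotvv_continuous.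
exact: sqrt_continuous.
Qed.

End euclidean_vectors.

(** * Dilations, reflections and products under Lebesgue measure on R^d *)

Section lebesgue_vectors.
Context {R : realType} {d : nat}.
Local Notation vec := (@vecB R d).
Local Notation lam := (@Leb R d).

Definition vec_affine (a : 'cV[R]_d) (c : nat -> R) (z : vec) : vec :=
  \col_(j < d) (a j 0 + c j * (z : 'cV[R]_d) j 0).

Lemma ge0_integral_Leb_affine (a : 'cV[R]_d) (c : nat -> R) (F : vec -> \bar R) :
  (forall k, c k != 0) -> measurable_fun [set: vec] F -> (forall y, 0 <= F y)%E ->
  (\int[lam]_y F y =
   (\prod_(j < d) `|c j|)%:E * \int[lam]_z F (vec_affine a c z))%E.
Proof.
move=> c0 mF F0.
have maff : measurable_fun [set: vec] (vec_affine a c).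
  apply: measurable_fun_vecB => j.
  rewrite (_ : (fun x => _) = (fun x : vec => a j 0 + c j * (x : 'cV[R]_d) j 0)).
    by apply: measurable_funD => //; apply: measurable_funM => //; exact: measurable_entry.
  by apply/funext => x; rewrite mxE.
rewrite /Leb ge0_integral_image_measure// ge0_integral_image_measure//; last exact: (measurableT_comp mF maff).
(* [iint_affine] takes a shift indexed by all naturals; beyond the dimension it is set to 0, where
   it is never read. *)
pose a' k : R := oapp (fun j => a j 0) 0 (insub k : option 'I_d).
rewrite -!iintE//; first last.
- exact: (measurableT_comp mF (measurable_seq_col)).
- exact: (measurableT_comp mF (measurableT_comp maff measurable_seq_col)).
rewrite (@iint_affine R d a' c)//; last exact: (measurableT_comp mF (measurable_seq_col)).
congr (_ * _)%E; congr iint; apply/funext => s; congr F.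
apply/matrixP => i j; rewrite !mxE /seq_affine ltn_ord.
by rewrite /a' valK/=.
Qed.

Lemma ge0_integral_Leb_scale (a : 'cV[R]_d) (s : R) (F : vec -> \bar R) : 0 < s ->
  measurable_fun [set: vec] F -> (forall y, 0 <= F y)%E ->
  (\int[lam]_y F y = (s ^+ d)%:E * \int[lam]_z F ((a + s *: (z : 'cV[R]_d))%R : vec))%E.
Proof.
move=> s0 mF F0; rewrite (@ge0_integral_Leb_affine a (fun=> s))//; last by move=> _; rewrite gt_eqF.
congr (_ * _)%E; first by rewrite prodr_const card_ord gtr0_norm.
by apply: eq_integral => z _; congr F; apply/matrixP => i j; rewrite !mxE (ord1 j).
Qed.

Definition flip (i : 'I_d) (z : vec) : vec := \col_(j < d) ((-1) ^+ (j == i) * (z : 'cV[R]_d) j 0).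

(** Reflections also preserve the Gaussian weight, so through [Rintegral_odd] they kill every
    monomial that is odd in some coordinate. *)
Lemma ge0_integral_flip (i : 'I_d) (F : vec -> \bar R) :
  measurable_fun [set: vec] F -> (forall y, 0 <= F y)%E ->
  (\int[lam]_z F (flip i z) = \int[lam]_z F z)%E.
Proof.
move=> mF F0; rewrite [RHS](@ge0_integral_Leb_affine 0 (fun k => (-1) ^+ (k == i :> nat)))//; last first.
  by move=> k; rewrite signr_eq0.
rewrite big1 ?mul1e; last by move=> j _; rewrite normrX normrN1 expr1n.
by apply: eq_integral => z _; congr F; apply/matrixP => k j; rewrite !mxE add0r.
Qed.

Lemma integral_Leb_prod (f : nat -> R -> R) (m : nat -> R) :
  (forall k, measurable_fun [set: R] (f k)) -> (forall k t, 0 <= f k t) ->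
  (forall k, \int[lebesgue_measure]_t (f k t)%:E = (m k)%:E)%E ->
  (\int[lam]_z (\prod_(k < d) f k ((z : 'cV[R]_d) k 0))%:E = (\prod_(k < d) m k)%:E)%E.
Proof.
move=> mf f0 fm; rewrite -(iint_prod d mf f0 fm).
have mp : measurable_fun [set: vec] (fun z => (\prod_(k < d) f k ((z : 'cV[R]_d) k 0))%:E : \bar R).
  apply/measurable_EFinP; apply: measurable_prod => i _.
  exact: (measurableT_comp (mf _) (measurable_entry i)).
rewrite /Leb ge0_integral_image_measure//; last by move=> z; rewrite lee_fin prodr_ge0.
rewrite -iintE//.
- by congr iint; apply/funext => s; congr EFin; apply: eq_bigr => k _; rewrite mxE.
- exact: (measurableT_comp mp measurable_seq_col).
- by move=> z; rewrite lee_fin prodr_ge0.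
Qed.

End lebesgue_vectors.

Section Rintegral_extra.
Context d (T : measurableType d) (R : realType) (mu : {measure set T -> \bar R}).
Implicit Types f g : T -> R.

Lemma integrable_sumr (I : Type) (r : seq I) (f : I -> T -> R) :
  (forall i, mu.-integrable [set: T] (EFin \o f i)) ->
  mu.-integrable [set: T] (EFin \o (fun x => \sum_(i <- r) f i x)).
Proof.
move=> intf; have := @integrable_sum _ _ _ mu setT measurableT I r xpredT
  (fun i => EFin \o f i) (fun i _ => intf i).
by apply: eq_integrable => // x _; rewrite /= sumEFin.
Qed.

Lemma Rintegral_sum (I : Type) (r : seq I) (f : I -> T -> R) :
  (forall i, mu.-integrable [set: T] (EFin \o f i)) ->
  \int[mu]_x (\sum_(i <- r) f i x) = \sum_(i <- r) \int[mu]_x f i x.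
Proof.
move=> intf; elim: r => [|i r IH].
  under eq_Rintegral do rewrite big_nil.
  by rewrite big_nil /Rintegral integral0.
under eq_Rintegral do rewrite big_cons.
rewrite big_cons -IH RintegralD//; exact: integrable_sumr.
Qed.

Lemma integrableZ (k : R) f : mu.-integrable [set: T] (EFin \o f) ->
  mu.-integrable [set: T] (EFin \o (fun x => k * f x)).
Proof.
by move=> /(integrableZl measurableT k); apply: eq_integrable => // x _; rewrite EFinM.
Qed.

Lemma integral_Rintegral f : mu.-integrable [set: T] (EFin \o f) ->
  (\int[mu]_x (f x)%:E = (\int[mu]_x f x)%:E)%E.
Proof. by move=> intf; rewrite /Rintegral fineK//; exact: integrable_fin_num. Qed.

End Rintegral_extra.

(** * Gaussian moments of degree at most four in R^d *)

Section gaussian_moments.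
Context {R : realType} {d : nat}.
Local Notation vec := (@vecB R d).
Local Notation lam := (@Leb R d).
Local Notation mu := (@lebesgue_measure R).
Local Notation cv z := (z : 'cV[R]_d).
Local Notation g t := (expR (- (2^-1 * t ^+ 2))).
Local Notation E z := (expR (- (2^-1 * dotv (cv z) (cv z)))).

Lemma measurable_dotv u : measurable_fun [set: vec] (fun z : vec => dotv u (cv z)).
Proof. by apply: continuous_measurable; exact: dotv_continuous. Qed.

Lemma measurable_dotvv : measurable_fun [set: vec] (fun z : vec => dotv (cv z) (cv z)).
Proof. by apply: continuous_measurable; exact: dotvv_continuous. Qed.

Lemma measurable_gauss_vec c : measurable_fun [set: vec] (fun z : vec => expR (- (c * dotv (cv z) (cv z)))).
Proof.
apply: measurableT_comp => //; apply: measurableT_comp => //.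
by apply: measurable_funM => //; exact: measurable_dotvv.
Qed.

Lemma expR_dotvv c (z : vec) :
  expR (- (c * dotv (cv z) (cv z))) = \prod_(k < d) expR (- (c * (cv z) k 0 ^+ 2)).
Proof. by rewrite -expR_sum mulr_sumr -sumrN; congr expR; apply: eq_bigr => k _; rewrite expr2. Qed.

Lemma integrable_gauss_vec c : 0 < c ->
  lam.-integrable [set: vec] (fun z => (expR (- (c * dotv (cv z) (cv z))))%:E).
Proof.
move=> c0; apply/integrableP; split; first by apply/measurable_EFinP; exact: measurable_gauss_vec.
under eq_integral do rewrite /= ger0_norm ?expR_ge0// expR_dotvv.
rewrite (@integral_Leb_prod R d (fun=> fun t => expR (- (c * t ^+ 2))) (fun=> Num.sqrt (pi / c))) ?ltry//.
- by move=> _; exact: measurable_gauss.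
- by move=> _; exact: integral_gauss.
Qed.

Lemma integrable_poly_gauss_vec (f : vec -> R) k (c K : R) : 0 < c -> measurable_fun [set: vec] f ->
  (forall z, `|f z| <= K * ((1 + dotv (cv z) (cv z)) ^+ k * expR (- (c * dotv (cv z) (cv z))))) ->
  lam.-integrable [set: vec] (EFin \o f).
Proof.
move=> c0 mf fK.
have K0 : 0 <= K.
  have := fK (0 : 'cV[R]_d); rewrite dotv0r mulr0 oppr0 expR0 addr0 expr1n !mulr1; exact: le_trans.
have [C C0 CP] := @poly_gauss_le R k c c0.
apply: (@integrable_dominated _ _ _ _ f (fun z => K * C * expR (- (c / 2 * dotv (cv z) (cv z))))) => //.
  by apply: integrableZ; apply: integrable_gauss_vec; rewrite divr_gt0.
by move=> z; rewrite (le_trans (fK z))// -mulrA ler_wpM2l// CP// dotvv_ge0.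
Qed.

Definition gauss_moment e : R := \int[mu]_t (t ^+ (e.*2) * g t).

Lemma gauss_moment0 : gauss_moment 0 = Num.sqrt (2 * pi).
Proof.
rewrite -Rintegral_gauss; apply: eq_Rintegral => t _.
by rewrite expr0 mul1r.
Qed.

Lemma gauss_moment1 : gauss_moment 1 = Num.sqrt (2 * pi).
Proof. exact: Rintegral_gauss2. Qed.

Lemma Rintegral_gauss_monomial (e : nat -> nat) :
  \int[lam]_z (\prod_(k < d) (cv z) k 0 ^+ (e k).*2 * E z) = \prod_(k < d) gauss_moment (e k).
Proof.
under eq_Rintegral do rewrite expR_dotvv -big_split/=.
rewrite /Rintegral (@integral_Leb_prod R d (fun k t => t ^+ (e k).*2 * g t) (fun k => gauss_moment (e k)))//.
- move=> k; apply: measurable_funM; [exact: measurable_funX|exact: measurable_gauss].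
- by move=> k t; rewrite mulr_ge0 ?expR_ge0// -mul2n exprM exprn_ge0// sqr_ge0.
- move=> k; apply: (@integral_Rintegral _ (measurableTypeR R) R mu (fun t => t ^+ (e k).*2 * g t)).
  apply: (@integrable_poly_gauss _ _ (e k) 2^-1 1) => //.
    by apply: measurable_funM; [exact: measurable_funX|exact: measurable_gauss].
  move=> t; rewrite mul1r normrM [X in _ * X]ger0_norm ?expR_ge0// ler_wpM2r ?expR_ge0//.
  have t2 := sqr_ge0 t.
  rewrite -mul2n exprM ger0_norm; last by rewrite exprn_ge0.
  by apply: lerXn2r; rewrite ?nnegrE ?addr_ge0// lerDr.
Qed.

Lemma Rintegral_gauss_vec : \int[lam]_z E z = Num.sqrt (2 * pi) ^+ d.
Proof.
have := Rintegral_gauss_monomial (fun=> 0%N).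
under eq_Rintegral => z _ do rewrite big1 ?mul1r//.
by move=> ->; rewrite prodr_const card_ord gauss_moment0.
Qed.

Lemma dotv_flip (i : 'I_d) z : dotv (cv (flip i z)) (cv (flip i z)) = dotv (cv z) (cv z).
Proof.
apply: eq_bigr => j _; rewrite !mxE mulrACA -expr2 -exprM mulnC exprM sqrrN expr1n expr1n.
by rewrite mul1r.
Qed.

Section even_weight.
Variable W : vec -> R.
Hypothesis Wflip : forall i z, W (flip i z) = W z.
Hypothesis intW1 : forall i, lam.-integrable [set: vec] (EFin \o (fun z => (cv z) i 0 * W z)).
Hypothesis intW2 : forall i j, lam.-integrable [set: vec] (EFin \o (fun z => (cv z) i 0 * (cv z) j 0 * W z)).

Lemma Rintegral_linear_even u : \int[lam]_z (dotv u (cv z) * W z) = 0.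
Proof.
transitivity (\int[lam]_z (\sum_(i < d) u i 0 * ((cv z) i 0 * W z))).
  apply: eq_Rintegral => z _; rewrite mulr_suml.
  by apply: eq_bigr => i _; rewrite mulrA.
rewrite Rintegral_sum; last by move=> i; exact: integrableZ.
rewrite big1// => i _; rewrite RintegralZl//.
rewrite (@Rintegral_odd _ vec R lam (flip i)) ?mulr0//.
- by move=> F mF F0; exact: ge0_integral_flip.
- by move=> z; rewrite Wflip mxE eqxx expr1 mulN1r mulNr.
Qed.

(** Off-diagonal terms are odd under [flip i], and the diagonal ones share the value [C]. The weight
    is kept general because it is used for the Gaussian and for the Gaussian times [dotv z z]. *)
Lemma Rintegral_quadratic_even C u v :
  (forall i, \int[lam]_z ((cv z) i 0 * (cv z) i 0 * W z) = C) ->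
  \int[lam]_z (dotv u (cv z) * dotv v (cv z) * W z) = dotv u v * C.
Proof.
move=> HC.
transitivity (\int[lam]_z (\sum_(i < d) (\sum_(j < d) u i 0 * v j 0 * ((cv z) i 0 * (cv z) j 0 * W z)))).
  apply: eq_Rintegral => z _; rewrite big_distrl/= mulr_suml; apply: eq_bigr => i _.
  rewrite mulr_sumr mulr_suml; apply: eq_bigr => j _; ring.
rewrite Rintegral_sum; last by move=> i; apply: integrable_sumr => j; exact: integrableZ.
rewrite [in RHS]/dotv mulr_suml; apply: eq_bigr => i _.
rewrite Rintegral_sum; last by move=> j; exact: integrableZ.
rewrite (bigD1 i)//= big1 ?addr0; first by rewrite RintegralZl// HC.
move=> j ji; rewrite RintegralZl//.
rewrite (@Rintegral_odd _ vec R lam (flip i)) ?mulr0//.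
- by move=> F mF F0; exact: ge0_integral_flip.
- by move=> z; rewrite Wflip !mxE eqxx (negbTE ji) expr1 expr0; ring.
Qed.

End even_weight.

Lemma integrable_monomial_gauss k (f : vec -> R) : measurable_fun [set: vec] f ->
  (forall z, `|f z| <= (1 + dotv (cv z) (cv z)) ^+ k) ->
  lam.-integrable [set: vec] (EFin \o (fun z => f z * E z)).
Proof.
move=> mf fk; apply: (@integrable_poly_gauss_vec _ k 2^-1 1) => //.
  by apply: measurable_funM => //; exact: measurable_gauss_vec.
by move=> z; rewrite mul1r normrM [X in _ * X]ger0_norm ?expR_ge0// ler_wpM2r ?expR_ge0.
Qed.

Lemma coord_le_1D (z : vec) i : `|(cv z) i 0| <= 1 + dotv (cv z) (cv z).
Proof.
have := normr_coord_le (cv z) i; rewrite -enorm_sqr; have := enorm_ge0 (cv z).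
have := sqr_ge0 (enorm (cv z) - 1); rewrite sqrrB1 mulr2n; lra.
Qed.

Lemma coord2_le (z : vec) i j : `|(cv z) i 0 * (cv z) j 0| <= dotv (cv z) (cv z).
Proof. by rewrite normrM -enorm_sqr expr2 ler_pM// normr_coord_le. Qed.

Let intE1 i : lam.-integrable [set: vec] (EFin \o (fun z => (cv z) i 0 * E z)).
Proof.
apply: (@integrable_monomial_gauss 1); first exact: measurable_entry.
by move=> z; rewrite expr1 coord_le_1D.
Qed.

Let intE2 i j : lam.-integrable [set: vec] (EFin \o (fun z => (cv z) i 0 * (cv z) j 0 * E z)).
Proof.
apply: (@integrable_monomial_gauss 1); first by apply: measurable_funM; exact: measurable_entry.
by move=> z; rewrite expr1 (le_trans (coord2_le _ _ _))// lerDr.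
Qed.

Let Eflip i z : E (flip i z) = E z. Proof. by rewrite dotv_flip. Qed.

Lemma Rintegral_gauss_linear u : \int[lam]_z (dotv u (cv z) * E z) = 0.
Proof. exact: Rintegral_linear_even. Qed.

Let prod_pow_eq (f : 'I_d -> R) (i : 'I_d) : \prod_(l < d) f l ^+ (l == i).*2 = f i * f i.
Proof.
by rewrite (bigD1 i)//= eqxx -expr2 big1 ?mulr1// => j /negbTE ->; rewrite expr0.
Qed.

Lemma Rintegral_gauss_quadratic u v :
  \int[lam]_z (dotv u (cv z) * dotv v (cv z) * E z) = dotv u v * Num.sqrt (2 * pi) ^+ d.
Proof.
apply: Rintegral_quadratic_even => // i.
transitivity (\prod_(l < d) gauss_moment (l == i)).
  rewrite -[RHS](Rintegral_gauss_monomial (fun k => (k == i :> nat) : nat)).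
  by apply: eq_Rintegral => z _; rewrite -(prod_pow_eq (fun l => (cv z) l 0)).
rewrite (eq_bigr (fun=> Num.sqrt (2 * pi))) ?prodr_const ?card_ord//.
by move=> j _; case: (_ == _); rewrite (gauss_moment0, gauss_moment1).
Qed.

Let E4flip i z : dotv (cv (flip i z)) (cv (flip i z)) * E (flip i z) = dotv (cv z) (cv z) * E z.
Proof. by rewrite dotv_flip. Qed.

Let intE41 i : lam.-integrable [set: vec] (EFin \o (fun z => (cv z) i 0 * (dotv (cv z) (cv z) * E z))).
Proof.
have : lam.-integrable [set: vec] (EFin \o (fun z => (cv z) i 0 * dotv (cv z) (cv z) * E z)).
  apply: (@integrable_monomial_gauss 2).
    by apply: measurable_funM; [exact: measurable_entry|exact: measurable_dotvv].
  move=> z; rewrite normrM expr2 ler_pM// ?coord_le_1D// ger0_norm ?dotvv_ge0// lerDr//.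
by apply: eq_integrable => // z _; rewrite /= mulrA.
Qed.

Let intE42 i j : lam.-integrable [set: vec] (EFin \o (fun z => (cv z) i 0 * (cv z) j 0 * (dotv (cv z) (cv z) * E z))).
Proof.
have : lam.-integrable [set: vec] (EFin \o (fun z => (cv z) i 0 * (cv z) j 0 * dotv (cv z) (cv z) * E z)).
  apply: (@integrable_monomial_gauss 2).
    apply: measurable_funM; last exact: measurable_dotvv.
    by apply: measurable_funM; exact: measurable_entry.
  move=> z; rewrite normrM expr2 ler_pM//.
    by rewrite (le_trans (coord2_le _ _ _))// lerDr.
  by rewrite ger0_norm ?dotvv_ge0// lerDr.
by apply: eq_integrable => // z _; rewrite /= !mulrA.
Qed.

(** By symmetry the integral is a multiple of [dotv u v]; the fourth moments that form the factor
    never have to be computed. In [laplace_tangential] this removes the term coming from the radius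
    in the exponent. *)
Lemma Rintegral_gauss_quartic u v : dotv u v = 0 ->
  \int[lam]_z (dotv u (cv z) * dotv v (cv z) * (dotv (cv z) (cv z) * E z)) = 0.
Proof.
move=> uv0.
have H4 i : \int[lam]_z ((cv z) i 0 * (cv z) i 0 * (dotv (cv z) (cv z) * E z)) =
    \sum_(k < d) \prod_(l < d) gauss_moment ((l == i) + (l == k)).
  transitivity (\int[lam]_z (\sum_(k < d) (\prod_(l < d) (cv z) l 0 ^+ ((l == i) + (l == k)).*2 * E z))).
    apply: eq_Rintegral => z _; rewrite mulrA mulr_sumr mulr_suml; apply: eq_bigr => k _.
    congr (_ * _); under eq_bigr do rewrite doubleD exprD.
    by rewrite big_split/= !(prod_pow_eq (fun l => (cv z) l 0)).
  rewrite Rintegral_sum.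
    apply: eq_bigr => k _.
    exact: (Rintegral_gauss_monomial (fun l => ((l == i :> nat) + (l == k :> nat))%N)).
  move=> k; have : lam.-integrable [set: vec] (EFin \o (fun z => ((cv z) i 0 ^+ 2 * (cv z) k 0 ^+ 2) * E z)).
    apply: (@integrable_monomial_gauss 2).
      by apply: measurable_funM; apply: measurable_funX; exact: measurable_entry.
    move=> z; rewrite -exprMn normrX lerXn2r ?nnegrE// ?addr_ge0 ?dotvv_ge0//.
    by rewrite (le_trans (coord2_le _ _ _))// lerDr.
  apply: eq_integrable => // z _; congr EFin; rewrite /=; congr (_ * _).
  under eq_bigr do rewrite doubleD exprD.
  by rewrite big_split/= !(prod_pow_eq (fun l => (cv z) l 0)).
(* The common diagonal value is named through a reference index [i0], which exists only in positive
   dimension. *)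
have [d0|[i0]] : (d = 0)%N \/ exists i0 : 'I_d, True.
- by case: (d) => [|d']; [left|right; exists ord0].
- transitivity (\int[lam]_z (0 : R)); last by rewrite /Rintegral integral0.
  apply: eq_Rintegral => z _; rewrite [dotv u _]big1 ?mul0r// => j.
  by have := ltn_ord j; rewrite {2}d0.
move=> _.
rewrite (@Rintegral_quadratic_even _ E4flip intE42 (\sum_(k < d) \prod_(l < d) gauss_moment ((l == i0) + (l == k)))) ?uv0 ?mul0r// => i.
(* Independence of the diagonal value from [i]: exchanging coordinates [i] and [i0] permutes both
   the sum and the inner product. *)
rewrite H4 (reindex_inj (@perm_inj _ (tperm i i0)))/=; apply: eq_bigr => k _.
rewrite [LHS](reindex_inj (@perm_inj _ (tperm i i0)))/=; apply: eq_bigr => l _.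
by rewrite (inj_eq perm_inj) -{2}(tpermR i i0) (inj_eq perm_inj).
Qed.

End gaussian_moments.

(** * Polar coordinates *)

Section density_measure.
Local Open Scope ereal_scope.
Context d (T : measurableType d) (R : realType).
Variables (mu : {measure set T -> \bar R}) (f : T -> R).
Hypothesis mf : measurable_fun [set: T] f.
Hypothesis f0 : forall x, (0 <= f x)%R.

Definition density_fun (A : set T) : \bar R := \int[mu]_(x in A) (f x)%:E.

Let density0 : density_fun set0 = 0.
Proof. by rewrite /density_fun integral_set0. Qed.

Let density_ge0 A : 0 <= density_fun A.
Proof. by apply: integral_ge0 => x _; rewrite lee_fin. Qed.

Let density_additive : semi_sigma_additive density_fun.
Proof.
move=> A mA tA mUA; rewrite /density_fun ge0_integral_bigcup//.
- by apply: is_cvg_ereal_nneg_natsum => n _; exact: density_ge0.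
- by apply: measurable_funTS; exact/measurable_EFinP.
- by move=> x _; rewrite lee_fin.
Qed.

HB.instance Definition _ := isMeasure.Build _ _ _ density_fun density0 density_ge0 density_additive.

Definition density_measure : {measure set T -> \bar R} := density_fun.

Lemma density_measureE A : density_measure A = \int[mu]_(x in A) (f x)%:E.
Proof. by []. Qed.

Lemma ge0_integral_density (F : T -> \bar R) : measurable_fun [set: T] F ->
  (forall x, 0 <= F x) -> \int[density_measure]_x F x = \int[mu]_x (F x * (f x)%:E).
Proof.
move=> mF F0; apply/esym.
have mEf : measurable_fun [set: T] (EFin \o f) by exact/measurable_EFinP.
have f0' x : 0 <= (f x)%:E by rewrite lee_fin.
apply: (@ge0_functional_integral _ _ _ density_measure (fun F => \int[mu]_x (F x * (f x)%:E))) => // {F mF F0}.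
- move=> F G mF mG F0 G0; rewrite -ge0_integralD//.
  + by apply: eq_integral => x _; rewrite ge0_muleDl.
  + by move=> x _; rewrite mule_ge0.
  + exact: emeasurable_funM.
  + by move=> x _; rewrite mule_ge0.
  + exact: emeasurable_funM.
- move=> k F k0 mF F0; rewrite -ge0_integralZl_EFin//.
  + by apply: eq_integral => x _; rewrite muleA.
  + by move=> x _; rewrite mule_ge0.
  + exact: emeasurable_funM.
- move=> g h mg g0 ndg gh.
  have -> : \int[mu]_x (h x * (f x)%:E) = \int[mu]_x (limn (fun n => g n x * (f x)%:E)).
    by apply: eq_integral => x _; apply/esym/cvg_lim => //; apply: cvgeZr => //; exact: gh.
  apply: cvg_monotone_convergence => //.
  + by move=> n; exact: emeasurable_funM.
  + by move=> n x _; rewrite mule_ge0.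
  + by move=> x _ m n mn; rewrite lee_wpmul2r// ndg.
- move=> A mA; rewrite density_measureE [RHS]integral_mkcond; apply: eq_integral => x _.
  by rewrite patchE indicE; case: ifP => _; rewrite (mul1e, mul0e).
Qed.

End density_measure.

Section measures_on_line.
Context {R : realType}.

Definition left_rays : set (set R) := [set A | exists x, A = `]-oo, x]%classic].

Lemma measurable_left_rays : (@ocitv R).-sigma.-measurable = <<s left_rays >>.
Proof.
rewrite RGenOInfty.measurableE eqEsubset; split => A.
  apply: smallest_sub; first exact: smallest_sigma_algebra.
  move=> _ [x ->]; rewrite -setCitvl.
  apply: (@measurableC _ (g_sigma_algebraType left_rays)).
  by apply: sub_sigma_algebra; exists x.
apply: smallest_sub; first exact: smallest_sigma_algebra.
move=> _ [x ->]; rewrite -setCitvr; apply: measurableC.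
by apply: sub_sigma_algebra; exists x.
Qed.

(** Left rays form a generating pi-system, and the rays ending at naturals exhaust the line with
    finite measure. *)
Lemma measure_unique_left_rays (m1 m2 : {measure set (measurableTypeR R) -> \bar R}) :
  (forall x, m1 `]-oo, x]%classic = m2 `]-oo, x]%classic) ->
  (forall x, m1 `]-oo, x]%classic < +oo)%E ->
  forall A, measurable A -> m1 A = m2 A.
Proof.
move=> m12 m1oo A mA.
apply: (@measure_unique _ R (measurableTypeR R) left_rays (fun n => `]-oo, n%:R]%classic)) => //.
- exact: measurable_left_rays.
- move=> _ _ [x ->] [y ->]; exists (Num.min x y); apply/seteqP; split => t /=; rewrite !in_itv/= le_min.
    by move=> [-> ->].
  by move=> /andP[].
- by move=> n; exists n%:R.
- apply/seteqP; split => // t _; have [n _ nP] := @nbhs_infty_ger R t.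
  by exists n => //=; rewrite in_itv/=; exact: (nP n (leqnn n)).
- by move=> _ [x ->].
Qed.

End measures_on_line.

Section polar_coordinates.
Context {R : realType} {d : nat}.
Hypothesis d_gt0 : (0 < d)%N.
Local Notation vec := (@vecB R d).
Local Notation lam := (@Leb R d).
Local Notation cv z := (z : 'cV[R]_d).

Definition direction (y : vec) : vec := (enorm (cv y))^-1 *: cv y.

Variable G : vec -> R.
Hypothesis mG : measurable_fun [set: vec] G.
Hypothesis G_ge0 : forall y, 0 <= G y.
Hypothesis G_homogeneous : forall (s : R) y, 0 < s -> G (s *: cv y) = G y.
Hypothesis G_zero : G (0 : 'cV[R]_d) = 0.

Let ball_mass (r : R) : \bar R := (\int[lam]_y (if (enorm (cv y) <= r)%R then (G y)%:E else 0))%E.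

Let measurable_ball_fun (r : R) : measurable_fun [set: vec]
  (fun y => if enorm (cv y) <= r then (G y)%:E else 0%E : \bar R).
Proof.
apply: measurable_fun_ifT; [|exact/measurable_EFinP|exact: measurable_cst].
apply: measurable_fun_ler => //.
by apply: continuous_measurable; exact: enorm_continuous.
Qed.

(** [G] is constant on open rays from the origin, so a dilation only contributes its Jacobian. *)
Lemma ball_mass_scale r : 0 < r -> ball_mass r = ((r ^+ d)%:E * ball_mass 1)%E.
Proof.
move=> r0; rewrite /ball_mass (@ge0_integral_Leb_scale R d 0 r)//; last first.
  by move=> y; case: ifP => _; rewrite ?lee_fin.
congr (_ * _)%E; apply: eq_integral => z _.
by rewrite add0r enormZ gtr0_norm// -{2}[r]mulr1 ler_pM2l// G_homogeneous.
Qed.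

Lemma ball_mass_le0 r : r <= 0 -> ball_mass r = 0%E.
Proof.
move=> r0; rewrite /ball_mass; apply: integral0_eq => y _.
case: ifP => // yr; have : enorm (cv y) = 0 by apply/eqP; rewrite eq_le enorm_ge0 (le_trans yr).
move=> y0; have : cv y = 0 by apply: dotvv_eq0; rewrite -enorm_sqr y0 expr0n.
by move=> ->; rewrite G_zero.
Qed.

(** The Jacobian of polar coordinates, extended by 0 so that radial integrals run over the whole
    line and can be changed affinely. *)
Definition radial (r : R) : R := if 0 < r then r ^+ d.-1 else 0.

Lemma radial_ge0 r : 0 <= radial r.
Proof. by rewrite /radial; case: ifP => // /ltW r0; rewrite exprn_ge0. Qed.

Lemma measurable_radial : measurable_fun [set: R] radial.
Proof.
apply: measurable_fun_ifT; [|exact: measurable_funX|exact: measurable_cst].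
exact: measurable_fun_ltr.
Qed.

Lemma integral_radial x : 0 < x ->
  (\int[lebesgue_measure]_(r in `]-oo, x]) (radial r)%:E = (x ^+ d / d%:R)%:E)%E.
Proof.
move=> x0; have d0 : (d%:R : R) != 0 by rewrite pnatr_eq0 -lt0n.
transitivity (\int[lebesgue_measure]_(r in `[0%R, x]) (r ^+ d.-1)%:E)%E.
  rewrite -integral_itv_obnd_cbnd; last first.
    by apply/measurable_EFinP; apply: measurable_funTS; exact: measurable_funX.
  rewrite integral_mkcond [RHS]integral_mkcond; apply: eq_integral => r _.
  rewrite !patchE !mem_setE !in_itv/= /radial.
  by case: (0 < r); case: (r <= x).
have dF (r : R) : is_derive r (1 : R) (fun r : R => d%:R^-1 * r ^+ d) (r ^+ d.-1).
  have dX : is_derive r (1 : R) (fun r : R => r ^+ d) (d%:R * r ^+ d.-1).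
    apply: DeriveDef; first exact: exprn_derivable.
    by rewrite exp_derive /GRing.scale/= mulr1.
  have H := @is_deriveZ R R R (fun r : R => r ^+ d) (d%:R^-1) r 1 _ dX.
  have -> : r ^+ d.-1 = d%:R^-1 *: (d%:R * r ^+ d.-1).
    by rewrite /GRing.scale/= mulrA mulVf// mul1r.
  exact: H.
rewrite (@continuous_FTC2 _ (fun r => r ^+ d.-1) (fun r => d%:R^-1 * r ^+ d))//.
- by rewrite expr0n/= -(prednK d_gt0)/= mulr0 sube0 mulrC.
- by apply: continuous_subspaceT; exact: exprn_continuous.
- have cF : continuous (fun r : R => d%:R^-1 * r ^+ d).
    by move=> r; apply: cvgM; [exact: cvg_cst|exact: exprn_continuous].
  split => [r _||]; first exact: (@ex_derive _ _ _ _ _ _ _ (dF r)).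
    by apply: cvg_at_right_filter; exact: cF.
  by apply: cvg_at_left_filter; exact: cF.
- by move=> r _; rewrite derive1E (@derive_val _ _ _ _ _ _ _ (dF r)).
Qed.

(* Both sides are integrals of [w] against measures on the line which agree on left rays by
   scaling. *)
Lemma polar_integral (S : R) (w : R -> R) : ball_mass 1 = S%:E ->
  measurable_fun [set: R] w -> (forall r, 0 <= w r) ->
  (\int[lam]_y (w (enorm (cv y)) * G y)%:E =
   (d%:R * S)%:E * \int[lebesgue_measure]_r (w r * radial r)%:E)%E.
Proof.
move=> BS mw w0.
have S0 : 0 <= S.
  rewrite -lee_fin -BS; apply: integral_ge0 => y _.
  by case: ifP => _; rewrite lee_fin.
have dS0 : 0 <= d%:R * S by rewrite mulr_ge0.
have menorm : measurable_fun [set: vec] (fun y : vec => enorm (cv y) : measurableTypeR R).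
  by apply: continuous_measurable; exact: enorm_continuous.
pose m1 := image_measure (density_measure lam mG G_ge0) menorm.
pose k : {nonneg R} := NngNum dS0.
pose mrad : {measure set (measurableTypeR R) -> \bar R} :=
  density_measure lebesgue_measure measurable_radial radial_ge0.
have mx0 (x : R) : x <= 0 -> mrad `]-oo, x]%classic = 0%E.
  move=> x0; apply: integral0_eq => r/=; rewrite in_itv/= => rx; rewrite /radial ifF//.
  by apply/negbTE; rewrite -leNgt (le_trans rx).
have m12 (x : R) : m1 `]-oo, x]%classic = mscale k mrad `]-oo, x]%classic.
  have -> : m1 `]-oo, x]%classic = ball_mass x.
    rewrite /m1 image_measureE density_measureE integral_mkcond /ball_mass.
    apply: eq_integral => y _; rewrite patchE.
    case: ifPn => [|yx]; rewrite ?inE/= ?in_itv/=; first by move=> ->.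
    rewrite ifF//; apply/negP => yx'; move/negP: yx; apply.
    by rewrite inE/= in_itv.
  have [x0|x0] := leP x 0; last first.
    have mx : mrad `]-oo, x]%classic = (x ^+ d / d%:R)%:E by exact: integral_radial.
    rewrite ball_mass_scale// BS /mscale/= mx.
    rewrite -!EFinM; congr EFin; field.
    by rewrite pnatr_eq0 -lt0n.
  by rewrite ball_mass_le0// /mscale/= mx0// mule0.
have m1oo (x : R) : (m1 `]-oo, x]%classic < +oo)%E.
  rewrite m12 /mscale/=.
  have [x0|x0] := leP x 0; first by rewrite mx0// mule0.
  have -> : mrad `]-oo, x]%classic = (x ^+ d / d%:R)%:E by exact: integral_radial.
  by rewrite -EFinM ltry.
have E := measure_unique_left_rays m12 m1oo.
have mEw : measurable_fun [set: measurableTypeR R] (EFin \o w) by exact/measurable_EFinP.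
have w0' r : (0 <= (w r)%:E)%E by rewrite lee_fin.
transitivity (\int[m1]_r (w r)%:E)%E.
  rewrite [RHS](ge0_integral_image_measure (density_measure lam mG G_ge0) menorm mEw)//.
  rewrite [RHS](@ge0_integral_density _ vec R lam G mG G_ge0 (fun y => (w (enorm (cv y)))%:E))//.
  exact: (measurableT_comp mEw menorm).
rewrite (@eq_measure_integral _ (measurableTypeR R) R setT (mscale k mrad)); last first.
  by move=> A mA _; exact: E.
rewrite ge0_integral_mscale//=.
congr (_ * _)%E.
exact: (ge0_integral_density lebesgue_measure measurable_radial radial_ge0 mEw w0').
Qed.

End polar_coordinates.

(** * The density near q *)

Section directional_calculus.
Context {R : realType} {d : nat}.
Local Notation cV := 'cV[R]_d.

Lemma is_derive_line (f : cV -> R) (x v : cV) (t : R) : derivable f (x + t *: v) v ->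
  is_derive t (1 : R) (fun s : R => f (x + s *: v)) ('D_v f (x + t *: v)).
Proof.
move=> df.
have E : (fun h : R => h^-1 *: (((fun s : R => f (x + s *: v)) \o shift t) (h *: (1 : R)) - f (x + t *: v))) =
    (fun h : R => h^-1 *: ((f \o shift (x + t *: v)) (h *: v) - f (x + t *: v))).
  apply/funext => h /=; congr (_ *: (f _ - _)).
  by rewrite -[h%:A]/(h * 1) mulr1 scalerDl addrCA.
apply: DeriveDef; first by rewrite /derivable E.
by rewrite /derive E.
Qed.

Lemma trmx_cV_continuous : continuous (fun v : 'rV[R]_d => (v^T : cV)).
Proof.
move=> v A /= [P vP PA].
exists (fun i j => P j i); first by move=> i j; have := vP j i; rewrite mxE.
by move=> w wP; apply: PA => i j; rewrite /= mxE; exact: wP.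
Qed.

End directional_calculus.

(** Closed and bounded for row vectors, then transported to columns by transposition. In dimension 0
    the sphere is empty. *)
Lemma compact_sphere (R : realType) (d : nat) : compact (@sphere R d).
Proof.
case: d => [|d].
  have -> : @sphere R 0 = set0; last exact: compact0.
  apply/seteqP; split => // v; rewrite /sphere/= /enorm /dotv big_ord0 sqrtr0 => /eqP.
  by rewrite eq_sym oner_eq0.
have -> : @sphere R d.+1 = (fun v : 'rV[R]_d.+1 => v^T) @` [set v | enorm v^T = 1].
  apply/seteqP; split => [v v1|_ [v v1 <-]//]; exists v^T => //=; rewrite ?trmxK//.
apply: continuous_compact.
  by apply: continuous_subspaceT; exact: trmx_cV_continuous.
apply: bounded_closed_compact.
  exists 2; split => // M M2 v /= v1.
  rewrite (le_trans _ (ltW M2))// [leLHS]/Num.norm/= mx_normrE; apply/bigmax_leP; split => //= [[i j]] _ /=.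
  rewrite (ord1 i); have := normr_coord_le (v^T) j; rewrite mxE v1 => /le_trans; apply.
  by rewrite ler1n.
have -> : [set v : 'rV[R]_d.+1 | enorm v^T = 1] = (fun v : 'rV[R]_d.+1 => enorm v^T) @^-1` [set 1] by [].
apply: closed_comp; last exact: closed_eq.
move=> v _; apply: continuous_comp; first exact: trmx_cV_continuous.
exact: enorm_continuous.
Qed.

(** * First order expansion from partial derivatives *)

Section multivariate_taylor.
Context {R : realType} {d : nat}.
Local Notation cV := 'cV[R]_d.
Variables (U : set cV) (f : cV -> R) (q : cV).
Hypothesis oU : open U.
Hypothesis Uq : U q.
Hypothesis f_derivable : forall x, U x -> forall i, derivable f x (ebasis i).
Hypothesis f_partial : forall i, {for q, continuous (partial f i)}.

Lemma coord_sub_le_enorm (x y : cV) j : `|x j 0 - y j 0| <= enorm (x - y).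
Proof. by have := normr_coord_le (x - y) j; rewrite !mxE. Qed.

Lemma enorm_ball_in (A : set cV) : nbhs q A -> exists2 e : R, 0 < e & forall x : cV, enorm (x - q) < e -> A x.
Proof.
move=> /nbhs_ballP[e /= e0 beA]; exists e => // x xe; apply: beA.
split => // i j; rewrite (ord1 j) /ball/= distrC.
exact: le_lt_trans (coord_sub_le_enorm _ _ _) xe.
Qed.

Lemma partial_near (e : R) : 0 < e -> exists2 r : R, 0 < r & forall x : cV,
  (forall j, `|x j 0 - q j 0| < r) -> U x /\ forall i, `|partial f i x - partial f i q| <= e.
Proof.
move=> e0.
have /nbhs_ballP[r0 /= r00 br0] : nbhs q U by exact: open_nbhs_nbhs.
have /choice[r rP] : forall i, exists r : R, 0 < r /\ forall x, ball q r x -> `|partial f i x - partial f i q| <= e.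
  move=> i; have /cvgrPdist_le/(_ e e0)/nbhs_ballP[r /= r0' br] := f_partial (i := i).
  by exists r; split => // x /br; rewrite distrC.
pose m := \big[Num.min/r0]_(i < d) r i.
have m0 : 0 < m by apply/bigmin_gtP; split => // i _; have [] := rP i.
have bm (x : cV) : (forall j, `|x j 0 - q j 0| < m) -> forall s, m <= s -> ball q s x.
  move=> xm s ms; split; first exact: lt_le_trans ms.
  by move=> i j; rewrite (ord1 j) /ball/= distrC; exact: lt_le_trans ms.
exists m => // x xm; split.
  by apply: br0; apply: bm => //; exact: bigmin_le_id.
by move=> i; have [_] := rP i; apply; apply: bm => //; exact: bigmin_le_cond.
Qed.

Let pt (x : cV) (k : nat) : cV := \col_j (if (j < k)%N then x j 0 else q j 0).

(** Only partial derivatives are given, so [f x - f q] is telescoped along the path [pt x k], which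
    changes one coordinate at a time. Nearness in [partial_near] is coordinatewise, hence the whole
    path stays where the partials are close to their value at [q]. *)
Lemma taylor1 (e : R) : 0 < e -> exists2 r : R, 0 < r & forall x : cV,
  enorm (x - q) < r -> `|f x - f q - dotv (egrad f q) (x - q)| <= e * enorm (x - q).
Proof.
move=> e0; have d1 : (0 : R) < d.+1%:R by [].
(* Each of the [d] steps may cost [e / d.+1]; the successor keeps the share positive when
   [d = 0]. *)
have [r r0 rP] := partial_near (divr_gt0 e0 d1).
exists r => // x xr.
have step (k : 'I_d) : `|f (pt x k.+1) - f (pt x k) - partial f k q * (x k 0 - q k 0)| <= e / d.+1%:R * enorm (x - q).
  pose h := x k 0 - q k 0.
  have ptk : pt x k.+1 = pt x k + h *: ebasis k.
    apply/matrixP => j l; rewrite !mxE (ord1 l) eqxx andbT ltnS leq_eqVlt.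
    have [jk|jk] := eqVneq j k; first by rewrite jk eqxx ltnn/= mulr1 /h addrC subrK.
    by rewrite -val_eqE/= in jk; rewrite (negbTE jk)/= mulr0 addr0.
  have near_pt s : `|s| <= `|h| -> forall j, `|(pt x k + s *: ebasis k) j 0 - q j 0| < r.
    move=> sh j; apply: le_lt_trans xr; rewrite !mxE eqxx andbT.
    have [jk|jk] := eqVneq j k.
      rewrite jk ltnn mulr1 addrAC subrr add0r (le_trans sh)//; exact: coord_sub_le_enorm.
    rewrite mulr0 addr0; case: ifP => _; first exact: coord_sub_le_enorm.
    by rewrite subrr normr0 enorm_ge0.
  have [c [ch E]] : exists c, `|c| <= `|h| /\ f (pt x k + h *: ebasis k) - f (pt x k + 0 *: ebasis k) = partial f k (pt x k + c *: ebasis k) * h.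
    have [|c [ch E]] := @mean_value_local R (fun s => f (pt x k + s *: ebasis k))
      (fun s => partial f k (pt x k + s *: ebasis k)) 0 h.
      move=> s; rewrite !subr0 => sh.
      have [Us _] := rP _ (near_pt s sh).
      exact/is_derive_line/f_derivable.
    by exists c; rewrite !subr0 in ch E.
  rewrite ptk; rewrite scale0r addr0 in E; rewrite E -mulrBl normrM.
  have [_ /(_ k) H] := rP _ (near_pt c ch).
  by apply: ler_pM => //; exact: coord_sub_le_enorm.
have pt0 : pt x 0 = q by apply/matrixP => j l; rewrite !mxE (ord1 l).
have ptd : pt x d = x by apply/matrixP => j l; rewrite !mxE (ord1 l) ltn_ord.
have -> : f x - f q - dotv (egrad f q) (x - q) =
    \sum_(k < d) (f (pt x k.+1) - f (pt x k) - partial f k q * (x k 0 - q k 0)).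
  rewrite sumrB; congr (_ - _); last by apply: eq_bigr => k _; rewrite !mxE.
  rewrite -(big_mkord xpredT (fun k => f (pt x k.+1) - f (pt x k))) telescope_sumr//.
  by rewrite pt0 ptd.
rewrite (le_trans (ler_norm_sum _ _ _))//.
apply: (le_trans (ler_sum _ (fun k _ => step k))).
rewrite sumr_const card_ord -[leLHS]mulr_natl mulrA ler_wpM2r ?enorm_ge0//.
rewrite mulrA ler_pdivrMr// mulrC ler_wpM2l ?ler_nat// ltW//.
Qed.

End multivariate_taylor.

Section sphere_density.
Context {R : realType} {d : nat}.
Local Notation cV := 'cV[R]_d.
Variables (q : cV) (rho : cV -> R).
Hypothesis hq : sphere q.
Hypothesis hC2 : exists U : set cV, [/\ open U, sphere `<=` U & C2_on U rho].

Lemma C2_continuous (x : cV) : sphere x -> {for x, continuous rho}.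
Proof. by move=> sx; have [U [_ sU CU]] := hC2; have [] := CU x (sU x sx). Qed.

Lemma C2_taylor1 (e : R) : 0 < e -> exists2 r : R, 0 < r & forall x : cV,
  enorm (x - q) < r -> `|rho x - rho q - dotv (egrad rho q) (x - q)| <= e * enorm (x - q).
Proof.
have [U [oU sU CU]] := hC2; have Uq := sU q hq.
apply: (taylor1 oU Uq).
- by move=> x Ux; have [] := CU x Ux.
- by have [] := CU q Uq.
Qed.

Lemma C2_bounded_sphere : exists M : R, forall x : cV, sphere x -> `|rho x| <= M.
Proof.
have cw : {within @sphere R d, continuous rho}.
  by apply: continuous_in_subspaceT => x /[1!inE] sx; exact: C2_continuous.
have /compact_bounded[M [_ MP]] := continuous_compact cw (@compact_sphere R d).
exists (M + 1) => x sx; apply: (MP (M + 1)); first by rewrite ltrDl.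
by exists x.
Qed.

(** Within distance [r] of [q] the first order expansion gives slope [1 + g]. Farther away the
    oscillation is at most [2 * M], hence at most [2 * M / r] times the distance. *)
Lemma C2_lipschitz_at : exists L : R, forall x : cV, sphere x -> `|rho x - rho q| <= L * enorm (x - q).
Proof.
have [M MP] := C2_bounded_sphere.
have [r r0 rP] := C2_taylor1 ltr01.
have M0 : 0 <= M by exact: le_trans (MP q hq).
pose g := enorm (egrad rho q).
have g0 : 0 <= g by exact: enorm_ge0.
exists (1 + g + 2 * M / r) => x sx.
have xq0 := enorm_ge0 (x - q).
have Mr0 : 0 <= 2 * M / r by rewrite divr_ge0 ?mulr_ge0// ltW.
have [xr|xr] := ltP (enorm (x - q)) r.
  have h1 := rP x xr; have h2 := normr_dotv_le (egrad rho q) (x - q).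
  have -> : rho x - rho q = (rho x - rho q - dotv (egrad rho q) (x - q)) + dotv (egrad rho q) (x - q) by ring.
  rewrite (le_trans (ler_normD _ _))//.
  rewrite mul1r in h1; rewrite -/g in h2; nra.
rewrite (@le_trans _ _ (2 * M))//.
  by rewrite (le_trans (ler_normB _ _))// mulr_natl mulr2n lerD// MP.
have : 2 * M <= 2 * M / r * enorm (x - q).
  by rewrite -mulrA ler_peMr ?mulr_ge0// mulrC ler_pdivlMr// mul1r.
nra.
Qed.

Lemma egrad_ln : 0 < rho q -> egrad (fun y => ln (rho y)) q = (rho q)^-1 *: egrad rho q.
Proof.
move=> rq; apply/matrixP => j l; rewrite !mxE /partial.
have [U [oU sU CU]] := hC2; have Uq := sU q hq.
have [_ /(_ j) dq _ _ _] := CU q Uq.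
have H0 : is_derive (0 : R) (1 : R) (fun s : R => rho (q + s *: ebasis j)) ('D_(ebasis j) rho q).
  by have := @is_derive_line R d rho q (ebasis j) 0; rewrite scale0r addr0 => /(_ dq).
have H2 : is_derive (0 : R) (1 : R) (fun s : R => ln (rho (q + s *: ebasis j))) ((rho q)^-1 * 'D_(ebasis j) rho q).
  have H1' : is_derive (rho (q + 0 *: ebasis j)) (1 : R) (@ln R) (rho q)^-1.
    by rewrite scale0r addr0; exact: is_derive1_ln.
  exact: (@is_derive1_comp _ _ _ _ _ _ H1' H0).
rewrite -(@derive_val _ _ _ _ _ _ _ H2) /derive.
have -> : (fun h : R => h^-1 *: (((fun y => ln (rho y)) \o shift q) (h *: ebasis j) - ln (rho q))) =
    (fun h : R => h^-1 *: (((fun s => ln (rho (q + s *: ebasis j))) \o shift 0) (h *: (1 : R)) - ln (rho (q + 0 *: ebasis j)))).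
  apply/funext => h /=; rewrite scale0r addr0 addr0; congr (_ *: (ln (rho _) - _)).
  by rewrite -[h%:A]/(h * 1) mulr1 addrC.
by [].
Qed.

End sphere_density.

(** * Laplace asymptotics on the sphere *)

Section polar_law.
Context {R : realType} {d : nat}.
Local Notation vec := (@vecB R d).
Local Notation lam := (@Leb R d).
Local Notation cv z := (z : 'cV[R]_d).
Local Notation dir := (@direction R d).

(** Meant for functions of the direction, such as [direction] and [radial_ext], which are generally
    discontinuous at the origin. *)
Lemma measurable_punctured (f : vec -> R) :
  (forall y : 'cV[R]_d, 0 < enorm y -> {for y, continuous (f : 'cV[R]_d -> R)}) ->
  (forall y : 'cV[R]_d, enorm y = 0 -> f y = 0) -> measurable_fun [set: vec] f.
Proof.
move=> cf f0.
pose D : set vec := [set y | 0 < enorm (cv y)].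
have oD : open (D : set 'cV[R]_d).
  have -> : (D : set 'cV[R]_d) = (fun y : 'cV[R]_d => enorm y) @^-1` [set r | 0 < r] by [].
  by apply: open_comp; [move=> y _; exact: enorm_continuous|exact: open_gt].
have mD : measurable D by apply: measurable_borelRd; exact: open_borelRd.
have mf : measurable_fun D f by apply: for_continuous_measurable => // y; exact: cf.
have -> : f = f \_ D.
  apply/funext => y; rewrite patchE; case: ifPn => // /negP yD; apply: f0.
  apply/eqP; rewrite eq_le enorm_ge0 andbT leNgt; apply/negP => y0; apply: yD.
  by rewrite inE.
exact: (measurable_restrictT f mD).1.
Qed.

Lemma enorm_inv_continuous (y : 'cV[R]_d) : 0 < enorm y ->
  (fun z : 'cV[R]_d => (enorm z)^-1) @ y --> (enorm y)^-1.
Proof.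
move=> y0; have yn0 : enorm y != 0 by rewrite gt_eqF.
exact: (cvgV yn0 (@enorm_continuous R d y)).
Qed.

Lemma direction_continuous (y : 'cV[R]_d) : 0 < enorm y ->
  (fun z : 'cV[R]_d => (enorm z)^-1 *: z) @ y --> (enorm y)^-1 *: y.
Proof.
move=> y0; have H := enorm_inv_continuous y0.
apply: (cvgZ H); exact: cvg_id.
Qed.

Lemma measurable_direction : measurable_fun [set: vec] dir.
Proof.
apply: measurable_fun_vecB => j; apply: measurable_punctured => y y0.
  rewrite (_ : (fun x : vec => _) = (fun z : 'cV[R]_d => (enorm z)^-1 * z j 0)); last first.
    by apply/funext => z; rewrite /direction mxE.
  have H := enorm_inv_continuous y0.
  apply: (cvgM H).
  exact: coord_continuous.
by rewrite /direction mxE y0 invr0 mul0r.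
Qed.

Lemma enorm_direction (y : vec) : 0 < enorm (cv y) -> enorm (cv (dir y)) = 1.
Proof.
move=> y0; rewrite /direction enormZ ger0_norm ?invr_ge0 ?enorm_ge0//.
by rewrite mulVf// gt_eqF.
Qed.

Lemma direction_scale (s : R) (y : 'cV[R]_d) : 0 < s -> dir (s *: y) = dir y.
Proof.
move=> s0; rewrite /direction enormZ gtr0_norm// scalerA invfM mulrAC mulVf ?mul1r// gt_eqF//.
Qed.

Lemma direction_sphere (y : vec) : sphere (cv y) -> dir y = y.
Proof. by rewrite /direction => ->; rewrite invr1 scale1r. Qed.

Variable rho : 'cV[R]_d -> R.
Hypothesis rho_continuous : forall y, sphere y -> {for y, continuous rho}.
Hypothesis rho_ge0 : forall y, sphere y -> 0 <= rho y.

(** The extension of [rho] that is homogeneous of degree 0. The value 0 at the origin keeps it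
    nonnegative, since [rho] is controlled only on the sphere. *)
Definition radial_ext (y : vec) : R := if 0 < enorm (cv y) then rho (dir y) else 0.

Lemma measurable_radial_ext : measurable_fun [set: vec] radial_ext.
Proof.
apply: measurable_punctured => y y0; last by rewrite /radial_ext y0 ltxx.
have H : {for y, continuous (fun z : 'cV[R]_d => rho ((enorm z)^-1 *: z))}.
  apply: continuous_comp; first exact: direction_continuous.
  apply: rho_continuous; exact: (enorm_direction y0).
have E : radial_ext y = rho ((enorm y)^-1 *: y) by rewrite /radial_ext y0.
rewrite /prop_for /continuous_at E; apply: cvg_trans H.
have near_pos : \forall z \near y, 0 < enorm z.
  exact: (@enorm_continuous R d y _ (lt_nbhsr y0)).
have near_eq : \forall z \near y, rho ((enorm z)^-1 *: z) = radial_ext z.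
  by near=> z; rewrite /radial_ext ifT//; near: z.
exact: (@near_eq_cvg _ _ _ (nbhs_filter y) _ _ near_eq).
Unshelve. all: by end_near.
Qed.

Lemma radial_ext_ge0 y : 0 <= radial_ext y.
Proof. by rewrite /radial_ext; case: ifP => // y0; apply: rho_ge0; exact: enorm_direction. Qed.

Context {dT : measure_display} {T : measurableType dT} (P : probability T R).
Variable X : T -> vec.
Hypothesis X_measurable : forall A, borelRd A -> measurable (X @^-1` A).
Hypothesis X_law : forall A, borelRd A ->
  P (X @^-1` A) = sphere_int (fun y => ((\1_A y) * rho y)%:E).

Lemma measurable_sample : measurable_fun [set: T] X.
Proof. by move=> _ A mA; rewrite setTI; exact: X_measurable. Qed.

Let D (y : vec) : R := d%:R * (if enorm (cv y) <= 1 then radial_ext y else 0).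

Let mD : measurable_fun [set: vec] D.
Proof.
apply: measurable_funM => //; apply: measurable_fun_if => //.
- apply: (measurable_fun_ler (f := fun y : vec => enorm (cv y))) => //.
  by apply: continuous_measurable; exact: enorm_continuous.
- by apply: measurable_funTS; exact: measurable_radial_ext.
Qed.

Let D_ge0 y : 0 <= D y.
Proof. by apply: mulr_ge0 => //; case: ifP => // _; exact: radial_ext_ge0. Qed.

Let measurable_ball (k : vec -> R) : measurable_fun [set: vec] k -> measurable_fun [set: vec]
  (fun y : vec => if enorm (cv y) <= 1 then (k (dir y) * radial_ext y)%:E else 0%E : \bar R).
Proof.
move=> mk; apply: measurable_fun_if => //.
  apply: (measurable_fun_ler (f := fun y : vec => enorm (cv y))) => //.
  by apply: continuous_measurable; exact: enorm_continuous.
apply: measurable_funTS; apply/measurable_EFinP; apply: measurable_funM.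
  exact: measurableT_comp measurable_direction.
exact: measurable_radial_ext.
Qed.

(** By the form of [sphere_int], the law of [X] is the image under [direction] of the measure with
    density [D] on the unit ball. The two measures agree on Borel sets, hence have the same
    integrals. *)
Lemma law_integral (h : vec -> R) : measurable_fun [set: vec] h -> (forall y, 0 <= h y) ->
  (\int[P]_w (h (X w))%:E =
   d%:R%:E * \int[lam]_y (if (enorm (cv y) <= 1)%R then (h (dir y) * radial_ext y)%:E else 0))%E.
Proof.
move=> mh h0.
have mEh : measurable_fun [set: vec] (EFin \o h) by exact/measurable_EFinP.
have h0' y : (0 <= (EFin \o h) y)%E by rewrite lee_fin.
rewrite -(ge0_integral_image_measure P measurable_sample mEh h0').
pose nu := density_measure lam mD D_ge0.
have mhd : measurable_fun [set: vec] (fun y => ((EFin \o h) (dir y))) by exact: measurableT_comp measurable_direction.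

have rhs (k : vec -> R) : (forall y, 0 <= k y) -> measurable_fun [set: vec] k ->
  (\int[image_measure nu measurable_direction]_y (k y)%:E =
   d%:R%:E * \int[lam]_y (if (enorm (cv y) <= 1)%R then (k (dir y) * radial_ext y)%:E else 0))%E.
  move=> k0 mk.
  have mEk : measurable_fun [set: vec] (EFin \o k) by exact/measurable_EFinP.
  have k0' y : (0 <= (EFin \o k) y)%E by rewrite lee_fin.
  rewrite (ge0_integral_image_measure nu measurable_direction mEk k0').
  have mkd : measurable_fun [set: vec] (fun y => ((EFin \o k) (dir y))) by exact: measurableT_comp measurable_direction.
  rewrite [LHS](@ge0_integral_density _ vec R lam D mD D_ge0 _ mkd)//.
  rewrite -ge0_integralZl_EFin//.
  - apply: eq_integral => y _; rewrite /= /D; case: ifP => _.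
      by rewrite -!EFinM; congr EFin; ring.
    by rewrite mulr0 !mule0.
  - move=> y _; case: ifP => // _; rewrite lee_fin mulr_ge0//; exact: radial_ext_ge0.
  - exact: measurable_ball.
rewrite -rhs//; apply: eq_measure_integral => A mA _.
rewrite [LHS]X_law// -[in RHS](setIT A) -(integral_indic _ measurableT mA).
rewrite rhs//.
rewrite /sphere_int; congr (_ * _)%E; rewrite lebRdE.
- apply: eq_integral => y _; rewrite /radial_ext.
  case: (ltP 0 (enorm (cv y))) => //= y0.
  by rewrite mulr0 if_same.
- have mi : measurable_fun [set: vec] (\1_A : vec -> R) by exact: measurable_indic.
  apply: (eq_measurable_fun _ _ (measurable_ball mi)) => y _; rewrite /radial_ext.
  case: (ltP 0 (enorm (cv y))) => //= y0.
  by rewrite mulr0 if_same.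
- move=> y; case: ifP => // /andP[y0 _]; rewrite lee_fin mulr_ge0//.
  by apply: rho_ge0; exact: enorm_direction.
Qed.

Hypothesis d_gt0 : (0 < d)%N.

(** [polar_integral] applied to the function [h (dir y) * radial_ext y], whose mass on the unit ball
    is the expectation of [h (X w)] divided by [d]; the two factors [d] cancel. The radial factor
    [w] is free, which is what later allows completing the exponent. *)
Lemma law_polar (h : vec -> R) (M : R) (w : R -> R) : measurable_fun [set: vec] h ->
  (forall y, 0 <= h y <= M) -> measurable_fun [set: R] w -> (forall r, 0 <= w r) ->
  (\int[lam]_y (w (enorm (cv y)) * (h (dir y) * radial_ext y))%:E =
   (\int[P]_w (h (X w))%:E) * \int[lebesgue_measure]_r (w r * @radial R d r)%:E)%E.
Proof.
move=> mh h0M mw w0.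
have h0 y : 0 <= h y by have /andP[] := h0M y.
have L := law_integral mh h0.
have dn0 : (d%:R : R) != 0 by rewrite pnatr_eq0 -lt0n.
set S := (\int[lam]_y _)%E in L.
have S0 : (0 <= S)%E.
  by apply: integral_ge0 => y _; case: ifP => // _; rewrite lee_fin mulr_ge0// radial_ext_ge0.
have Lfin : (\int[P]_w (h (X w))%:E < +oo)%E.
  apply: (@le_lt_trans _ _ (\int[P]_w M%:E)%E).
    apply: ge0_le_integral => //.
    - by move=> w' _; rewrite lee_fin.
    - by apply/measurable_EFinP; exact: measurableT_comp measurable_sample.
    - by move=> w' _; rewrite lee_fin; have /andP[] := h0M (X w').
  have -> : (\int[P]_w M%:E = M%:E)%E.
    by rewrite -[RHS]mule1 -(@probability_setT _ T R P); exact: integral_cst.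
  exact: ltry.
have Sfin : S \is a fin_num.
  (* Finiteness of the ball mass is deduced from the bound [M] on the expectation, [d] being
     positive. *)
  rewrite ge0_fin_numE// ltNge leye_eq; apply/negP => /eqP Soo.
  by move: Lfin; rewrite L Soo gt0_muley ?ltxx// lte_fin ltr0n.
rewrite L -(fineK Sfin) -EFinM; apply: polar_integral => //.
- by apply: measurable_funM; [exact: measurableT_comp measurable_direction|exact: measurable_radial_ext].
- by move=> y; rewrite mulr_ge0// radial_ext_ge0.
- by move=> s y s0; rewrite /radial_ext enormZ gtr0_norm// pmulr_rgt0// direction_scale.
- by rewrite /radial_ext /enorm dotv0r sqrtr0 ltxx mulr0.
- by rewrite fineK.
Qed.
Hypothesis X_sphere : forall w, sphere (X w : 'cV[R]_d).

(** [attention] is bounded on the sphere but need not be bounded on R^d, so [h] is first replaced by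
    its homogeneous extension [h'], which changes neither side. *)
Lemma law_polar_sphere (h : vec -> R) (M : R) (w : R -> R) : measurable_fun [set: vec] h ->
  (forall y, sphere (cv y) -> 0 <= h y <= M) -> measurable_fun [set: R] w -> (forall r, 0 <= w r) ->
  (\int[lam]_y (w (enorm (cv y)) * (h (dir y) * radial_ext y))%:E =
   (\int[P]_w (h (X w))%:E) * \int[lebesgue_measure]_r (w r * @radial R d r)%:E)%E.
Proof.
move=> mh hM mw w0.
pose h' (y : vec) : R := if 0 < enorm (cv y) then h (dir y) else 0.
have M0 : 0 <= M.
  by have /andP[h0 hle] := hM _ (X_sphere point); exact: le_trans hle.
have mh' : measurable_fun [set: vec] h'.
  apply: measurable_fun_if => //.
    by apply: measurable_fun_ltr => //; apply: continuous_measurable; exact: enorm_continuous.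
  by apply: measurable_funTS; exact: measurableT_comp measurable_direction.
have h'M y : 0 <= h' y <= M.
  by rewrite /h'; case: ifP => [y0|_]; [apply: hM; exact: enorm_direction|rewrite lexx].
have E1 y : h' (dir y) * radial_ext y = h (dir y) * radial_ext y.
  rewrite /radial_ext; case: ifPn => y0; rewrite ?mulr0//; congr (_ * _).
  by rewrite /h' enorm_direction// ltr01 direction_sphere//; exact: enorm_direction.
have E2 t : h' (X t) = h (X t).
  have Xs := X_sphere t; rewrite /h' direction_sphere//.
  by have -> : enorm (cv (X t)) = 1 by []; rewrite ltr01.
have := law_polar mh' h'M mw w0.
under eq_integral => y _ do rewrite E1.
by move=> ->; congr (_ * _)%E; apply: eq_integral => t _; rewrite E2.
Qed.

End polar_law.

(** * Geometry of the substitution y = q + s z *)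

Section blowup_geometry.
Context {R : realType} {d : nat}.
Local Notation cV := 'cV[R]_d.
Variables (q : cV) (s : R).
Hypothesis hq : sphere q.
Hypothesis s_gt0 : 0 < s.
Implicit Types z u : cV.

Definition blowup z : cV := q + s *: z.
Definition blowup_radius z : R := enorm (blowup z).
(** Radial displacement measured at scale [s]. As [s] tends to 0 it approaches [dotv q z], so
    [z - a z *: q] approaches the tangential part of [z]. *)
Definition blowup_slope z : R := (blowup_radius z - 1) / s.
Local Notation r := blowup_radius.
Local Notation a := blowup_slope.

Lemma blowup_radius_ge0 z : 0 <= r z. Proof. exact: enorm_ge0. Qed.

Lemma dotvv_sphere (x : cV) : sphere x -> dotv x x = 1.
Proof. by move=> x1; rewrite -enorm_sqr x1 expr1n. Qed.

Lemma blowup_radius_sqr z : r z ^+ 2 = 1 + 2 * s * dotv q z + s ^+ 2 * dotv z z.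
Proof.
rewrite /r enorm_sqr /blowup dotvDr !dotvDl !dotvZr !dotvZl (dotvC z q) dotvv_sphere//.
by ring.
Qed.

Lemma blowup_radiusE z : r z = 1 + s * a z.
Proof. by rewrite /a mulrC divfK ?gt_eqF// addrC subrK. Qed.

Lemma dist_blowup_radius z : `|r z - 1| <= s * enorm z.
Proof.
have := ler_dist_enorm (blowup z) q.
rewrite /r hq => /le_trans; apply.
by rewrite /blowup addrAC subrr add0r enormZ gtr0_norm.
Qed.

Lemma blowup_slope_le z : `|a z| <= enorm z.
Proof.
rewrite /a normrM normfV (gtr0_norm s_gt0) ler_pdivrMr// mulrC.
exact: dist_blowup_radius.
Qed.

(** From [r - 1 = (r ^+ 2 - 1) / (r + 1)]: the division by [s] cancels, and the limit becomes
    visible. *)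
Lemma blowup_slopeE z : a z = (2 * dotv q z + s * dotv z z) / (r z + 1).
Proof.
have r1 : r z + 1 != 0 by rewrite gt_eqF// ltr_wpDl ?blowup_radius_ge0.
apply: (mulIf r1); rewrite divfK//.
apply: (mulfI (lt0r_neq0 s_gt0)).
have := blowup_radius_sqr z; rewrite blowup_radiusE => H.
have {}H : s * a z * (2 + s * a z) = s * (2 * dotv q z + s * dotv z z).
  by move: H; lra.
by rewrite -H; ring.
Qed.

Section positive_radius.
Variable z : cV.
Hypothesis rz : 0 < r z.
Local Notation dirz := (direction (blowup z : vecB) : cV).

Lemma blowup_direction_sub : dirz - q = s *: ((r z)^-1 *: (z - a z *: q)).
Proof.
rewrite scalerA mulrC -scalerA.
have -> : dirz - q = (r z)^-1 *: (blowup z - r z *: q).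
  by rewrite /direction scalerBr (scalerA (r z)^-1) mulVf ?gt_eqF// scale1r.
congr (_ *: _); rewrite /blowup blowup_radiusE scalerDl scale1r scalerBr scalerA.
by rewrite opprD addrA [X in X - _]addrAC subrr add0r.
Qed.

Lemma dotv_blowup_direction u : dotv u (dirz - q) = s * ((dotv u z - a z * dotv u q) / r z).
Proof. by rewrite blowup_direction_sub !dotvZr dotvBr dotvZr (mulrC _ (r z)^-1). Qed.

Lemma blowup_tilt : 1 - dotv q dirz = s ^+ 2 * ((dotv z z - a z ^+ 2) / (2 * r z)).
Proof.
have := dotv_blowup_direction q; rewrite dotvBr !(dotvv_sphere hq) mulr1 => H.
have {H}-> : 1 - dotv q dirz = - (s * ((dotv q z - a z) / r z)) by rewrite -H; ring.
have := blowup_slopeE z => /(congr1 (fun t => t * (r z + 1))).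
rewrite divfK; last by rewrite gt_eqF// ltr_wpDl ?blowup_radius_ge0.
move=> H; have {H}-> : dotv q z = (a z * (r z + 1) - s * dotv z z) / 2 by rewrite H; field.
have -> : r z + 1 = 2 + s * a z by rewrite blowup_radiusE; ring.
by field; rewrite gt_eqF.
Qed.

Lemma blowup_exponent :
  (1 - dotv q dirz) / s ^+ 2 + (r z - 1) ^+ 2 / (2 * r z * s ^+ 2) = dotv z z / (2 * r z).
Proof.
rewrite blowup_tilt {2}blowup_radiusE (addrC 1) addrK.
by field; rewrite gt_eqF//= gt_eqF.
Qed.

(** The factor 4 is 2 for the inverse of [r z] times 2 for [z] and [a z *: q], both of norm at most
    [enorm z]. *)
Lemma blowup_direction_dist : 2^-1 <= r z -> enorm (dirz - q) <= s * (4 * enorm z).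
Proof.
move=> r2; rewrite blowup_direction_sub !enormZ (gtr0_norm s_gt0) ler_wpM2l ?(ltW s_gt0)//.
rewrite gtr0_norm ?invr_gt0// ler_pdivrMl//.
apply: (@le_trans _ _ (enorm z + enorm z)).
  rewrite (le_trans (ler_enormD _ _))// lerD2l enormN enormZ (_ : enorm q = 1)// mulr1.
  exact: blowup_slope_le.
have z0 := enorm_ge0 z; nra.
Qed.

End positive_radius.
End blowup_geometry.

Section cutoff.
Context {R : realType}.

Lemma measurable_invr : measurable_fun [set: R] (fun x : R => x^-1).
Proof.
pose D : set R := [set x | x != 0].
have oD : open D by exact: open_neq.
have mD : measurable D by exact: open_measurable.
have mf : measurable_fun D (fun x : R => x^-1).
  apply: open_continuous_measurable_fun => // x /[1!inE] xD.
  by apply: inv_continuous.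
have -> : (fun x : R => x^-1) = (fun x : R => x^-1) \_ D.
  apply/funext => x; rewrite patchE; case: ifPn => // /negP xD.
  have [->|x0] := eqVneq x 0; first by rewrite invr0.
  by case: xD; rewrite inE.
exact: (measurable_restrictT _ mD).1.
Qed.

Lemma cvg_exprn (u : nat -> R) (l : R) k : u @ \oo --> l -> (fun n => u n ^+ k) @ \oo --> l ^+ k.
Proof.
move=> ul; apply: (@continuous_cvg _ _ _ _ _ _ (fun x : R => x ^+ k)) => //.
exact: exprn_continuous.
Qed.

(** Restricts the radial factor, which is free in [law_polar]. The lower bound keeps [r] away from
    0; the upper bound gives [1 / (2 r) >= 1 / 3], hence domination by a fixed Gaussian with
    coefficient [3^-1]. *)
Definition cutoff (r : R) : R := if 2^-1 <= r <= 3 / 2 then 1 else 0.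

Lemma measurable_cutoff : measurable_fun [set: R] cutoff.
Proof.
apply: measurable_fun_if => //; apply: measurable_and.
  by apply: measurable_fun_ler.
by apply: measurable_fun_ler.
Qed.

Lemma cutoff_near (u : nat -> R) : u @ \oo --> (1 : R) -> \forall n \near \oo, cutoff (u n) = 1.
Proof.
move=> u1.
have h2 : (0 : R) < 2^-1 by rewrite invr_gt0.
have /cvgrPdist_le /(_ _ h2) := u1.
apply: filterS => n; rewrite ler_norml => /andP[H1 H2].
by rewrite /cutoff ifT//; apply/andP; split; lra.
Qed.

Lemma cutoffM_le (r K k : R) : 0 <= K -> (2^-1 <= r <= 3 / 2 -> `|k| <= K) -> `|cutoff r * k| <= K.
Proof. by rewrite /cutoff; case: ifP => [_ _ H|_ K0 _]; rewrite ?mul1r ?H// mul0r normr0. Qed.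

Lemma cutoff_eq0 (r : R) : cutoff r = 0 -> 2^-1 <= `|r - 1|.
Proof.
rewrite /cutoff; case: ifPn => [_ /eqP|]; first by rewrite oner_eq0.
rewrite negb_and -!ltNge => /orP[H|H] _; rewrite ler_normr; apply/orP; [right|left]; lra.
Qed.

Lemma expR_div_le (e r : R) : 0 <= e -> 2^-1 <= r <= 3 / 2 ->
  expR (- (e / (2 * r))) <= expR (- (3^-1 * e)).
Proof.
move=> e0 /andP[r1 r2]; rewrite ler_expR lerN2 mulrC ler_wpM2l//.
by rewrite lef_pV2 ?posrE; lra.
Qed.

End cutoff.

(** * The radial factor and its one-dimensional integral *)

Section radial_weight.
Context {R : realType}.
Variable d : nat.
Hypothesis d_gt0 : (0 < d)%N.
Local Notation lebR := (@lebesgue_measure R).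

(** The factor [r] cancels the denominator in [dotv_blowup_direction] and [blowup_tilt]: [r] times
    the first moment is [s * (dotv u z - a z * dotv u q)], which reduces to [s * dotv u z] for [u]
    orthogonal to [q]. *)
Definition radial_weight (s r : R) : R :=
  cutoff r * (r * expR (- ((r - 1) ^+ 2 / (2 * r * s ^+ 2)))).

Lemma measurable_radial_weight s : measurable_fun [set: R] (radial_weight s).
Proof.
apply: measurable_funM; first exact: measurable_cutoff.
apply: measurable_funM => //; apply: measurableT_comp => //; apply: measurableT_comp => //.
apply: measurable_funM; first by apply: measurable_funX; apply: measurable_funB.
apply: (measurableT_comp measurable_invr).
by apply: measurable_funM => //; apply: measurable_funM.
Qed.

Lemma radial_weight_ge0 s r : 0 <= radial_weight s r.
Proof.
rewrite /radial_weight /cutoff; case: ifP => [/andP[r0 _]|_]; last by rewrite mul0r.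
by rewrite mul1r mulr_ge0 ?expR_ge0//; apply: le_trans r0; rewrite invr_ge0.
Qed.

Definition scaled_weight (s t : R) : R :=
  cutoff (1 + s * t) * ((1 + s * t) ^+ d * expR (- (t ^+ 2 / (2 * (1 + s * t))))).

Lemma scaled_weightE s t : 0 < s ->
  radial_weight s (1 + s * t) * @radial R d (1 + s * t) = scaled_weight s t.
Proof.
move=> s0; rewrite /radial_weight /scaled_weight /radial /cutoff.
case: ifP => [/andP[r0 _]|_]; last by rewrite !mul0r.
have r1 : 0 < 1 + s * t by apply: lt_le_trans r0; rewrite invr_gt0.
rewrite r1 !mul1r addrAC subrr add0r mulrAC -exprS prednK//; congr (_ * expR (- _)).
by field; rewrite !gt_eqF.
Qed.

Lemma measurable_scaled_weight s : measurable_fun [set: R] (scaled_weight s).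
Proof.
have m1 : measurable_fun [set: R] (fun t : R => 1 + s * t).
  by apply: measurable_funD => //; apply: measurable_funM.
apply: measurable_funM; first exact: measurableT_comp measurable_cutoff m1.
apply: measurable_funM; first exact: measurable_funX.
apply: measurableT_comp => //; apply: measurableT_comp => //.
apply: measurable_funM; first by apply: measurable_funX.
by apply: (measurableT_comp measurable_invr); apply: measurable_funM.
Qed.

Lemma scaled_weight_le s t : `|scaled_weight s t| <= (3 / 2) ^+ d * expR (- (3^-1 * t ^+ 2)).
Proof.
apply: cutoffM_le; first by rewrite mulr_ge0 ?expR_ge0.
move=> H; have /andP[r1 r2] := H.
have r0 : 0 <= 1 + s * t by apply: le_trans r1; rewrite invr_ge0.
rewrite ger0_norm; last by rewrite mulr_ge0 ?expR_ge0// exprn_ge0.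
apply: ler_pM; [exact: exprn_ge0|exact: expR_ge0| |].
  by rewrite lerXn2r// nnegrE divr_ge0.
by apply: expR_div_le => //; rewrite sqr_ge0.
Qed.

Let integrable_bound :
  lebR.-integrable [set: R] (EFin \o (fun t : R => (3 / 2) ^+ d * expR (- (3^-1 * t ^+ 2)))).
Proof.
apply: (@integrableZ _ (measurableTypeR R) R lebR).
by apply: integrable_gauss; rewrite invr_gt0.
Qed.

Lemma integral_radial_weight s : 0 < s ->
  (\int[lebR]_r (radial_weight s r * @radial R d r)%:E =
   (s * \int[lebR]_t scaled_weight s t)%:E)%E.
Proof.
move=> s0; have sn0 : s != 0 by rewrite gt_eqF.
rewrite (@ge0_integral_affine R 1 s (fun r => (radial_weight s r * @radial R d r)%:E) sn0).
- under eq_integral => t _ do rewrite scaled_weightE//.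
  have I : lebR.-integrable [set: R] (EFin \o scaled_weight s).
    apply: (@integrable_dominated _ (measurableTypeR R) R lebR _ _ _ integrable_bound).
      exact: measurable_scaled_weight.
    exact: scaled_weight_le.
  have -> := @integral_Rintegral _ (measurableTypeR R) R lebR _ I.
  by rewrite gtr0_norm// EFinM.
- by apply/measurable_EFinP; apply: measurable_funM; [exact: measurable_radial_weight|exact: measurable_radial].
- by move=> t; rewrite lee_fin mulr_ge0 ?radial_ge0// radial_weight_ge0.
Qed.

Lemma scaled_weight_cvg (s : nat -> R) : (forall n, 0 < s n) -> s @ \oo --> (0 : R) ->
  (fun n => \int[lebR]_t scaled_weight (s n) t) @ \oo --> Num.sqrt (2 * pi).
Proof.
move=> s_gt0 s0; rewrite -Rintegral_gauss.
have pt t : (fun n => scaled_weight (s n) t) @ \oo --> expR (- (2^-1 * t ^+ 2)).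
  have u1 : (fun n => 1 + s n * t) @ \oo --> (1 : R).
    rewrite -[X in _ --> X]addr0 -[X in _ --> _ + X](mul0r t).
    by apply: cvgD; [exact: cvg_cst|apply: cvgMr_tmp].
  have H : (fun n => (1 + s n * t) ^+ d * expR (- (t ^+ 2 / (2 * (1 + s n * t))))) @ \oo -->
      expR (- (2^-1 * t ^+ 2)).
    have -> : expR (- (2^-1 * t ^+ 2)) = 1 ^+ d * expR (- (t ^+ 2 / (2 * 1))).
      by rewrite expr1n mul1r mulr1 mulrC.
    apply: cvgM; first exact: cvg_exprn.
    apply: continuous_cvg; first exact: continuous_expR.
    apply: cvgN; apply: cvgMl_tmp; apply: cvgV; first by rewrite mulr1.
    exact: cvgMl_tmp.
  apply: cvg_trans H; apply: near_eq_cvg.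
  have := cutoff_near u1; apply: filterS => n; rewrite /scaled_weight => ->.
  by rewrite mul1r.
have := @dominated_convergence_real _ (measurableTypeR R) R lebR (fun n => scaled_weight (s n))
  (fun t => expR (- (2^-1 * t ^+ 2))) _ (fun n => measurable_scaled_weight (s n)) pt integrable_bound
  (fun n => scaled_weight_le (s n)).
by case.
Qed.

End radial_weight.

Lemma integrable_bounded d (T : measurableType d) (R : realType) (P : probability T R)
  (f : T -> R) (M : R) : measurable_fun [set: T] f -> (forall x, `|f x| <= M) ->
  P.-integrable [set: T] (EFin \o f).
Proof.
move=> mf fM; apply: (@integrable_dominated _ _ _ _ f (cst M)) => //.
exact: finite_measure_integrable_cst.
Qed.

Lemma integrable_gauss_quadratic (R : realType) (d : nat) (u v : 'cV[R]_d) :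
  Leb.-integrable [set: vecB] (EFin \o (fun z : @vecB R d =>
    dotv u (z : 'cV_d) * dotv v (z : 'cV_d) * expR (- (2^-1 * dotv (z : 'cV_d) (z : 'cV_d))))).
Proof.
apply: (@integrable_poly_gauss_vec _ _ _ 1 2^-1 (enorm u * enorm v)); first by rewrite invr_gt0.
  apply: measurable_funM; last exact: measurable_gauss_vec.
  by apply: measurable_funM; exact: measurable_dotv.
move=> z; rewrite mulrA normrM (ger0_norm (expR_ge0 _)) ler_wpM2r ?expR_ge0// expr1.
apply: (@le_trans _ _ ((enorm u * enorm (z : 'cV_d)) * (enorm v * enorm (z : 'cV_d)))).
  by rewrite normrM ler_pM// normr_dotv_le.
by rewrite mulrACA -expr2 enorm_sqr ler_wpM2l ?mulr_ge0 ?enorm_ge0// lerDr.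
Qed.

Lemma dotv_ebasis (R : realType) (d : nat) (j : 'I_d) (v : 'cV[R]_d) : dotv (ebasis j) v = v j 0.
Proof.
rewrite /dotv (bigD1 j)//= mxE !eqxx mul1r big1 ?addr0// => i ij.
by rewrite mxE (negbTE ij) mul0r.
Qed.

Lemma projT_mulmx (R : realType) (d : nat) (q v : 'cV[R]_d) : projT q *m v = v - dotv q v *: q.
Proof.
by rewrite /projT mulmxBl mul1mx -mulmxA [q^T *m v]mx11_scalar -dotv_mxE mul_mx_scalar.
Qed.

(** Squeezed between [c n] and [c n * expR (s n * c n)] by convexity of the exponential; the case
    where [c n] vanishes needs no separate treatment. *)
Lemma expR_slope_cvg (R : realType) (s c : nat -> R) (l : R) : (forall n, 0 < s n) ->
  s @ \oo --> (0 : R) -> c @ \oo --> l -> (fun n => (expR (s n * c n) - 1) / s n) @ \oo --> l.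
Proof.
move=> s_gt0 s0 cl.
have scvg0 : (fun n => s n * c n) @ \oo --> (0 : R).
  by rewrite -[X in _ --> X](mul0r l); exact: cvgM.
have H : (fun n => c n * expR (s n * c n)) @ \oo --> l.
  rewrite -[X in _ --> X]mulr1 -expR0; apply: cvgM => //.
  by apply: continuous_cvg => //; exact: continuous_expR.
apply: (squeeze_cvgr _ cl H); apply: nearW => n.
rewrite ler_pdivlMr// ler_pdivrMr//; apply/andP; split.
  by have := expR_ge1Dx (s n * c n); lra.
have := expR_ge1Dx (- (s n * c n)); have := expR_gt0 (s n * c n).
rewrite expRN -mulrA (mulrC _ (s n)) mulrA (mulrC (c n)).
move: (s n * c n) => t; move: (expR t) => x x0 H1.
have : (1 - t) * x <= x^-1 * x by rewrite ler_wpM2r// ltW.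
by rewrite mulVf ?gt_eqF//; lra.
Qed.

(** * Moments of the attention weight for large beta *)

Section laplace.
Context {R : realType} {d : nat}.
Hypothesis d_gt0 : (0 < d)%N.
Local Notation vec := (@vecB R d).
Local Notation lam := (@Leb R d).
Local Notation lebR := (@lebesgue_measure R).
Local Notation cv z := (z : 'cV[R]_d).
Local Notation dir := (@direction R d).
Variables (q : 'cV[R]_d) (rho : 'cV[R]_d -> R).
Hypothesis hq : sphere q.
Hypothesis hC2 : exists U : set 'cV[R]_d, [/\ open U, sphere `<=` U & C2_on U rho].
Hypothesis rho_ge0 : forall y, sphere y -> 0 <= rho y.
Let rho_cont := C2_continuous hC2.
Context {dT : measure_display} {T : measurableType dT} (P : probability T R).
Variable X : T -> vec.
Hypothesis X_measurable : forall A, borelRd A -> measurable (X @^-1` A).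
Hypothesis X_law : forall A, borelRd A ->
  P (X @^-1` A) = sphere_int (fun y => ((\1_A y) * rho y)%:E).
Hypothesis X_sphere : forall w, sphere (X w : 'cV[R]_d).

Definition attention (b : R) (x : 'cV[R]_d) : R := expR (- b * (1 - dotv q x)).

Lemma measurable_attention b : measurable_fun [set: vec] (fun x : vec => attention b (cv x)).
Proof.
rewrite /attention; apply: measurableT_comp => //; apply: measurable_funM => //.
by apply: measurable_funB => //; exact: measurable_dotv.
Qed.

Lemma attention_le1 b (x : 'cV[R]_d) : 0 <= b -> sphere x -> attention b x <= 1.
Proof.
move=> b0 xs; rewrite -expR0 ler_expR mulNr oppr_le0 mulr_ge0// subr_ge0.
have := dotv_le_enorm q x; by rewrite (hq : enorm q = 1) (xs : enorm x = 1) mulr1.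
Qed.

(** The density of the problem after blow-up: [blowup_exponent] has merged the attention weight and
    the radial factor into one exponential. It tends to [rho q] times the standard Gaussian
    weight. *)
Definition tilted (s : R) (z : vec) : R :=
  cutoff (blowup_radius q s (cv z)) *
  (radial_ext rho (blowup q s (cv z)) *
   expR (- (dotv (cv z) (cv z) / (2 * blowup_radius q s (cv z))))).

Lemma measurable_blowup s : measurable_fun [set: vec] (fun z : vec => blowup q s (cv z) : vec).
Proof.
apply: measurable_fun_vecB => j; rewrite /blowup.
rewrite (_ : (fun _ => _) = (fun z : vec => q j 0 + s * (cv z) j 0)); last first.
  by apply/funext => z; rewrite !mxE.
by apply: measurable_funD => //; apply: measurable_funM => //; exact: measurable_entry.
Qed.

Lemma measurable_blowup_radius s : measurable_fun [set: vec] (fun z : vec => blowup_radius q s (cv z)).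
Proof.
have me : measurable_fun [set: vec] (fun y : vec => enorm (cv y)).
  by apply: continuous_measurable; exact: enorm_continuous.
exact: measurableT_comp me (measurable_blowup s).
Qed.

Lemma measurable_tilted s : measurable_fun [set: vec] (tilted s).
Proof.
have mr := measurable_blowup_radius s.
apply: measurable_funM; first exact: measurableT_comp measurable_cutoff mr.
apply: measurable_funM.
  exact: measurableT_comp (measurable_radial_ext rho_cont) (measurable_blowup s).
apply: measurableT_comp => //; apply: measurableT_comp => //.
apply: measurable_funM; first exact: measurable_dotvv.
by apply: (measurableT_comp measurable_invr); apply: measurable_funM.
Qed.

Lemma tilted_le : exists2 M : R, 0 <= M & forall s z,
  `|tilted s z| <= M * expR (- (3^-1 * dotv (cv z) (cv z))).
Proof.
have [M MP] := C2_bounded_sphere hC2.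
have M0 : 0 <= M by apply: le_trans (MP q hq).
exists M => // s z; apply: cutoffM_le; first by rewrite mulr_ge0 ?expR_ge0.
move=> H; rewrite normrM (ger0_norm (expR_ge0 _)); apply: ler_pM; rewrite ?expR_ge0//.
  rewrite /radial_ext; case: ifP => [y0|_]; last by rewrite normr0.
  by apply: MP; exact: enorm_direction.
by apply: expR_div_le => //; exact: dotvv_ge0.
Qed.

Lemma tiltedM_le s z (k B C : R) : 0 <= B -> `|tilted s z| <= C ->
  (2^-1 <= blowup_radius q s (cv z) <= 3 / 2 -> `|k| <= B) -> `|tilted s z * k| <= B * C.
Proof.
move=> B0 tC kB; have C0 : 0 <= C by exact: le_trans tC.
have [H|/negbTE H] := boolP (2^-1 <= blowup_radius q s (cv z) <= 3 / 2).
  by rewrite normrM mulrC ler_pM// kB.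
by rewrite /tilted /cutoff H !mul0r normr0 mulr_ge0.
Qed.

Lemma tilted_cutoff s z k1 k2 :
  (2^-1 <= blowup_radius q s (cv z) <= 3 / 2 -> k1 = k2) -> tilted s z * k1 = tilted s z * k2.
Proof. by rewrite /tilted /cutoff; case: ifP => [_ ->//|_ _]; rewrite !mul0r. Qed.

Lemma integrable_attention (k : vec -> R) (M b : R) : 0 <= b -> measurable_fun [set: vec] k ->
  (forall y, sphere (cv y) -> `|k y| <= M) ->
  P.-integrable [set: T] (EFin \o (fun w => attention b (X w) * k (X w))).
Proof.
move=> b0 mk kM; apply: (@integrable_bounded _ _ _ _ _ M).
  have mh : measurable_fun [set: vec] (fun x : vec => attention b (cv x) * k x).
    by apply: measurable_funM => //; exact: measurable_attention.
  exact: measurableT_comp mh (measurable_sample X_measurable).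
move=> w; have sX := X_sphere w; rewrite normrM ger0_norm ?expR_ge0//.
by rewrite (le_trans _ (kM _ sX))// ler_piMl// attention_le1.
Qed.

Lemma integrable_tilted (k : vec -> R) (M s : R) : measurable_fun [set: vec] k ->
  (forall y, sphere (cv y) -> `|k y| <= M) ->
  lam.-integrable [set: vec]
    (EFin \o (fun z => tilted s z * (blowup_radius q s (cv z) * k (dir (blowup q s (cv z)))))).
Proof.
move=> mk kM; have [K K0 KP] := tilted_le.
have M0 : 0 <= M by apply: le_trans (kM _ hq).
apply: (@integrable_poly_gauss_vec _ _ _ 0 3^-1 (3 / 2 * M * K)); first by rewrite invr_gt0.
  apply: measurable_funM; first exact: measurable_tilted.
  apply: measurable_funM; first exact: measurable_blowup_radius.
  apply: measurableT_comp => //; apply: measurableT_comp (measurable_blowup s).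
  exact: measurable_direction.
move=> z; rewrite expr0 mul1r -[leRHS]mulrA; apply: tiltedM_le; first by rewrite mulr_ge0.
  exact: KP.
move=> /andP[r1 r2].
have r0 : 0 < blowup_radius q s (cv z) by apply: lt_le_trans r1; rewrite invr_gt0.
have sy : sphere (cv (dir (blowup q s (cv z)))) by exact: enorm_direction.
by rewrite normrM (ger0_norm (ltW r0)) ler_pM// ?(ltW r0)// kM.
Qed.

(** [law_polar_sphere] with [w = radial_weight s], an identity at fixed [s]. The exponent is [d.-1]
    because the substitution in R^d yields [s ^+ d] and the radial one yields [s]. *)
Lemma laplace_polar_ge0 (k : vec -> R) (M s : R) : 0 < s -> measurable_fun [set: vec] k ->
  (forall y, sphere (cv y) -> 0 <= k y <= M) ->
  (\int[P]_w (attention (s ^+ 2)^-1 (X w) * k (X w))) * \int[lebR]_t scaled_weight d s t =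
  s ^+ d.-1 * \int[lam]_z (tilted s z * (blowup_radius q s (cv z) * k (dir (blowup q s (cv z))))).
Proof.
move=> s0 mk kM.
have b0 : 0 <= (s ^+ 2)^-1 by rewrite invr_ge0 sqr_ge0.
pose h (x : vec) : R := attention (s ^+ 2)^-1 (cv x) * k x.
have mh : measurable_fun [set: vec] h by apply: measurable_funM => //; exact: measurable_attention.
have hM (y : vec) : sphere (cv y) -> 0 <= h y <= M.
  move=> ys; have /andP[k0 kM'] := kM y ys; rewrite mulr_ge0 ?expR_ge0//=.
  by apply: le_trans kM'; rewrite ler_piMl// attention_le1.
have M0 : 0 <= M by have /andP[H1 H2] := kM _ (X_sphere point); exact: le_trans H2.
have := law_polar_sphere rho_cont rho_ge0 X_measurable X_law d_gt0 X_sphere mh hM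
  (measurable_radial_weight s) (radial_weight_ge0 s).
rewrite (integral_radial_weight d_gt0 s0).
have I1 : P.-integrable [set: T] (EFin \o (fun w => h (X w))).
  apply: (@integrable_attention _ M) => // y sy.
  by have /andP[H1 H2] := kM _ sy; rewrite ger0_norm.
have -> := integral_Rintegral I1.
pose F (y : vec) : \bar R := (radial_weight s (enorm (cv y)) * (h (dir y) * radial_ext rho y))%:E.
have mF : measurable_fun [set: vec] F.
  apply/measurable_EFinP; apply: measurable_funM.
    apply: measurableT_comp; first exact: measurable_radial_weight.
    by apply: continuous_measurable; exact: enorm_continuous.
  apply: measurable_funM; first exact: measurableT_comp measurable_direction.
  exact: measurable_radial_ext.
have F0 y : (0 <= F y)%E.
  rewrite lee_fin mulr_ge0 ?radial_weight_ge0// /radial_ext; case: ifP; rewrite ?mulr0// => y0.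
  have sy : sphere (cv (dir y)) by exact: enorm_direction.
  by rewrite mulr_ge0 ?rho_ge0//; have /andP[] := hM _ sy.
rewrite -[(\int[lam]_y _)%E]/(\int[lam]_y F y)%E (ge0_integral_Leb_scale q s0 mF F0).
have FE z : F ((q + s *: cv z) : vec) =
   (tilted s z * (blowup_radius q s (cv z) * k (dir (blowup q s (cv z)))))%:E.
  rewrite /F -/(blowup q s (cv z)) -/(blowup_radius q s (cv z)) /radial_weight /tilted /cutoff.
  case: ifP => [/andP[r1 _]|_]; last by rewrite !mul0r.
  have r0 : 0 < blowup_radius q s (cv z) by apply: lt_le_trans r1; rewrite invr_gt0.
  rewrite /h /attention -(blowup_exponent hq s0 r0) opprD expRD; congr EFin.
  by rewrite mulNr (mulrC (s ^+ 2)^-1); ring.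
have I2 : lam.-integrable [set: vec]
    (EFin \o (fun z => tilted s z * (blowup_radius q s (cv z) * k (dir (blowup q s (cv z)))))).
  apply: (@integrable_tilted _ M) => // y sy.
  by have /andP[H1 H2] := kM _ sy; rewrite ger0_norm.
under [in X in X -> _]eq_integral => z _ do rewrite FE.
have -> := integral_Rintegral I2.
rewrite -!EFinM => -[] H.
apply: (mulfI (lt0r_neq0 s0)); rewrite [RHS]mulrA -exprS prednK//.
by apply: etrans (esym H); rewrite /h; ring.
Qed.

(** The nonnegative case applies to [k + M] and to the constant [M]; the signed case is the
    difference. *)
Lemma laplace_polar (k : vec -> R) (M s : R) : 0 < s -> measurable_fun [set: vec] k ->
  (forall y, sphere (cv y) -> `|k y| <= M) ->
  (\int[P]_w (attention (s ^+ 2)^-1 (X w) * k (X w))) * \int[lebR]_t scaled_weight d s t =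
  s ^+ d.-1 * \int[lam]_z (tilted s z * (blowup_radius q s (cv z) * k (dir (blowup q s (cv z))))).
Proof.
move=> s0 mk kM.
have M0 : 0 <= M by apply: le_trans (kM _ hq).
have b0 : 0 <= (s ^+ 2)^-1 by rewrite invr_ge0 sqr_ge0.
have mM : measurable_fun [set: vec] (fun _ : vec => M) by [].
have mkM : measurable_fun [set: vec] (fun y => k y + M) by exact: measurable_funD.
have M1 (y : vec) : sphere (cv y) -> 0 <= M <= M by rewrite M0 lexx.
have M1' (y : vec) : sphere (cv y) -> `|M| <= M by rewrite ger0_norm.
have kM1 (y : vec) : sphere (cv y) -> 0 <= k y + M <= M + M.
  by move=> /kM; rewrite ler_norml => /andP[H1 H2]; rewrite lerD2r H2 andbT; lra.
have H1 := laplace_polar_ge0 s0 mkM kM1.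
have H2 := laplace_polar_ge0 s0 mM M1.
have D1 : \int[P]_w (attention (s ^+ 2)^-1 (X w) * (k (X w) + M)) =
    \int[P]_w (attention (s ^+ 2)^-1 (X w) * k (X w)) + \int[P]_w (attention (s ^+ 2)^-1 (X w) * M).
  rewrite -(RintegralD measurableT (integrable_attention b0 mk kM) (integrable_attention b0 mM M1')).
  by apply: eq_Rintegral => w _; rewrite mulrDr.
have D2 : \int[lam]_z (tilted s z * (blowup_radius q s (cv z) * (k (dir (blowup q s (cv z))) + M))) =
  \int[lam]_z (tilted s z * (blowup_radius q s (cv z) * k (dir (blowup q s (cv z))))) +
  \int[lam]_z (tilted s z * (blowup_radius q s (cv z) * M)).
  rewrite -(RintegralD measurableT (integrable_tilted s mk kM) (integrable_tilted s mM M1')).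
  by apply: eq_Rintegral => z _; rewrite !mulrDr.
by move: H1; rewrite D1 D2 mulrDl H2 mulrDr => /addIr.
Qed.

Variable s : nat -> R.
Hypothesis s_gt0 : forall n, 0 < s n.
Hypothesis s_cvg0 : s @ \oo --> (0 : R).
Local Notation E z := (expR (- (2^-1 * dotv (cv z) (cv z)))).
Local Notation r n z := (blowup_radius q (s n) (cv z)).
Local Notation a n z := (blowup_slope q (s n) (cv z)).

Lemma blowup_radius_cvg (z : vec) : (fun n => r n z) @ \oo --> (1 : R).
Proof.
apply/cvgrPdist_le => e e0.
have : (fun n => s n * enorm (cv z)) @ \oo --> (0 : R).
  by rewrite -[X in _ --> X](mul0r (enorm (cv z))); exact: cvgMr_tmp.
move=> /cvgrPdist_le /(_ _ e0); apply: filterS => n; rewrite sub0r normrN => H.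
rewrite distrC (le_trans (dist_blowup_radius hq (s_gt0 n) _))// (le_trans _ H)//.
exact: ler_norm.
Qed.

Lemma blowup_window (z : vec) : \forall n \near \oo, 2^-1 <= r n z <= 3 / 2.
Proof.
have := cutoff_near (blowup_radius_cvg z); apply: filterS => n; rewrite /cutoff.
by case: ifP => // _ /eqP; rewrite eq_sym oner_eq0.
Qed.

Lemma blowup_slope_cvg (z : vec) : (fun n => a n z) @ \oo --> dotv q (cv z).
Proof.
have -> : (fun n => a n z) = (fun n => (2 * dotv q (cv z) + s n * dotv (cv z) (cv z)) / (r n z + 1)).
  by apply/funext => n; rewrite blowup_slopeE.
have Ez : dotv q (cv z) = (2 * dotv q (cv z) + 0 * dotv (cv z) (cv z)) / (1 + 1) by field.
rewrite [X in _ --> X]Ez; apply: cvgM.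
  by apply: cvgD; [exact: cvg_cst|exact: cvgMr_tmp].
apply: cvgV => //; apply: cvgD; last exact: cvg_cst.
exact: blowup_radius_cvg.
Qed.

Lemma radial_ext_blowup_dist : exists2 L : R, 0 <= L & forall n (z : vec), 2^-1 <= r n z ->
  `|radial_ext rho (blowup q (s n) (cv z)) - rho q| <= L * (s n * enorm (cv z)).
Proof.
have [L LP] := C2_lipschitz_at hq hC2.
exists (`|L| * 4) => [|n z r1]; first by rewrite mulr_ge0.
have r0 : 0 < r n z by apply: lt_le_trans r1; rewrite invr_gt0.
rewrite /radial_ext ifT//.
have sy : sphere (cv (dir (blowup q (s n) (cv z)))) by exact: enorm_direction.
rewrite (le_trans (LP _ sy))// (le_trans (ler_wpM2r (enorm_ge0 _) (ler_norm L)))//.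
rewrite -mulrA ler_wpM2l// mulrCA; exact: blowup_direction_dist.
Qed.

Lemma tilted_cvg (z : vec) : (fun n => tilted (s n) z) @ \oo --> rho q * E z.
Proof.
have Hr := blowup_radius_cvg z.
have HG : (fun n => radial_ext rho (blowup q (s n) (cv z))) @ \oo --> rho q.
  have [L L0 LP] := radial_ext_blowup_dist.
  apply/cvgrPdist_le => e e0.
  have : (fun n => L * (s n * enorm (cv z))) @ \oo --> (0 : R).
    rewrite -[X in _ --> X](mulr0 L); apply: cvgMl_tmp.
    by rewrite -[X in _ --> X](mul0r (enorm (cv z))); exact: cvgMr_tmp.
  move=> /cvgrPdist_le /(_ _ e0) H1.
  near=> n; rewrite distrC; apply: le_trans (LP n z _) _.
    by have /andP[] : 2^-1 <= r n z <= 3 / 2 by near: n; exact: blowup_window.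
  have : `|0 - L * (s n * enorm (cv z))| <= e by near: n.
  by rewrite sub0r normrN; apply: le_trans; exact: ler_norm.
have HE : (fun n => expR (- (dotv (cv z) (cv z) / (2 * r n z)))) @ \oo --> E z.
  have -> : E z = expR (- (dotv (cv z) (cv z) / (2 * 1))) by rewrite mulr1 mulrC.
  apply: continuous_cvg; first exact: continuous_expR.
  apply: cvgN; apply: cvgMl_tmp; apply: cvgV; first by rewrite mulr1.
  exact: cvgMl_tmp.
rewrite -[X in _ --> X]mul1r; apply: cvgM; last exact: cvgM.
by apply: cvg_near_cst; exact: cutoff_near Hr.
Unshelve. all: by end_near.
Qed.

Lemma laplace_quotient (A I : nat -> R) (l : R) :
  (forall n, A n * \int[lebR]_t scaled_weight d (s n) t = I n) -> I @ \oo --> l ->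
  A @ \oo --> l / Num.sqrt (2 * pi).
Proof.
move=> AI Il.
have W := scaled_weight_cvg d s_gt0 s_cvg0.
have spos : 0 < Num.sqrt (2 * pi) :> R by rewrite sqrtr_gt0 mulr_gt0// pi_gt0.
have HQ : (fun n => I n / \int[lebR]_t scaled_weight d (s n) t) @ \oo --> l / Num.sqrt (2 * pi).
  by apply: cvgM => //; apply: cvgV => //; rewrite gt_eqF.
apply: cvg_trans HQ; apply: near_eq_cvg.
have W0 : \forall n \near \oo, \int[lebR]_t scaled_weight d (s n) t != 0.
  by have /cvgr_gt/(_ _ spos) := W; apply: filterS => n /gt_eqF ->.
by apply: filterS W0 => n Wn0 /=; rewrite -AI mulfK.
Qed.

(** [e] is the power of [s] that [k] yields under the blow-up, [b n] the rescaled moment, and the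
    degree [p] of its polynomial bound provides domination. It is used with [e = 0] for the mass and
    [e = 2] for the square and the gap. *)
Lemma laplace_limit (k : vec -> R) (M K : R) (e p : nat) (b : nat -> vec -> R) (binf : vec -> R) :
  measurable_fun [set: vec] k -> (forall y, sphere (cv y) -> `|k y| <= M) -> 
  0 <= K -> (forall n, measurable_fun [set: vec] (b n)) ->
  (forall n z, 2^-1 <= r n z <= 3 / 2 ->
     r n z * k (dir (blowup q (s n) (cv z))) = s n ^+ e * b n z) ->
  (forall n z, 2^-1 <= r n z <= 3 / 2 -> `|b n z| <= K * (1 + dotv (cv z) (cv z)) ^+ p) ->
  (forall z, (fun n => b n z) @ \oo --> binf z) ->
  (fun n => \int[P]_w (attention (s n ^+ 2)^-1 (X w) * k (X w)) / s n ^+ (d.-1 + e)) @ \oo -->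
  \int[lam]_z (rho q * E z * binf z) / Num.sqrt (2 * pi).
Proof.
move=> mk kM K0 mb bE bK bcvg.
have [C C0 CP] := tilted_le.
have bound n z : `|tilted (s n) z * b n z| <=
    K * C * ((1 + dotv (cv z) (cv z)) ^+ p * expR (- (3^-1 * dotv (cv z) (cv z)))).
  have D0 : 0 <= (1 + dotv (cv z) (cv z)) ^+ p by rewrite exprn_ge0// addr_ge0// dotvv_ge0.
  rewrite mulrACA; apply: tiltedM_le; first by rewrite mulr_ge0.
  - exact: CP.
  - exact: bK.
have mtb n : measurable_fun [set: vec] (fun z => tilted (s n) z * b n z).
  by apply: measurable_funM => //; exact: measurable_tilted.
have Ig : lam.-integrable [set: vec] (EFin \o (fun z : vec =>
    K * C * ((1 + dotv (cv z) (cv z)) ^+ p * expR (- (3^-1 * dotv (cv z) (cv z)))))).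
  apply: (@integrable_poly_gauss_vec _ _ _ p 3^-1 (K * C)); first by rewrite invr_gt0.
    apply: measurable_funM => //; apply: measurable_funM; last exact: measurable_gauss_vec.
    by apply: measurable_funX; apply: measurable_funD => //; exact: measurable_dotvv.
  move=> z; rewrite ger0_norm// mulr_ge0 ?mulr_ge0 ?expR_ge0//.
  by rewrite exprn_ge0// addr_ge0// dotvv_ge0.
have pt z : (fun n => tilted (s n) z * b n z) @ \oo --> rho q * E z * binf z.
  by apply: cvgM; [exact: tilted_cvg|exact: bcvg].
have [_ HI] := dominated_convergence_real mtb pt Ig bound.
apply: laplace_quotient HI => n.
have sn0 : s n != 0 by rewrite gt_eqF.
rewrite mulrAC (laplace_polar (s_gt0 n) mk kM).
have -> : \int[lam]_z (tilted (s n) z * (r n z * k (dir (blowup q (s n) (cv z))))) =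
  s n ^+ e * \int[lam]_z (tilted (s n) z * b n z).
  rewrite -RintegralZl//.
    by apply: eq_Rintegral => z _; rewrite [RHS]mulrCA; apply: tilted_cutoff; exact: bE.
  apply: integrable_dominated (bound n) => //.
by rewrite exprD; field; rewrite !expf_neq0.
Qed.

Lemma normr_blowup_coef n (z : vec) (u : 'cV[R]_d) :
  `|dotv u (cv z) - a n z * dotv u q| <= 2 * enorm u * enorm (cv z).
Proof.
have uz := normr_dotv_le u (cv z).
have uq : `|dotv u q| <= enorm u.
  by have := normr_dotv_le u q; rewrite (hq : enorm q = 1) mulr1.
have az : `|a n z| <= enorm (cv z) := blowup_slope_le hq (s_gt0 n) (cv z).
have -> : 2 * enorm u * enorm (cv z) = enorm u * enorm (cv z) + enorm (cv z) * enorm u by ring.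
by rewrite (le_trans (ler_normB _ _))// lerD// normrM ler_pM.
Qed.

Lemma measurable_blowup_slope n : measurable_fun [set: vec] (fun z : vec => a n z).
Proof.
apply: measurable_funM => //; apply: measurable_funB => //; exact: measurable_blowup_radius.
Qed.

Let divM_sqrt (x : R) : x * Num.sqrt (2 * pi) ^+ d / Num.sqrt (2 * pi) = x * Num.sqrt (2 * pi) ^+ d.-1.
Proof.
have spos : 0 < Num.sqrt (2 * pi) :> R by rewrite sqrtr_gt0 mulr_gt0// pi_gt0.
by rewrite -{1}(prednK d_gt0) exprSr mulrA mulfK// gt_eqF.
Qed.

Let window_gt0 n (z : vec) : 2^-1 <= r n z -> 0 < r n z.
Proof. by apply: lt_le_trans; rewrite invr_gt0. Qed.

Lemma laplace_mass :
  (fun n => \int[P]_w attention (s n ^+ 2)^-1 (X w) / s n ^+ d.-1) @ \oo -->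
  rho q * Num.sqrt (2 * pi) ^+ d.-1.
Proof.
have m1 : measurable_fun [set: vec] (fun _ : vec => 1 : R) by [].
have k1 (y : vec) : sphere (cv y) -> `|1 : R| <= 1 by rewrite normr1.
have mb n : measurable_fun [set: vec] (fun z : vec => r n z) by exact: measurable_blowup_radius.
have bE n (z : vec) : 2^-1 <= r n z <= 3 / 2 -> r n z * 1 = s n ^+ 0 * r n z.
  by rewrite mulr1 mul1r.
have bK n (z : vec) : 2^-1 <= r n z <= 3 / 2 -> `|r n z| <= 3 / 2 * (1 + dotv (cv z) (cv z)) ^+ 0.
  by move=> /andP[r1 r2]; rewrite mulr1 ger0_norm// ltW// window_gt0.
have K0 : 0 <= 3 / 2 :> R by rewrite divr_ge0.
have := laplace_limit m1 k1 K0 mb bE bK blowup_radius_cvg.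
rewrite addn0; under eq_fun do under eq_Rintegral do rewrite mulr1.
have -> : \int[lam]_z (rho q * E z * 1) = rho q * Num.sqrt (2 * pi) ^+ d.
  rewrite -Rintegral_gauss_vec -RintegralZl//; first by apply: eq_Rintegral => z _; rewrite mulr1.
  by apply: integrable_gauss_vec; rewrite invr_gt0.
by rewrite divM_sqrt.
Qed.

Lemma laplace_square (u : 'cV[R]_d) (v := u - dotv u q *: q) :
  (fun n => \int[P]_w (attention (s n ^+ 2)^-1 (X w) * dotv u (cv (X w) - q) ^+ 2) / s n ^+ d.+1) @ \oo -->
  rho q * dotv v v * Num.sqrt (2 * pi) ^+ d.-1.
Proof.
pose k (x : vec) : R := dotv u (cv x - q) ^+ 2.
have mk : measurable_fun [set: vec] k.
  apply: measurable_funX.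
  rewrite (_ : (fun _ => _) = (fun x : vec => dotv u (cv x) - dotv u q)); last first.
    by apply/funext => x; rewrite dotvBr.
  by apply: measurable_funB => //; exact: measurable_dotv.
have kM (y : vec) : sphere (cv y) -> `|k y| <= (enorm u * 2) ^+ 2.
  move=> ys; rewrite /k normrX lerXn2r ?nnegrE ?mulr_ge0 ?enorm_ge0//.
  rewrite (le_trans (normr_dotv_le _ _))// ler_wpM2l ?enorm_ge0//.
  by rewrite (le_trans (ler_enormD _ _))// enormN (hq : enorm q = 1) (ys : enorm (cv y) = 1).
pose b n (z : vec) : R := (dotv u (cv z) - a n z * dotv u q) ^+ 2 / r n z.
have mb n : measurable_fun [set: vec] (b n).
  apply: measurable_funM; last first.
    by apply: (measurableT_comp measurable_invr); exact: measurable_blowup_radius.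
  apply: measurable_funX; apply: measurable_funB; first exact: measurable_dotv.
  by apply: measurable_funM => //; exact: measurable_blowup_slope.
have bE n (z : vec) : 2^-1 <= r n z <= 3 / 2 ->
    r n z * k (dir (blowup q (s n) (cv z))) = s n ^+ 2 * b n z.
  move=> /andP[/window_gt0 r0 _]; rewrite /k dotv_blowup_direction// /b.
  by field; rewrite gt_eqF.
have bK n (z : vec) : 2^-1 <= r n z <= 3 / 2 ->
    `|b n z| <= 8 * enorm u ^+ 2 * (1 + dotv (cv z) (cv z)) ^+ 1.
  move=> /andP[r1 _]; have r0 := window_gt0 r1.
  rewrite expr1 -enorm_sqr /b normrM normfV (gtr0_norm r0) normrX ler_pdivrMr//.
  have H := normr_blowup_coef n z u.
  apply: (@le_trans _ _ ((2 * enorm u * enorm (cv z)) ^+ 2)).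
    by rewrite lerXn2r// nnegrE !mulr_ge0 ?enorm_ge0.
  rewrite !exprMn; have := sqr_ge0 (enorm u); have := sqr_ge0 (enorm (cv z)).
  move: (enorm u ^+ 2) (enorm (cv z) ^+ 2) (r n z) r1 => U Z t t1 Z0 U0.
  have UZ : 0 <= U * Z by rewrite mulr_ge0.
  have H1 : 4 * (U * Z) <= 8 * (U * Z) * t by nra.
  have H2 : 0 <= 8 * U * t by nra.
  by nra.
have K0 : 0 <= 8 * enorm u ^+ 2 by rewrite mulr_ge0 ?sqr_ge0.
have bcvg (z : vec) : (fun n => b n z) @ \oo --> dotv v (cv z) ^+ 2.
  have -> : dotv v (cv z) ^+ 2 = (dotv u (cv z) - dotv q (cv z) * dotv u q) ^+ 2 / 1.
    by rewrite divr1 /v dotvBl dotvZl mulrC.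
  apply: cvgM; last by apply: cvgV => //; exact: blowup_radius_cvg.
  apply: cvg_exprn; apply: cvgB; first exact: cvg_cst.
  by apply: cvgMr_tmp; exact: blowup_slope_cvg.
have := laplace_limit mk kM K0 mb bE bK bcvg.
rewrite addn2 prednK//.
have -> : \int[lam]_z (rho q * E z * dotv v (cv z) ^+ 2) = rho q * (dotv v v * Num.sqrt (2 * pi) ^+ d).
  rewrite -Rintegral_gauss_quadratic -RintegralZl//.
    by apply: eq_Rintegral => z _; rewrite -mulrA expr2; congr (_ * _); rewrite mulrC.
  exact: integrable_gauss_quadratic.
by rewrite mulrA divM_sqrt.
Qed.

(** The limit integrand is half the squared length of the tangential part of [z], which lives in
    [d - 1] dimensions. This is where the coefficient of [q] in [Ylim] comes from. *)
Lemma laplace_gap :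
  (fun n => \int[P]_w (attention (s n ^+ 2)^-1 (X w) * (1 - dotv q (cv (X w)))) / s n ^+ d.+1) @ \oo -->
  rho q * ((d%:R - 1) / 2) * Num.sqrt (2 * pi) ^+ d.-1.
Proof.
pose k (x : vec) : R := 1 - dotv q (cv x).
have mk : measurable_fun [set: vec] k.
  by apply: measurable_funB => //; exact: measurable_dotv.
have kM (y : vec) : sphere (cv y) -> `|k y| <= 2.
  move=> ys; rewrite /k (le_trans (ler_normB _ _))// normr1 -[leRHS]/(1 + 1) lerD2l.
  by have := normr_dotv_le q (cv y); rewrite (hq : enorm q = 1) (ys : enorm (cv y) = 1) mulr1.
pose b n (z : vec) : R := 2^-1 * (dotv (cv z) (cv z) - a n z ^+ 2).
have mb n : measurable_fun [set: vec] (b n).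
  apply: measurable_funM => //; apply: measurable_funB; first exact: measurable_dotvv.
  by apply: measurable_funX; exact: measurable_blowup_slope.
have bE n (z : vec) : 2^-1 <= r n z <= 3 / 2 ->
    r n z * k (dir (blowup q (s n) (cv z))) = s n ^+ 2 * b n z.
  move=> /andP[/window_gt0 r0 _]; rewrite /k blowup_tilt// /b.
  by field; rewrite gt_eqF.
have bK n (z : vec) : 2^-1 <= r n z <= 3 / 2 -> `|b n z| <= 1 * (1 + dotv (cv z) (cv z)) ^+ 1.
  move=> _; rewrite mul1r expr1 /b normrM ger0_norm// -enorm_sqr.
  have az : `|a n z| <= enorm (cv z) := blowup_slope_le hq (s_gt0 n) (cv z).
  have : a n z ^+ 2 <= enorm (cv z) ^+ 2 by rewrite -[leLHS]real_normK ?num_real// lerXn2r// nnegrE enorm_ge0.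
  have := sqr_ge0 (a n z).
  move: (a n z ^+ 2) (enorm (cv z) ^+ 2) => A Z A0 AZ.
  by rewrite ger0_norm; lra.
have bcvg (z : vec) : (fun n => b n z) @ \oo --> 2^-1 * (dotv (cv z) (cv z) - dotv q (cv z) ^+ 2).
  apply: cvgMl_tmp; apply: cvgB; first exact: cvg_cst.
  by apply: cvg_exprn; exact: blowup_slope_cvg.
have := laplace_limit mk kM ler01 mb bE bK bcvg.
rewrite addn2 prednK//.
have -> : \int[lam]_z (rho q * E z * (2^-1 * (dotv (cv z) (cv z) - dotv q (cv z) ^+ 2))) =
    rho q / 2 * ((d%:R - 1) * Num.sqrt (2 * pi) ^+ d).
  have I1 : lam.-integrable [set: vec] (EFin \o (fun z : vec => dotv (cv z) (cv z) * E z)).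
    apply: (@integrable_monomial_gauss _ _ 1); first exact: measurable_dotvv.
    by move=> z; rewrite expr1 ger0_norm ?dotvv_ge0// lerDr.
  have H1 : \int[lam]_z (dotv (cv z) (cv z) * E z) = d%:R * Num.sqrt (2 * pi) ^+ d.
    transitivity (\int[lam]_z (\sum_(j < d) dotv (ebasis j) (cv z) * dotv (ebasis j) (cv z) * E z)).
      apply: eq_Rintegral => z _; rewrite mulr_suml; apply: eq_bigr => j _.
      by rewrite dotv_ebasis.
    rewrite Rintegral_sum; last by move=> j; exact: integrable_gauss_quadratic.
    under eq_bigr do rewrite Rintegral_gauss_quadratic dotv_ebasis mxE !eqxx mul1r.
    by rewrite sumr_const card_ord [RHS]mulr_natl.
  have I2 := integrable_gauss_quadratic q q.
  have H2 := Rintegral_gauss_quadratic q q; rewrite (dotvv_sphere hq) mul1r in H2.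
  transitivity (\int[lam]_z (rho q / 2 * (dotv (cv z) (cv z) * E z - dotv q (cv z) * dotv q (cv z) * E z))).
    by apply: eq_Rintegral => z _; ring.
  rewrite RintegralZl//; last exact: (integrableB _ I1 I2).
  by rewrite (RintegralB _ I1 I2)// H1 H2; ring.
rewrite mulrA divM_sqrt.
by rewrite (_ : rho q / 2 * (d%:R - 1) = rho q * ((d%:R - 1) / 2)); last by ring.
Qed.

(** First order correction to the limit of [tilted]. The tangential first moment needs it, because
    against the limit itself a linear form integrates to 0. *)
Definition tilted_slope n (z : vec) : R := (tilted (s n) z - rho q * E z) / s n.

Lemma measurable_tilted_slope n : measurable_fun [set: vec] (tilted_slope n).
Proof.
apply: measurable_funM => //; apply: measurable_funB; first exact: measurable_tilted.
by apply: measurable_funM => //; exact: measurable_gauss_vec.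
Qed.

Let rq_ge0 : 0 <= rho q. Proof. exact: rho_ge0. Qed.

(** Inside the window the division by [s] is paid by the Lipschitz bound on the density and by
    [expRN_dist] for the exponents, whose difference is of order [r - 1], hence of order [s]. *)
Lemma tilted_slope_le : exists2 K : R, 0 <= K & forall n z, `|tilted_slope n z| <=
  K * ((1 + dotv (cv z) (cv z)) ^+ 2 * expR (- (3^-1 * dotv (cv z) (cv z)))).
Proof.
have [L L0 LP] := radial_ext_blowup_dist.
exists (L + 2 * rho q) => [|n z]; first by rewrite addr_ge0// mulr_ge0.
have sn := s_gt0 n.
set e := dotv (cv z) (cv z); set G3 := expR (- (3^-1 * e)).
have e0 : 0 <= e := dotvv_ge0 _.
have ez : enorm (cv z) ^+ 2 = e by rewrite enorm_sqr.
have z0 := enorm_ge0 (cv z).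
have z1 : enorm (cv z) <= (1 + e) ^+ 2 by nra.
have z3 : enorm (cv z) * e <= (1 + e) ^+ 2 by nra.
have G0 : 0 <= G3 := expR_ge0 _.
rewrite /tilted_slope normrM normfV (gtr0_norm sn) ler_pdivrMr//.
(* Outside the window [tilted] is 0 but its limit is not. There [2^-1 <= s n * enorm z], so
   [1 / s n] is at most [2 * enorm z], which the Gaussian absorbs. *)
have [/andP[r1 r2]|/negbTE Hw] := boolP (2^-1 <= r n z <= 3 / 2); last first.
  have : cutoff (r n z) = 0 by rewrite /cutoff Hw.
  move=> H; rewrite /tilted H mul0r sub0r normrN ger0_norm ?mulr_ge0 ?expR_ge0//.
  have {}H := le_trans (cutoff_eq0 H) (dist_blowup_radius hq sn (cv z)).
  have EG : E z <= G3 by rewrite ler_expR lerN2 ler_wpM2r//; lra.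
  have E0 : 0 <= E z := expR_ge0 _.
  apply: (@le_trans _ _ (rho q * G3 * (2 * (s n * enorm (cv z))))).
    rewrite -mulrA ler_wpM2l//; apply: (le_trans EG).
    by rewrite ler_peMr//; lra.
  have H2 : G3 * s n * enorm (cv z) <= G3 * s n * (1 + e) ^+ 2.
    by rewrite ler_wpM2l// mulr_ge0// ltW.
  have -> : (L + 2 * rho q) * ((1 + e) ^+ 2 * G3) * s n =
     (L + 2 * rho q) * (G3 * s n * (1 + e) ^+ 2) by ring.
  have -> : rho q * G3 * (2 * (s n * enorm (cv z))) = 2 * rho q * (G3 * s n * enorm (cv z)) by ring.
  apply: ler_pM => //; first by rewrite mulr_ge0.
    by rewrite !mulr_ge0// ltW.
  by rewrite lerDr.
have r0 := window_gt0 r1.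
rewrite /tilted /cutoff r1 r2 mul1r.
set D := radial_ext rho _; set A := e / (2 * r n z).
have -> : D * expR (- A) - rho q * E z = (D - rho q) * expR (- A) + rho q * (expR (- A) - E z) by ring.
have HA : expR (- A) <= G3 by apply: expR_div_le => //; rewrite r1.
have H1 : `|(D - rho q) * expR (- A)| <= L * (s n * enorm (cv z)) * G3.
  by rewrite normrM (ger0_norm (expR_ge0 _)) ler_pM ?expR_ge0//; exact: LP.
have H2 : `|rho q * (expR (- A) - E z)| <= rho q * (s n * (enorm (cv z) * e) * G3).
  rewrite normrM (ger0_norm rq_ge0) ler_wpM2l//.
  have cA : 3^-1 * e <= A by rewrite /A mulrC ler_wpM2l// lef_pV2 ?posrE; lra.
  have cE : 3^-1 * e <= 2^-1 * e by rewrite ler_wpM2r//; lra.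
  apply: (le_trans (expRN_dist cA cE)); rewrite ler_wpM2r//.
  have -> : A - 2^-1 * e = - ((r n z - 1) * (e / (2 * r n z))) by rewrite /A; field; rewrite gt_eqF.
  rewrite normrN normrM [leRHS]mulrA; apply: ler_pM => //; first exact: dist_blowup_radius.
  rewrite ger0_norm ?divr_ge0 ?mulr_ge0// ?(ltW r0)// ler_pdivrMr ?mulr_gt0// ler_peMr//.
  by lra.
rewrite (le_trans (ler_normD _ _))// (le_trans (lerD H1 H2))//.
have -> : (L + 2 * rho q) * ((1 + e) ^+ 2 * G3) * s n =
   L * (s n * (1 + e) ^+ 2) * G3 + rho q * (2 * s n * (1 + e) ^+ 2 * G3) by ring.
apply: lerD; first by rewrite ler_wpM2r// ler_wpM2l// ler_wpM2l// ltW.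
rewrite ler_wpM2l// ler_wpM2r// -mulrA (mulrCA 2) ler_wpM2l//; first exact: ltW.
by rewrite (le_trans z3)// ler_peMl// ?exprn_ge0 ?addr_ge0//; lra.
Qed.

Local Notation g := (egrad rho q).

(** The derivative at 0 of [rho] along the curve of directions of [q + s z], whose velocity is the
    tangential part of [z]. The expansion of [rho] at [q] is applied to the point of the sphere
    itself. *)
Lemma radial_ext_slope_cvg (z : vec) :
  (fun n => (radial_ext rho (blowup q (s n) (cv z)) - rho q) / s n) @ \oo -->
  dotv g (cv z) - dotv q (cv z) * dotv g q.
Proof.
have Hc : (fun n => (dotv g (cv z) - a n z * dotv g q) / r n z) @ \oo -->
    dotv g (cv z) - dotv q (cv z) * dotv g q.
  rewrite -[X in _ --> X]divr1; apply: cvgM.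
    by apply: cvgB; [exact: cvg_cst|apply: cvgMr_tmp; exact: blowup_slope_cvg].
  by apply: cvgV => //; exact: blowup_radius_cvg.
rewrite -[X in _ --> X]addr0.
pose D n := (radial_ext rho (blowup q (s n) (cv z)) - rho q) / s n -
   (dotv g (cv z) - a n z * dotv g q) / r n z.
have -> : (fun n => (radial_ext rho (blowup q (s n) (cv z)) - rho q) / s n) =
    (fun n => (dotv g (cv z) - a n z * dotv g q) / r n z + D n).
  by apply/funext => n; rewrite /D addrCA subrr addr0.
apply: cvgD; first exact: Hc.
apply/cvgrPdist_le => e e0.
(* The 4 is that of [blowup_direction_dist]; adding 1 keeps the denominator positive at [z = 0]. *)
have e'0 : 0 < e / (4 * (1 + enorm (cv z))).
  by rewrite divr_gt0// mulr_gt0// ltr_pwDl// enorm_ge0.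
have [del del0 T1] := C2_taylor1 hq hC2 e'0.
have sz0 : (fun n => s n * (4 * enorm (cv z))) @ \oo --> (0 : R).
  by rewrite -[X in _ --> X](mul0r (4 * enorm (cv z))); exact: cvgMr_tmp.
near=> n.
have /andP[r1 _] : 2^-1 <= r n z <= 3 / 2 by near: n; exact: blowup_window.
have r0 := window_gt0 r1.
set x : 'cV[R]_d := dir (blowup q (s n) (cv z)).
have dx : enorm (x - q) <= s n * (4 * enorm (cv z)) by exact: blowup_direction_dist.
have sdel : s n * (4 * enorm (cv z)) < del.
  by near: n; have /cvgr_lt/(_ _ del0) := sz0.
have := T1 x (le_lt_trans dx sdel).
have -> : dotv g (x - q) = s n * ((dotv g (cv z) - a n z * dotv g q) / r n z) by exact: dotv_blowup_direction.
move=> H; rewrite sub0r normrN /D /radial_ext ifT// -/x.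
have -> : (rho x - rho q) / s n - (dotv g (cv z) - a n z * dotv g q) / r n z =
   (rho x - rho q - s n * ((dotv g (cv z) - a n z * dotv g q) / r n z)) / s n.
  by field; rewrite !gt_eqF//=.
rewrite normrM normfV (gtr0_norm (s_gt0 n)) ler_pdivrMr// (le_trans H)//.
apply: (@le_trans _ _ (e / (4 * (1 + enorm (cv z))) * (s n * (4 * (1 + enorm (cv z)))))).
  rewrite ler_wpM2l ?(ltW e'0)// (le_trans dx)// ler_wpM2l ?(ltW (s_gt0 n))// ler_wpM2l//.
  by rewrite lerDr.
rewrite mulrCA -mulrA mulVf ?mulr1; first by rewrite mulrC.
by rewrite mulf_neq0// gt_eqF// ltr_pwDl// enorm_ge0.
Unshelve. all: by end_near.
Qed.

(** Two first order effects: the variation of the density, and the radius [r = 1 + s a] in the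
    exponent, which multiplies [E z] by [expR (s * a * dotv z z / (2 r))]. *)
Lemma tilted_slope_cvg (z : vec) : (fun n => tilted_slope n z) @ \oo -->
  E z * (dotv g (cv z) - dotv q (cv z) * dotv g q) +
  rho q * (E z * (dotv q (cv z) * (dotv (cv z) (cv z) / 2))).
Proof.
set e := dotv (cv z) (cv z).
pose c n := a n z * (e / (2 * r n z)).
have rV : (fun n => e / (2 * r n z)) @ \oo --> e / 2.
  rewrite -{2}[2]mulr1; apply: cvgMl_tmp; apply: cvgV; first by rewrite mulr1.
  by apply: cvgMl_tmp; exact: blowup_radius_cvg.
have ccvg : c @ \oo --> dotv q (cv z) * (e / 2).
  by apply: cvgM => //; exact: blowup_slope_cvg.
have HA : (fun n => expR (- (e / (2 * r n z)))) @ \oo --> E z.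
  apply: continuous_cvg; first exact: continuous_expR.
  by apply: cvgN; rewrite mulrC.
have H : (fun n => expR (- (e / (2 * r n z))) *
     ((radial_ext rho (blowup q (s n) (cv z)) - rho q) / s n) +
     rho q * (E z * ((expR (s n * c n) - 1) / s n))) @ \oo -->
  E z * (dotv g (cv z) - dotv q (cv z) * dotv g q) +
  rho q * (E z * (dotv q (cv z) * (e / 2))).
  apply: cvgD; first by apply: cvgM => //; exact: radial_ext_slope_cvg.
  by apply: cvgMl_tmp; apply: cvgMl_tmp; exact: expR_slope_cvg.
apply: cvg_trans H; apply: near_eq_cvg.
have := blowup_window z; apply: filterS => n /= W; have /andP[/window_gt0 r0 _] := W.
rewrite /tilted_slope /tilted /cutoff W mul1r -/e.
have -> : expR (- (e / (2 * r n z))) = E z * expR (s n * c n).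
  rewrite -expRD; congr expR; rewrite /c mulrA -/e.
  have -> : s n * a n z = r n z - 1 by rewrite [r n z]blowup_radiusE// addrC addKr.
  by field; rewrite gt_eqF.
have sn0 : s n != 0 by rewrite gt_eqF.
by field.
Qed.

(** For [u] orthogonal to [q] the blown-up moment is exactly linear in [z]. Of the two terms of
    [tilted_slope_cvg], the gradient one is quadratic once multiplied by it, and the other is the
    quartic integral that vanishes for orthogonal [u] and [q]. *)
Lemma laplace_tangential (u : 'cV[R]_d) : dotv u q = 0 ->
  (fun n => \int[P]_w (attention (s n ^+ 2)^-1 (X w) * dotv u (cv (X w) - q)) / s n ^+ d.+1) @ \oo -->
  dotv u g * Num.sqrt (2 * pi) ^+ d.-1.
Proof.
move=> uq; rewrite -divM_sqrt.
pose k (x : vec) : R := dotv u (cv x - q).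
have mk : measurable_fun [set: vec] k.
  rewrite /k (_ : (fun _ => _) = (fun x : vec => dotv u (cv x) - dotv u q)); last first.
    by apply/funext => x; rewrite dotvBr.
  by apply: measurable_funB => //; exact: measurable_dotv.
have kM (y : vec) : sphere (cv y) -> `|k y| <= enorm u * 2.
  move=> ys; rewrite (le_trans (normr_dotv_le _ _))// ler_wpM2l ?enorm_ge0//.
  by rewrite (le_trans (ler_enormD _ _))// enormN (hq : enorm q = 1) (ys : enorm (cv y) = 1).
have [K K0 KP] := tilted_slope_le.
pose bnd (z : vec) := (enorm u * K) * ((1 + dotv (cv z) (cv z)) ^+ 3 * expR (- (3^-1 * dotv (cv z) (cv z)))).
have bound n (z : vec) : `|dotv u (cv z) * tilted_slope n z| <= bnd z.
  rewrite normrM /bnd exprS.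
  have -> : enorm u * K * ((1 + dotv (cv z) (cv z)) * (1 + dotv (cv z) (cv z)) ^+ 2 *
     expR (- (3^-1 * dotv (cv z) (cv z)))) = (enorm u * (1 + dotv (cv z) (cv z))) *
     (K * ((1 + dotv (cv z) (cv z)) ^+ 2 * expR (- (3^-1 * dotv (cv z) (cv z))))) by ring.
  apply: ler_pM => //.
  rewrite (le_trans (normr_dotv_le _ _))// ler_wpM2l ?enorm_ge0//.
  by rewrite -enorm_sqr; have := enorm_ge0 (cv z); nra.
have mf n : measurable_fun [set: vec] (fun z => dotv u (cv z) * tilted_slope n z).
  by apply: measurable_funM; [exact: measurable_dotv|exact: measurable_tilted_slope].
have Ig : lam.-integrable [set: vec] (EFin \o bnd).
  apply: (@integrable_poly_gauss_vec _ _ _ 3 3^-1 (enorm u * K)); first by rewrite invr_gt0.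
    apply: measurable_funM => //; apply: measurable_funM; last exact: measurable_gauss_vec.
    by apply: measurable_funX; apply: measurable_funD => //; exact: measurable_dotvv.
  by move=> z; rewrite ger0_norm//; apply: le_trans (bound 0%N z).
have pt (z : vec) : (fun n => dotv u (cv z) * tilted_slope n z) @ \oo -->
   dotv u (cv z) * (E z * (dotv g (cv z) - dotv q (cv z) * dotv g q) +
     rho q * (E z * (dotv q (cv z) * (dotv (cv z) (cv z) / 2)))).
  by apply: cvgMl_tmp; exact: tilted_slope_cvg.
have [_ HI] := dominated_convergence_real mf pt Ig bound.
have EI : \int[lam]_z (dotv u (cv z) * (E z * (dotv g (cv z) - dotv q (cv z) * dotv g q) +
     rho q * (E z * (dotv q (cv z) * (dotv (cv z) (cv z) / 2))))) =
   dotv u g * Num.sqrt (2 * pi) ^+ d.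
  pose v := g - dotv g q *: q.
  have I1 := integrable_gauss_quadratic u v.
  have I2 : lam.-integrable [set: vec] (EFin \o (fun z : vec =>
      dotv u (cv z) * dotv q (cv z) * (dotv (cv z) (cv z) * E z))).
    apply: (@integrable_poly_gauss_vec _ _ _ 2 2^-1 (enorm u)); first by rewrite invr_gt0.
      apply: measurable_funM; first by apply: measurable_funM; exact: measurable_dotv.
      by apply: measurable_funM; [exact: measurable_dotvv|exact: measurable_gauss_vec].
    move=> z; rewrite !mulrA normrM (ger0_norm (expR_ge0 _)) ler_wpM2r ?expR_ge0//.
    rewrite normrM (ger0_norm (dotvv_ge0 _)); apply: ler_pM => //; rewrite ?dotvv_ge0//; last by rewrite lerDr.
    apply: (@le_trans _ _ ((enorm u * enorm (cv z)) * (1 * enorm (cv z)))).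
      rewrite normrM ler_pM// ?normr_dotv_le// -(hq : enorm q = 1); exact: normr_dotv_le.
    by rewrite mul1r -mulrA -expr2 enorm_sqr ler_wpM2l ?enorm_ge0// lerDr.
  transitivity (\int[lam]_z (dotv u (cv z) * dotv v (cv z) * E z +
      rho q / 2 * (dotv u (cv z) * dotv q (cv z) * (dotv (cv z) (cv z) * E z)))).
    by apply: eq_Rintegral => z _; rewrite /v dotvBl dotvZl; field.
  rewrite (RintegralD measurableT I1 (integrableZ (rho q / 2) I2)) RintegralZl//.
  by rewrite Rintegral_gauss_quadratic Rintegral_gauss_quartic// mulr0 addr0 /v dotvBr dotvZr uq mulr0 subr0.
rewrite EI in HI; apply: laplace_quotient HI => n.
have sn0 : s n != 0 by rewrite gt_eqF.
rewrite mulrAC (laplace_polar (s_gt0 n) mk kM).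
have -> : \int[lam]_z (tilted (s n) z * (r n z * k (dir (blowup q (s n) (cv z))))) =
    s n ^+ 2 * \int[lam]_z (dotv u (cv z) * tilted_slope n z).
  have I1 : lam.-integrable [set: vec] (EFin \o (fun z => dotv u (cv z) * tilted_slope n z)).
    exact: integrable_dominated (mf n) Ig (bound n).
  have I2 : lam.-integrable [set: vec] (EFin \o (fun z : vec => dotv u (cv z) * E z)).
    apply: (@integrable_poly_gauss_vec _ _ _ 1 2^-1 (enorm u)); first by rewrite invr_gt0.
      by apply: measurable_funM; [exact: measurable_dotv|exact: measurable_gauss_vec].
    move=> z; rewrite !mulrA normrM (ger0_norm (expR_ge0 _)) ler_wpM2r ?expR_ge0// expr1.
    rewrite (le_trans (normr_dotv_le _ _))// ler_wpM2l ?enorm_ge0//.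
    by rewrite -enorm_sqr; have := enorm_ge0 (cv z); nra.
  (* Writing [tilted] as its limit plus [s n * tilted_slope] isolates the term of order [s n], a
     linear form against the Gaussian, which integrates to 0 for every [n]. *)
  transitivity (\int[lam]_z (s n ^+ 2 * (dotv u (cv z) * tilted_slope n z) +
      s n * rho q * (dotv u (cv z) * E z))).
    apply: eq_Rintegral => z _.
    have -> : tilted (s n) z * (r n z * k (dir (blowup q (s n) (cv z)))) =
        tilted (s n) z * (s n * dotv u (cv z)).
      apply: tilted_cutoff => /andP[/window_gt0 r0 _].
      by rewrite /k dotv_blowup_direction// uq mulr0 subr0; field; rewrite gt_eqF.
    by rewrite /tilted_slope; field.
  rewrite (RintegralD measurableT (integrableZ (s n ^+ 2) I1) (integrableZ (s n * rho q) I2)).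
  by rewrite !RintegralZl// Rintegral_gauss_linear mulr0 addr0.
have -> : s n ^+ d.+1 = s n ^+ d.-1 * s n ^+ 2 by rewrite -exprD addn2 prednK.
by field; rewrite sn0 expf_neq0.
Qed.

(** Split [u] into its tangential part and [dotv u q *: q]. On the sphere [dotv q (x - q)] is minus
    the gap [1 - dotv q x], already of order [s ^+ 2], so both parts contribute at the same
    order. *)
Lemma laplace_first_moment (u : 'cV[R]_d) : 0 < rho q ->
  (fun n => \int[P]_w (attention (s n ^+ 2)^-1 (X w) * dotv u (cv (X w) - q)) / s n ^+ d.+1) @ \oo -->
  rho q * dotv u (Ylim rho q) * Num.sqrt (2 * pi) ^+ d.-1.
Proof.
move=> rq.
pose v := u - dotv u q *: q.
have vq : dotv v q = 0 by rewrite /v dotvBl dotvZl (dotvv_sphere hq) mulr1 subrr.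
have b0 n : 0 <= (s n ^+ 2)^-1 by rewrite invr_ge0 sqr_ge0.
have mk1 : measurable_fun [set: vec] (fun x : vec => dotv v (cv x - q)).
  rewrite (_ : (fun _ => _) = (fun x : vec => dotv v (cv x) - dotv v q)); last first.
    by apply/funext => x; rewrite dotvBr.
  by apply: measurable_funB => //; exact: measurable_dotv.
have mk2 : measurable_fun [set: vec] (fun x : vec => 1 - dotv q (cv x)).
  by apply: measurable_funB => //; exact: measurable_dotv.
have kM1 (y : vec) : sphere (cv y) -> `|dotv v (cv y - q)| <= enorm v * 2.
  move=> ys; rewrite (le_trans (normr_dotv_le _ _))// ler_wpM2l ?enorm_ge0//.
  by rewrite (le_trans (ler_enormD _ _))// enormN (hq : enorm q = 1) (ys : enorm (cv y) = 1).
have kM2 (y : vec) : sphere (cv y) -> `|1 - dotv q (cv y)| <= 2.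
  move=> ys; rewrite (le_trans (ler_normB _ _))// normr1 -[leRHS]/(1 + 1) lerD2l.
  by have := normr_dotv_le q (cv y); rewrite (hq : enorm q = 1) (ys : enorm (cv y) = 1) mulr1.
have -> : (fun n => \int[P]_w (attention (s n ^+ 2)^-1 (X w) * dotv u (cv (X w) - q)) / s n ^+ d.+1) =
  (fun n => \int[P]_w (attention (s n ^+ 2)^-1 (X w) * dotv v (cv (X w) - q)) / s n ^+ d.+1 -
     dotv u q * (\int[P]_w (attention (s n ^+ 2)^-1 (X w) * (1 - dotv q (cv (X w)))) / s n ^+ d.+1)).
  apply/funext => n; rewrite mulrA -mulrBl; congr (_ / _).
  have I1 := integrable_attention (b0 n) mk1 kM1.
  have I2 := integrable_attention (b0 n) mk2 kM2.
  rewrite -RintegralZl// -RintegralB//; last exact: integrableZ I2.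
  apply: eq_Rintegral => w _; rewrite /v dotvBl dotvZl (dotvBr q) (dotvv_sphere hq).
  by ring.
have -> : rho q * dotv u (Ylim rho q) * Num.sqrt (2 * pi) ^+ d.-1 =
    dotv v g * Num.sqrt (2 * pi) ^+ d.-1 -
    dotv u q * (rho q * ((d%:R - 1) / 2) * Num.sqrt (2 * pi) ^+ d.-1).
  have -> : rho q * dotv u (Ylim rho q) = dotv v g - rho q * ((d%:R - 1) / 2 * dotv u q).
    rewrite /Ylim dotvBr dotvZr mulrBr; congr (_ - _).
    rewrite (egrad_ln hq hC2 rq) -scalemxAr dotvZr mulVKf ?gt_eqF//.
    by rewrite projT_mulmx dotvBr dotvZr /v dotvBl dotvZl mulrC.
  by ring.
apply: cvgB; first exact: laplace_tangential.
by apply: cvgMl_tmp; exact: laplace_gap.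
Qed.

End laplace.

(** * Sums of independent variables *)

Section independent_sequence.
Context {R : realType} {dT : measure_display} {T : measurableType dT} (P : probability T R).
Context {dY : measure_display} {Y : measurableType dY}.
Variable x : nat -> T -> Y.
Hypothesis x_measurable : forall i, measurable_fun [set: T] (x i).
Hypothesis x_indep : forall (I : seq nat) (A : nat -> set Y), uniq I ->
  (forall k, k \in I -> measurable (A k)) ->
  P (\bigcap_(k in [set k | k \in I]) (x k @^-1` A k)) = (\prod_(k <- I) P (x k @^-1` A k))%E.
Hypothesis x_law : forall i A, measurable A -> P (x i @^-1` A) = P (x 0%N @^-1` A).

Lemma Rintegral_prob_cst (c : R) : \int[P]_w c = c.
Proof.
rewrite (Rintegral_cst P measurableT).
by apply: etrans (mulr1 c); congr (_ * _); exact: (congr1 fine (@probability_setT _ T R P)).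
Qed.

Let measurable_preimage i A : measurable A -> measurable (x i @^-1` A).
Proof. by move=> mA; rewrite -[X in measurable X]setTI; exact: x_measurable. Qed.

Definition event_prod (I : seq nat) (A : nat -> set Y) (w : T) : R :=
  \prod_(j <- I) \1_(A j) (x j w).

Definition event_prob (I : seq nat) (A : nat -> set Y) : R :=
  \prod_(j <- I) fine (P (x j @^-1` A j)).

Lemma event_prodE I A w :
  event_prod I A w = \1_(\bigcap_(k in [set k | k \in I]) (x k @^-1` A k)) w.
Proof.
rewrite /event_prod; elim: I => [|j I IH].
  rewrite big_nil (_ : \bigcap_(k in _) _ = setT) ?indicT//.
  by apply/seteqP; split => // t _ k.
rewrite big_cons IH !indicE -natrM mulnb; congr (_%:R); congr nat_of_bool.
apply/idP/idP => [/andP[]|] /[!inE] /=.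
  by move=> Aj AI k /=; rewrite inE => /predU1P[->//|kI]; exact: AI.
move=> H; apply/andP; split; rewrite inE; first by apply: H; rewrite /= mem_head.
by move=> k /= kI; apply: H; rewrite /= inE kI orbT.
Qed.

Lemma event_prod_ge0 I A w : 0 <= event_prod I A w.
Proof. by rewrite event_prodE indicE. Qed.

Lemma event_prod_le1 I A w : event_prod I A w <= 1.
Proof. by rewrite event_prodE indicE lern1 leq_b1. Qed.

Lemma measurable_event_prod I A : (forall k, k \in I -> measurable (A k)) ->
  measurable_fun [set: T] (event_prod I A).
Proof.
move=> mA; rewrite /event_prod; elim: I mA => [|j I IH] mA.
  rewrite (_ : (fun _ => _) = cst 1)//.
  by apply/funext => w; rewrite big_nil.
rewrite (_ : (fun _ => _) = (fun w => \1_(A j) (x j w) * \prod_(i <- I) \1_(A i) (x i w))); last first.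
  by apply/funext => w; rewrite big_cons.
apply: measurable_funM; last by apply: IH => k kI; apply: mA; rewrite inE kI orbT.
have mi : measurable_fun [set: Y] (\1_(A j) : Y -> R) by apply: measurable_indic; apply: mA; rewrite mem_head.
exact: measurableT_comp mi (x_measurable j).
Qed.

Lemma event_prob_ge0 I A : 0 <= event_prob I A.
Proof. by apply: prodr_ge0 => j _; exact: fine_ge0. Qed.

Lemma Rintegral_event_prod I A : uniq I -> (forall k, k \in I -> measurable (A k)) ->
  \int[P]_w event_prod I A w = event_prob I A.
Proof.
move=> uI mA; pose B := \bigcap_(k in [set k | k \in I]) (x k @^-1` A k).
have mB : measurable B.
  by apply: bigcap_measurableType => k kI; apply: measurable_preimage; exact: mA.
rewrite (_ : (fun w => _) = (fun w => \1_B w)); last first.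
  by apply/funext => w; rewrite event_prodE.
have PB : (\int[P]_w (\1_B w)%:E = \prod_(k <- I) P (x k @^-1` A k))%E.
  by rewrite integral_indic// setIT; exact: x_indep.
rewrite /Rintegral PB -[RHS]/(fine (event_prob I A)%:E); congr fine.
rewrite /event_prob -prodEFin; apply: eq_big_seq => j jI.
by rewrite fineK// fin_num_measure//; apply: measurable_preimage; exact: mA.
Qed.

(* [W] is independent of [x k, x k.+1, ...]: in place of sigma-algebras, the product rule is required
   against indicators of finitely many of these variables. *)
Definition future_indep (k : nat) (W : T -> R) : Prop :=
  forall (I : seq nat) (A : nat -> set Y), uniq I -> (forall j, j \in I -> (k <= j)%N) ->
    (forall j, j \in I -> measurable (A j)) ->
    \int[P]_w (W w * event_prod I A w) = \int[P]_w W w * event_prob I A.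

Definition bounded_rv (W : T -> R) : Prop :=
  measurable_fun [set: T] W /\ exists M : R, forall w, `|W w| <= M.

Lemma bounded_rv_integrable W : bounded_rv W -> P.-integrable [set: T] (EFin \o W).
Proof. by move=> [mW [M WM]]; exact: integrable_bounded mW WM. Qed.

Lemma bounded_rv_cst c : bounded_rv (fun=> c).
Proof. by split => //; exists `|c|. Qed.

Lemma bounded_rvD V W : bounded_rv V -> bounded_rv W -> bounded_rv (fun w => V w + W w).
Proof.
move=> [mV [M VM]] [mW [N WN]]; split; first exact: measurable_funD.
by exists (M + N) => w; rewrite (le_trans (ler_normD _ _))// lerD.
Qed.

Lemma bounded_rvM V W : bounded_rv V -> bounded_rv W -> bounded_rv (fun w => V w * W w).
Proof.
move=> [mV [M VM]] [mW [N WN]]; split; first exact: measurable_funM.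
by exists (M * N) => w; rewrite normrM ler_pM.
Qed.

Lemma bounded_rvZ c W : bounded_rv W -> bounded_rv (fun w => c * W w).
Proof. by apply: bounded_rvM; exact: bounded_rv_cst. Qed.

Lemma bounded_rv_sum n (W : nat -> T -> R) : (forall j, bounded_rv (W j)) ->
  bounded_rv (fun w => \sum_(j < n) W j w).
Proof.
move=> bW; elim: n => [|n IH].
  rewrite (_ : (fun _ => _) = fun=> 0); first exact: bounded_rv_cst.
  by apply/funext => w; rewrite big_ord0.
rewrite (_ : (fun _ => _) = (fun w => \sum_(j < n) W j w + W n w)); first exact: bounded_rvD.
by apply/funext => w; rewrite big_ord_recr.
Qed.

Lemma bounded_rv_event_prod I A : (forall k, k \in I -> measurable (A k)) ->
  bounded_rv (event_prod I A).
Proof.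
move=> mA; split; first exact: measurable_event_prod.
by exists 1 => w; rewrite ger0_norm ?event_prod_ge0// event_prod_le1.
Qed.

Lemma bounded_rv_comp i (g : Y -> R) : measurable_fun [set: Y] g ->
  (exists M : R, forall w, `|g (x i w)| <= M) -> bounded_rv (fun w => g (x i w)).
Proof. by move=> mg gM; split => //; exact: measurableT_comp mg (x_measurable i). Qed.

Lemma RintegralD_bounded V W : bounded_rv V -> bounded_rv W ->
  \int[P]_w (V w + W w) = \int[P]_w V w + \int[P]_w W w.
Proof. by move=> /bounded_rv_integrable iV /bounded_rv_integrable iW; rewrite (RintegralD measurableT iV iW). Qed.

Lemma RintegralZ_bounded c W : bounded_rv W -> \int[P]_w (c * W w) = c * \int[P]_w W w.
Proof. by move=> /bounded_rv_integrable iW; exact: RintegralZl. Qed.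

Lemma future_indep_cst k c : future_indep k (fun=> c).
Proof.
move=> I A uI kI mA; rewrite RintegralZ_bounded; last exact: bounded_rv_event_prod.
by rewrite Rintegral_event_prod// Rintegral_prob_cst.
Qed.

Lemma future_indepD k V W : bounded_rv V -> bounded_rv W -> future_indep k V -> future_indep k W ->
  future_indep k (fun w => V w + W w).
Proof.
move=> bV bW iV iW I A uI kI mA; have bE := bounded_rv_event_prod mA.
rewrite (_ : (fun w => _) = (fun w => V w * event_prod I A w + W w * event_prod I A w)); last first.
  by apply/funext => w; rewrite mulrDl.
by rewrite !RintegralD_bounded//; [rewrite iV// iW// mulrDl|exact: bounded_rvM|exact: bounded_rvM].
Qed.

Lemma future_indepZ k c W : bounded_rv W -> future_indep k W -> future_indep k (fun w => c * W w).
Proof.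
move=> bW iW I A uI kI mA; have bE := bounded_rv_event_prod mA.
rewrite (_ : (fun w => _) = (fun w => c * (W w * event_prod I A w))); last first.
  by apply/funext => w; rewrite mulrA.
by rewrite !RintegralZ_bounded//; [rewrite iW// mulrA|exact: bounded_rvM].
Qed.

Lemma future_indep_le k l W : (k <= l)%N -> future_indep k W -> future_indep l W.
Proof. by move=> kl iW I A uI lI mA; apply: iW => // j /lI; exact: leq_trans. Qed.

Section step.
Variables (k : nat) (W : T -> R).
Hypothesis bW : bounded_rv W.
Hypothesis iW : future_indep k W.

(** Two measures on [Y] are compared: the image under [x k] of the measure with density
    [W * event_prod I A], and a multiple of the law of [x k]. [future_indep] for [k :: I] says that
    they agree on sets, hence on [g]. Nonnegativity of [W] makes the first one a measure. *)
Let step_ge0 (g : Y -> R) I A : (forall w, 0 <= W w) -> measurable_fun [set: Y] g ->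
  (forall y, 0 <= g y) -> (exists M : R, forall w, `|g (x k w)| <= M) -> uniq I ->
  (forall j, j \in I -> (k < j)%N) -> (forall j, j \in I -> measurable (A j)) ->
  \int[P]_w (W w * event_prod I A w * g (x k w)) =
  \int[P]_w W w * event_prob I A * \int[P]_w g (x k w).
Proof.
move=> W0 mg g0 gM uI kI mA.
have bE := bounded_rv_event_prod mA.
have bWE := bounded_rvM bW bE.
have WE0 w : 0 <= W w * event_prod I A w by rewrite mulr_ge0 ?event_prod_ge0.
have c0 : 0 <= \int[P]_w W w * event_prob I A.
  by rewrite mulr_ge0 ?event_prob_ge0//; apply: Rintegral_ge0.
pose nu := density_measure P bWE.1 WE0.
pose mc := mscale (NngNum c0) (image_measure P (x_measurable k)).
have bg := bounded_rv_comp mg gM.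
have mEg : measurable_fun [set: Y] (EFin \o g) by exact/measurable_EFinP.
have g0' y : (0 <= (EFin \o g) y)%E by rewrite lee_fin.
have H : (\int[image_measure nu (x_measurable k)]_y (EFin \o g) y = \int[mc]_y (EFin \o g) y)%E.
  apply: eq_measure_integral => B mB _.
  rewrite image_measureE /nu (density_measureE P bWE.1 WE0) /mc.
  (* Consistent because all indices of [I] exceed [k], so [k] is free to carry the event [B]. *)
  pose A' j := if j == k then B else A j.
  have mA' j : j \in k :: I -> measurable (A' j).
    by rewrite inE /A'; case: eqP => //= _; exact: mA.
  have uI' : uniq (k :: I) by rewrite /= uI andbT; apply/negP => /kI; rewrite ltnn.
  have kI' j : j \in k :: I -> (k <= j)%N by rewrite inE => /predU1P[->//|/kI/ltnW].
  have := iW uI' kI' mA'.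
  have AE w : event_prod (k :: I) A' w = \1_B (x k w) * event_prod I A w.
    rewrite /event_prod big_cons {1}/A' eqxx; congr (_ * _); apply: eq_big_seq => j /kI kj.
    by rewrite /A' gtn_eqF.
  have PE : event_prob (k :: I) A' = fine (P (x k @^-1` B)) * event_prob I A.
    rewrite /event_prob big_cons {1}/A' eqxx; congr (_ * _); apply: eq_big_seq => j /kI kj.
    by rewrite /A' gtn_eqF.
  rewrite PE => HH.
  rewrite integral_mkcond.
  have -> : (\int[P]_w ((fun x0 : T => (W x0 * event_prod I A x0)%:E) \_ (x k @^-1` B)) w =
     \int[P]_w (W w * event_prod (k :: I) A' w)%:E)%E.
    apply: eq_integral => w _; rewrite patchE AE indicE.
    have -> : (w \in x k @^-1` B) = (x k w \in B) by apply/idP/idP; rewrite !inE.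
    by case: ifP => _; rewrite ?mul1r ?mul0r ?mulr0.
  rewrite integral_Rintegral; last first.
    by apply: bounded_rv_integrable; apply: bounded_rvM => //; exact: bounded_rv_event_prod.
  rewrite -[RHS]/((\int[P]_w W w * event_prob I A)%:E * P (x k @^-1` B))%E.
  have PB : P (x k @^-1` B) \is a fin_num by apply: fin_num_measure; exact: measurable_preimage.
  rewrite HH -(fineK PB) -EFinM/=; congr EFin; ring.
have H1 : (\int[P]_w ((W w * event_prod I A w * g (x k w))%:E) =
    (\int[P]_w W w * event_prob I A)%:E * \int[P]_w (g (x k w))%:E)%E.
  have mgx : measurable_fun [set: T] (fun w => (EFin \o g) (x k w)).
    exact: measurableT_comp mEg (x_measurable k).
  have E1 := ge0_integral_mscale (image_measure P (x_measurable k)) measurableT (NngNum c0) mEg (fun y _ => g0' y).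
  have E2 := ge0_integral_image_measure P (x_measurable k) mEg g0'.
  have E3 := ge0_integral_image_measure nu (x_measurable k) mEg g0'.
  have E4 := @ge0_integral_density _ T R P _ bWE.1 WE0 _ mgx (fun w => g0' (x k w)).
  have -> : (\int[P]_w ((W w * event_prod I A w * g (x k w))%:E) =
    \int[P]_w ((EFin \o g) (x k w) * (W w * event_prod I A w)%:E))%E.
    by apply: eq_integral => w _; rewrite -EFinM mulrC.
  by rewrite -E4; apply: etrans (esym E3) _; rewrite H; apply: etrans E1 _; rewrite E2.
rewrite !integral_Rintegral in H1; last 2 first.
- exact: bounded_rv_integrable.
- by apply: bounded_rv_integrable; exact: bounded_rvM.
by move: H1 => -[].
Qed.

Lemma future_indep_step_ge0 (g : Y -> R) I A : (forall w, 0 <= W w) -> measurable_fun [set: Y] g ->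
  (exists M : R, forall w, `|g (x k w)| <= M) -> uniq I ->
  (forall j, j \in I -> (k < j)%N) -> (forall j, j \in I -> measurable (A j)) ->
  \int[P]_w (W w * event_prod I A w * g (x k w)) =
  \int[P]_w W w * event_prob I A * \int[P]_w g (x k w).
Proof.
move=> W0 mg [M gM] uI kI mA.
(* [g] is bounded only at the samples, so [g + M] may be negative elsewhere; truncation at 0 repairs
   this without changing the values at the samples. *)
pose g' y := Num.max (g y + M) 0.
have mg' : measurable_fun [set: Y] g'.
  by apply: measurable_maxr => //; exact: measurable_funD.
have g'E w : g' (x k w) = g (x k w) + M.
  by apply/max_idPl; have := gM w; rewrite ler_norml -subr_ge0 opprK addrC => /andP[].
have bg : bounded_rv (fun w => g (x k w)) by apply: bounded_rv_comp => //; exists M.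
have g'M : exists M' : R, forall w, `|g' (x k w)| <= M'.
  exists (M + `|M|) => w; rewrite g'E (le_trans (ler_normD _ _))// lerD//.
have bE := bounded_rv_event_prod mA.
have bWE := bounded_rvM bW bE.
have g'0 y : 0 <= g' y by rewrite le_max lexx orbT.
have := step_ge0 W0 mg' g'0 g'M uI kI mA.
have -> : \int[P]_w g' (x k w) = \int[P]_w g (x k w) + M.
  by under eq_Rintegral do rewrite g'E; rewrite RintegralD_bounded ?Rintegral_prob_cst//; exact: bounded_rv_cst.
have -> : \int[P]_w (W w * event_prod I A w * g' (x k w)) =
  \int[P]_w (W w * event_prod I A w * g (x k w)) + M * (\int[P]_w W w * event_prob I A).
  rewrite -(iW uI _ mA); last by move=> j /kI /ltnW.
  rewrite -RintegralZ_bounded// -RintegralD_bounded//.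
  - by apply: eq_Rintegral => w _; rewrite g'E; ring.
  - exact: bounded_rvM.
  - exact: bounded_rvZ.
by rewrite mulrDr (mulrC M) => /addIr.
Qed.

End step.

(** [W + M] and the constant [M] are nonnegative and satisfy the hypotheses; the claim for [W] is
    their difference. *)
Lemma future_indep_step k W (g : Y -> R) I A : bounded_rv W -> future_indep k W ->
  measurable_fun [set: Y] g ->
  (exists M : R, forall w, `|g (x k w)| <= M) -> uniq I ->
  (forall j, j \in I -> (k < j)%N) -> (forall j, j \in I -> measurable (A j)) ->
  \int[P]_w (W w * event_prod I A w * g (x k w)) =
  \int[P]_w W w * event_prob I A * \int[P]_w g (x k w).
Proof.
move=> bW iW mg gM uI kI mA; have [mW [M WM]] := bW.
have bM := bounded_rv_cst M.
have iM := @future_indep_cst k M.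
have bWM := bounded_rvD bW bM.
have WM0 w : 0 <= W w + M.
  by have := WM w; rewrite ler_norml -subr_ge0 opprK addrC => /andP[]; rewrite addrC.
have M0 (w : T) : 0 <= M by apply: le_trans (WM w).
have H1 := future_indep_step_ge0 bWM (future_indepD bW bM iW iM) WM0 mg gM uI kI mA.
have H2 := future_indep_step_ge0 bM iM M0 mg gM uI kI mA.
have bg := bounded_rv_comp mg gM.
have bE := bounded_rv_event_prod mA.
move: H1; rewrite RintegralD_bounded// mulrDl mulrDl -H2.
rewrite (_ : (fun w => (W w + M) * _ * _) = (fun w => W w * event_prod I A w * g (x k w) + M * event_prod I A w * g (x k w))); last first.
  by apply/funext => w; rewrite !mulrDl.
rewrite RintegralD_bounded; first by move=> /addIr.
- by apply: bounded_rvM => //; exact: bounded_rvM.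
- by apply: bounded_rvM => //; exact: bounded_rvM.
Qed.

Lemma Rintegral_indep k W (g : Y -> R) : bounded_rv W -> future_indep k W ->
  measurable_fun [set: Y] g -> (exists M : R, forall w, `|g (x k w)| <= M) ->
  \int[P]_w (W w * g (x k w)) = \int[P]_w W w * \int[P]_w g (x k w).
Proof.
move=> bW iW mg gM.
have := @future_indep_step k W g [::] (fun=> setT) bW iW mg gM isT.
rewrite /event_prob big_nil mulr1 => <- //.
by apply: eq_Rintegral => w _; rewrite /event_prod big_nil mulr1.
Qed.

(** A factor depending on [x k] uses up this variable, so independence now starts at [k.+1].
    Iterated, this builds functions of the partial sums that are independent of the later
    samples. *)
Lemma future_indepM k W (g : Y -> R) : bounded_rv W -> future_indep k W ->
  measurable_fun [set: Y] g -> (exists M : R, forall w, `|g (x k w)| <= M) ->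
  future_indep k.+1 (fun w => W w * g (x k w)).
Proof.
move=> bW iW mg gM I A uI kI mA.
rewrite (Rintegral_indep bW iW mg gM) mulrAC -(future_indep_step bW iW mg gM uI kI mA).
by apply: eq_Rintegral => w _; rewrite mulrAC.
Qed.

Lemma Rintegral_law i (g : Y -> R) : measurable_fun [set: Y] g ->
  (exists M : R, forall i w, `|g (x i w)| <= M) -> \int[P]_w g (x i w) = \int[P]_w g (x 0%N w).
Proof.
move=> mg [M gM].
have H (h : Y -> R) : measurable_fun [set: Y] h -> (forall y, 0 <= h y) ->
    \int[P]_w h (x i w) = \int[P]_w h (x 0%N w).
  move=> mh h0; have mEh : measurable_fun [set: Y] (EFin \o h) by exact/measurable_EFinP.
  have h0' y : (0 <= (EFin \o h) y)%E by rewrite lee_fin.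
  congr fine.
  have E1 := ge0_integral_image_measure P (x_measurable i) mEh h0'.
  have E2 := ge0_integral_image_measure P (x_measurable 0%N) mEh h0'.
  apply: etrans (esym E1) _; apply: etrans E2.
  by apply: eq_measure_integral => B mB _; exact: x_law.
pose g' y := Num.max (g y + M) 0.
have mg' : measurable_fun [set: Y] g'.
  by apply: measurable_maxr => //; exact: measurable_funD.
have g'E j w : g' (x j w) = g (x j w) + M.
  by apply/max_idPl; have := gM j w; rewrite ler_norml -subr_ge0 opprK addrC => /andP[].
have bg j : bounded_rv (fun w => g (x j w)) by apply: bounded_rv_comp => //; exists M.
have E j : \int[P]_w g' (x j w) = \int[P]_w g (x j w) + M.
  by under eq_Rintegral do rewrite g'E; rewrite RintegralD_bounded ?Rintegral_prob_cst//; exact: bounded_rv_cst.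
have g'0 y : 0 <= g' y by rewrite le_max lexx orbT.
by have := H g' mg' g'0; rewrite !E => /addIr.
Qed.

Section sums.
Variables (f : Y -> R) (M : R).
Hypothesis mf : measurable_fun [set: Y] f.
Hypothesis fM : forall i w, `|f (x i w)| <= M.

Let bf j : bounded_rv (fun w => f (x j w)).
Proof. by apply: bounded_rv_comp => //; exists M. Qed.

Lemma future_indep_self j : future_indep j.+1 (fun w => f (x j w)).
Proof.
have := @future_indepM j (fun=> 1) f (bounded_rv_cst 1) (@future_indep_cst j 1) mf.
rewrite (_ : (fun w => 1 * _) = (fun w => f (x j w))); last by apply/funext => w; rewrite mul1r.
by apply; exists M.
Qed.

Lemma Rintegral_indep2 i j : i != j ->
  \int[P]_w (f (x i w) * f (x j w)) = (\int[P]_w f (x 0%N w)) ^+ 2.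
Proof.
have eM : exists M : R, forall i w, `|f (x i w)| <= M by exists M.
have H k l : (k < l)%N -> \int[P]_w (f (x k w) * f (x l w)) = (\int[P]_w f (x 0%N w)) ^+ 2.
  move=> kl; rewrite (@Rintegral_indep l (fun w => f (x k w)) f)//.
  - by rewrite !(Rintegral_law _ mf eM) expr2.
  - apply: (future_indep_le kl); exact: future_indep_self.
  - by exists M.
by rewrite neq_ltn => /orP[/H//|/H <-]; apply: eq_Rintegral => w _; rewrite mulrC.
Qed.

Lemma Rintegral_sum_sqr n : \int[P]_w f (x 0%N w) = 0 ->
  \int[P]_w (\sum_(j < n) f (x j w)) ^+ 2 = n%:R * \int[P]_w (f (x 0%N w) ^+ 2).
Proof.
move=> f0; elim: n => [|n IH].
  rewrite mul0r; under eq_Rintegral do rewrite big_ord0 expr0n/=.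
  exact: Rintegral_prob_cst.
have bS := @bounded_rv_sum n _ bf.
have sqE (h : T -> R) : (fun w => h w ^+ 2) = (fun w => h w * h w) by apply/funext => w; rewrite expr2.
have bS2 : bounded_rv (fun w => (\sum_(j < n) f (x j w)) ^+ 2).
  by rewrite (sqE (fun w => \sum_(j < n) f (x j w))); exact: bounded_rvM.
have bf2 j : bounded_rv (fun w => f (x j w) ^+ 2).
  by rewrite (sqE (fun w => f (x j w))); exact: bounded_rvM.
have bSf : bounded_rv (fun w => \sum_(j < n) f (x j w) * f (x n w)).
  apply: (@bounded_rv_sum n (fun j w => f (x j w) * f (x n w))) => j; exact: bounded_rvM.
transitivity (\int[P]_w ((\sum_(j < n) f (x j w)) ^+ 2 + (2 * \sum_(j < n) f (x j w) * f (x n w) + f (x n w) ^+ 2))).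
  apply: eq_Rintegral => w _; rewrite big_ord_recr/= -mulr_suml; ring.
rewrite RintegralD_bounded//; last by apply: bounded_rvD => //; exact: bounded_rvZ.
rewrite RintegralD_bounded//; last exact: bounded_rvZ.
rewrite RintegralZ_bounded// IH Rintegral_sum; last first.
  by move=> j; apply: bounded_rv_integrable; exact: bounded_rvM.
rewrite big1 ?mulr0 ?add0r => [|j _]; last first.
  by rewrite Rintegral_indep2 ?f0 ?expr0n// neq_ltn ltn_ord.
rewrite (@Rintegral_law n (fun y => f y ^+ 2)); first by rewrite -natr1 mulrDl mul1r.
- exact: measurable_funX.
- by exists (M ^+ 2) => i w; rewrite normrX lerXn2r ?nnegrE// (le_trans _ (fM i w)).
Qed.

Let S n w := \sum_(j < n) f (x j w).

Lemma bounded_rv_cos W : measurable_fun [set: T] W -> bounded_rv (fun w => cos (W w)).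
Proof.
move=> mW; split; last by exists 1 => w; rewrite ler_norml cos_geN1 cos_le1.
by apply: (measurableT_comp _ mW); apply: continuous_measurable_fun; exact: continuous_cos.
Qed.

Lemma bounded_rv_sin W : measurable_fun [set: T] W -> bounded_rv (fun w => sin (W w)).
Proof.
move=> mW; split; last by exists 1 => w; rewrite ler_norml sin_geN1 sin_le1.
by apply: (measurableT_comp _ mW); apply: continuous_measurable_fun; exact: continuous_sin.
Qed.

Let mS n : measurable_fun [set: T] (S n).
Proof. exact: (@bounded_rv_sum n _ bf).1. Qed.

Let mcos : measurable_fun [set: Y] (fun y => cos (f y)).
Proof. by apply: (measurableT_comp _ mf); apply: continuous_measurable_fun; exact: continuous_cos. Qed.

Let msin : measurable_fun [set: Y] (fun y => sin (f y)).
Proof. by apply: (measurableT_comp _ mf); apply: continuous_measurable_fun; exact: continuous_sin. Qed.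

Let cosM : exists M : R, forall i w, `|cos (f (x i w))| <= M.
Proof. by exists 1 => i w; rewrite ler_norml cos_geN1 cos_le1. Qed.

Let sinM : exists M : R, forall i w, `|sin (f (x i w))| <= M.
Proof. by exists 1 => i w; rewrite ler_norml sin_geN1 sin_le1. Qed.

Let at_index (g : Y -> R) k : (exists M : R, forall i w, `|g (x i w)| <= M) ->
  exists M : R, forall w, `|g (x k w)| <= M.
Proof. by move=> [N H]; exists N. Qed.

Let cosS k : (fun w => cos (S k.+1 w)) =
  (fun w => cos (S k w) * cos (f (x k w)) + -1 * (sin (S k w) * sin (f (x k w)))).
Proof. by apply/funext => w; rewrite /S big_ord_recr/= cosD mulN1r. Qed.

Let sinS k : (fun w => sin (S k.+1 w)) =
  (fun w => sin (S k w) * cos (f (x k w)) + cos (S k w) * sin (f (x k w))).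
Proof. by apply/funext => w; rewrite /S big_ord_recr/= sinD. Qed.

Let bC k := bounded_rv_cos (mS k).
Let bS k := bounded_rv_sin (mS k).
Let bc k := bounded_rv_comp mcos (at_index k cosM).
Let bs k := bounded_rv_comp msin (at_index k sinM).

(** Real and imaginary part of the exponential of the partial sum must be treated together, because
    the addition formulas mix them. *)
Let future_indep_trig k : future_indep k (fun w => cos (S k w)) /\ future_indep k (fun w => sin (S k w)).
Proof.
elim: k => [|k [IC IS]].
  split.
    rewrite (_ : (fun w => _) = fun=> 1); first exact: future_indep_cst.
    by apply/funext => w; rewrite /S big_ord0 cos0.
  rewrite (_ : (fun w => _) = fun=> 0); first exact: future_indep_cst.
  by apply/funext => w; rewrite /S big_ord0 sin0.
have Hc W : bounded_rv W -> future_indep k W -> future_indep k.+1 (fun w => W w * cos (f (x k w))).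
  by move=> bW iW; exact: (future_indepM bW iW mcos (at_index k cosM)).
have Hs W : bounded_rv W -> future_indep k W -> future_indep k.+1 (fun w => W w * sin (f (x k w))).
  by move=> bW iW; exact: (future_indepM bW iW msin (at_index k sinM)).
rewrite cosS sinS; split; apply: future_indepD.
- exact: bounded_rvM.
- by apply: bounded_rvZ; exact: bounded_rvM.
- exact: Hc.
- by apply: future_indepZ; [exact: bounded_rvM|exact: Hs].
- exact: bounded_rvM.
- exact: bounded_rvM.
- exact: Hc.
- exact: Hs.
Qed.

Let c := \int[P]_w cos (f (x 0%N w)).
Let sg := \int[P]_w sin (f (x 0%N w)).

Let cos_rec k : \int[P]_w cos (S k.+1 w) = \int[P]_w cos (S k w) * c - \int[P]_w sin (S k w) * sg.
Proof.
have [IC IS] := future_indep_trig k.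
rewrite cosS RintegralD_bounded; [|exact: bounded_rvM|by apply: bounded_rvZ; exact: bounded_rvM].
rewrite RintegralZ_bounded; last exact: bounded_rvM.
rewrite (Rintegral_indep (bC k) IC mcos (at_index k cosM)) (Rintegral_indep (bS k) IS msin (at_index k sinM)).
by rewrite (Rintegral_law k mcos cosM) (Rintegral_law k msin sinM) mulN1r.
Qed.

Let sin_rec k : \int[P]_w sin (S k.+1 w) = \int[P]_w sin (S k w) * c + \int[P]_w cos (S k w) * sg.
Proof.
have [IC IS] := future_indep_trig k.
rewrite sinS RintegralD_bounded; [|exact: bounded_rvM|exact: bounded_rvM].
rewrite (Rintegral_indep (bS k) IS mcos (at_index k cosM)) (Rintegral_indep (bC k) IC msin (at_index k sinM)).
by rewrite (Rintegral_law k mcos cosM) (Rintegral_law k msin sinM).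
Qed.

Lemma normr_Rintegral_le W N : bounded_rv W -> (forall w, `|W w| <= N) -> `|\int[P]_w W w| <= N.
Proof.
move=> bW WN; have iW := bounded_rv_integrable bW.
rewrite (le_trans (le_normr_Rintegral measurableT iW))// -[leRHS](Rintegral_prob_cst N).
apply: le_Rintegral => //; first exact: integrable_norm iW.
exact: bounded_rv_integrable (bounded_rv_cst N).
Qed.

Let normr_cosE W : measurable_fun [set: T] W -> `|\int[P]_w cos (W w)| <= 1.
Proof.
move=> mW; apply: normr_Rintegral_le; first exact: bounded_rv_cos.
by move=> w; rewrite ler_norml cos_geN1 cos_le1.
Qed.

Let normr_sinE W : measurable_fun [set: T] W -> `|\int[P]_w sin (W w)| <= 1.
Proof.
move=> mW; apply: normr_Rintegral_le; first exact: bounded_rv_sin.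
by move=> w; rewrite ler_norml sin_geN1 sin_le1.
Qed.

(** Compares the [n]-th power of the complex number with parts [c] and [sg] to the real power
    [g ^+ n]. Every factor has absolute value at most 1, so the errors of the [n] steps add up. *)
Lemma char_sum_le g n : 0 <= g <= 1 ->
  `|\int[P]_w cos (S n w) - g ^+ n| <= n%:R * (`|c - g| + `|sg|) /\
  `|\int[P]_w sin (S n w)| <= n%:R * `|sg|.
Proof.
move=> /andP[g0 g1]; elim: n => [|n [IC IS]].
  rewrite !mul0r expr0.
  under eq_Rintegral do rewrite /S big_ord0 cos0.
  under [in X in _ /\ X]eq_Rintegral do rewrite /S big_ord0 sin0.
  by rewrite !Rintegral_prob_cst subrr normr0.
have c1 : `|c| <= 1 by apply: normr_cosE; exact: measurableT_comp mf (x_measurable 0).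
have C1 := normr_cosE (mS n); have S1 := normr_sinE (mS n).
rewrite cos_rec sin_rec exprSr -!natr1 !mulrDl !mul1r.
move: (\int[P]_w cos (S n w)) (\int[P]_w sin (S n w)) (g ^+ n) IC IS C1 S1 => C D G IC IS C1 D1.
split.
  have -> : C * c - D * sg - G * g = (C - G) * g + (C * (c - g) - D * sg) by ring.
  rewrite (le_trans (ler_normD _ _))// lerD//.
    by rewrite normrM (le_trans _ IC)// (ger0_norm g0) ler_piMr.
  rewrite (le_trans (ler_normB _ _))// !normrM lerD// ler_piMl//.
rewrite (le_trans (ler_normD _ _))// !normrM lerD//; last by rewrite ler_piMl.
by rewrite (le_trans _ IS)// ler_piMr.
Qed.

(** [char_sum_le] with [g = expR (- v / 2)], whose powers are exactly Gaussian. Taylor remainders of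
    degree 3 and 4 are bounded by [delta] and [delta ^+ 2] times the second moment, so the total
    error is small as soon as [n * v] is bounded and [delta] is small. *)
Lemma char_sum_gauss n (delta v : R) : (forall i w, `|f (x i w)| <= delta) ->
  \int[P]_w f (x 0%N w) = 0 -> \int[P]_w (f (x 0%N w) ^+ 2) = v ->
  `|\int[P]_w cos (S n w) - expR (- (2^-1 * (n%:R * v)))| <= n%:R * v * (2 * delta ^+ 2 + delta) /\
  `|\int[P]_w sin (S n w)| <= n%:R * v * delta.
Proof.
move=> fd f0 fv.
have d0 : 0 <= delta by apply: le_trans (fd 0%N point).
have sqE (h : T -> R) : (fun w => h w ^+ 2) = (fun w => h w * h w) by apply/funext => w; rewrite expr2.
have bf2 : bounded_rv (fun w => f (x 0%N w) ^+ 2).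
  by rewrite (sqE (fun w => f (x 0%N w))); exact: bounded_rvM.
have v0 : 0 <= v by rewrite -fv; apply: Rintegral_ge0 => w _; exact: sqr_ge0.
(* Needed for the quadratic remainder of [g], which is of order [v ^+ 2] and must be brought to the
   form [v * delta ^+ 2]. *)
have vd : v <= delta ^+ 2.
  rewrite -fv (le_trans (ler_norm _))//; apply: normr_Rintegral_le => // w.
  by rewrite normrX lerXn2r// nnegrE.
have dom W K : bounded_rv W -> (forall w, `|W w| <= K * f (x 0%N w) ^+ 2) -> `|\int[P]_w W w| <= K * v.
  move=> bW WK; have iW := bounded_rv_integrable bW.
  rewrite (le_trans (le_normr_Rintegral measurableT iW))// -fv -RintegralZ_bounded//.
  apply: le_Rintegral => //; first exact: integrable_norm iW.
  by apply: bounded_rv_integrable; exact: bounded_rvZ.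
have mf0 := measurableT_comp mf (x_measurable 0).
have sg_le : `|sg| <= v * delta.
  have -> : sg = \int[P]_w (sin (f (x 0%N w)) + -1 * f (x 0%N w)).
    rewrite RintegralD_bounded//; [|exact: bounded_rvZ].
    by rewrite RintegralZ_bounded// f0 mulr0 addr0.
  rewrite mulrC; apply: dom; first by apply: bounded_rvD => //; exact: bounded_rvZ.
  move=> w; rewrite mulN1r (le_trans (sin_sub_id _))// exprS -normrX.
  by rewrite (ger0_norm (sqr_ge0 _)) ler_wpM2r ?sqr_ge0.
set g := expR (- (2^-1 * v)).
have c_le : `|c - (1 - 2^-1 * v)| <= v * delta ^+ 2.
  have -> : c - (1 - 2^-1 * v) = \int[P]_w (cos (f (x 0%N w)) + (2^-1 * f (x 0%N w) ^+ 2 + -1)).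
    rewrite RintegralD_bounded//; last by apply: bounded_rvD; [exact: bounded_rvZ|exact: bounded_rv_cst].
    rewrite RintegralD_bounded; [|exact: bounded_rvZ|exact: bounded_rv_cst].
    by rewrite RintegralZ_bounded// fv Rintegral_prob_cst; rewrite /c; lra.
  rewrite mulrC; apply: dom.
    by apply: bounded_rvD => //; apply: bounded_rvD; [exact: bounded_rvZ|exact: bounded_rv_cst].
  move=> w; have := cos_taylor2 (f (x 0%N w)).
  have -> : cos (f (x 0%N w)) - 1 + f (x 0%N w) ^+ 2 / 2 = cos (f (x 0%N w)) + (2^-1 * f (x 0%N w) ^+ 2 + -1) by field.
  move=> /le_trans; apply; rewrite -normrX (_ : 4%N = (2 * 2)%N)// exprM (ger0_norm (sqr_ge0 _)) expr2.
  rewrite ler_wpM2r ?sqr_ge0// -[leLHS](ger0_norm (sqr_ge0 _)) normrX lerXn2r// nnegrE//.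
have g_le : `|g - (1 - 2^-1 * v)| <= v * delta ^+ 2.
  have v20 : 0 <= 2^-1 * v by rewrite mulr_ge0.
  apply: (le_trans (expRN_taylor1 v20)); nra.
have gb : 0 <= g <= 1 by rewrite expR_ge0 -expR0 ler_expR oppr_le0 mulr_ge0.
have -> : expR (- (2^-1 * (n%:R * v))) = g ^+ n.
  by rewrite /g -expRM_natl; congr expR; ring.
have [HC HS] := char_sum_le n gb.
have cg : `|c - g| <= 2 * (v * delta ^+ 2).
  have -> : c - g = (c - (1 - 2^-1 * v)) - (g - (1 - 2^-1 * v)) by ring.
  by rewrite (le_trans (ler_normB _ _))// mulr_natl mulr2n lerD.
split.
  rewrite (le_trans HC)// -mulrA ler_wpM2l// mulrDr lerD//.
  by rewrite (le_trans cg)//; lra.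
by rewrite (le_trans HS)// -mulrA ler_wpM2l.
Qed.

End sums.
End independent_sequence.

(** * Approximation by trigonometric polynomials *)

Section random_lattice_walk.
Context {R : realType} {d : nat}.
Local Notation cV := 'cV[R]_d.
Implicit Types (u x : cV) (phi psi : cV -> R) (js : seq 'I_d).

(* Expectation of [phi] at the endpoint of the walk from 0 whose steps are independent: the step
   indexed by [j] moves by [ebasis j] with probability [u j 0]. *)
Fixpoint walk u js phi : R :=
  match js with
  | [::] => phi 0
  | j :: js' => u j 0 * walk u js' (fun x => phi (ebasis j + x)) + (1 - u j 0) * walk u js' phi
  end.

Lemma walkD u js phi psi : walk u js (fun x => phi x + psi x) = walk u js phi + walk u js psi.
Proof. by elim: js phi psi => //= j js IH phi psi; rewrite !IH; ring. Qed.

Lemma walkZ u js a phi : walk u js (fun x => a * phi x) = a * walk u js phi.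
Proof. by elim: js phi => //= j js IH phi; rewrite !IH; ring. Qed.

Lemma walk_cst u js a : walk u js (fun=> a) = a.
Proof. by elim: js => //= j js IH; rewrite !IH; ring. Qed.

Lemma walk_sum u js n (phi : 'I_n -> cV -> R) :
  walk u js (fun x => \sum_(i < n) phi i x) = \sum_(i < n) walk u js (phi i).
Proof.
elim: js phi => //= j js IH phi; rewrite !IH !mulr_sumr -big_split/=.
by apply: eq_bigr.
Qed.

Lemma walk_le u js phi psi : (forall j, 0 <= u j 0 <= 1) -> (forall x, phi x <= psi x) ->
  walk u js phi <= walk u js psi.
Proof.
move=> u01; elim: js phi psi => //= j js IH phi psi le_phi.
have /andP[u0 u1] := u01 j.
by apply: lerD; apply: ler_wpM2l; rewrite ?subr_ge0// IH.
Qed.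

Lemma normr_walk_sub_le u js phi psi a : (forall j, 0 <= u j 0 <= 1) ->
  (forall x, `|phi x - a| <= psi x) -> `|walk u js phi - a| <= walk u js psi.
Proof.
move=> u01 H; rewrite ler_norml; apply/andP; split.
  rewrite -[X in _ <= _ - X](walk_cst u js) -mulN1r -walkZ -[X in _ - X]mul1r -mulNr -walkZ -walkD.
  by apply: walk_le => // x; have := H x; rewrite ler_norml !mulN1r => /andP[].
rewrite -[X in _ - X](walk_cst u js) -mulN1r -walkZ -walkD.
by apply: walk_le => // x; have := H x; rewrite ler_norml !mulN1r => /andP[].
Qed.

(* variance plus squared bias of the number of steps in direction [l] *)
Lemma walk_coord_sqr u js l b : walk u js (fun x => (x l 0 - b) ^+ 2) =
  (count_mem l js)%:R * (u l 0 * (1 - u l 0)) + ((count_mem l js)%:R * u l 0 - b) ^+ 2.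
Proof.
elim: js b => [|j js IH] b /=; first by rewrite mxE; ring.
have -> : (fun x => ((ebasis j + x) l 0 - b) ^+ 2) = (fun x : cV => (x l 0 - (b - (l == j)%:R)) ^+ 2).
  by apply/funext => x; rewrite !mxE andbT; ring.
rewrite !IH eq_sym natrD; case: eqP => [->|_] /=; last by rewrite add0r; ring.
by rewrite -[1%:R]/(1 : R); ring.
Qed.

End random_lattice_walk.

Section trigonometric_polynomials.
Context {R : realType} {d : nat}.
Local Notation cV := 'cV[R]_d.

(** Closure under products is not built in, so limits in [levy_continuity] have to be checked only
    on sines and cosines; [trig_mul] recovers it from the product-to-sum formulas. *)
Inductive trig_poly : (cV -> R) -> Prop :=
| trig_cos t : trig_poly (fun y => cos (dotv t y))
| trig_sin t : trig_poly (fun y => sin (dotv t y))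
| trig_add g h : trig_poly g -> trig_poly h -> trig_poly (fun y => g y + h y)
| trig_scale a g : trig_poly g -> trig_poly (fun y => a * g y).

Lemma trig_poly_eq g h : trig_poly g -> g =1 h -> trig_poly h.
Proof. by move=> tg /funext <-. Qed.

Lemma trig_cst a : trig_poly (fun=> a).
Proof.
apply: trig_poly_eq (trig_scale a (trig_cos 0)) _ => y.
by rewrite dotvC dotv0r cos0 mulr1.
Qed.

Lemma trig_sub g h : trig_poly g -> trig_poly h -> trig_poly (fun y => g y - h y).
Proof.
move=> tg th; apply: trig_poly_eq (trig_add tg (trig_scale (-1) th)) _ => y.
by rewrite mulN1r.
Qed.

Let trig_mul_cos t h : trig_poly h -> trig_poly (fun y => cos (dotv t y) * h y).
Proof.
elim=> [s|s|g1 g2 _ H1 _ H2|a g _ H].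
- have H := trig_add (trig_scale 2^-1 (trig_cos (t + s))) (trig_scale 2^-1 (trig_cos (t - s))).
  by apply: trig_poly_eq H _ => y; rewrite dotvDl dotvBl cosD cosB; field.
- have H := trig_sub (trig_scale 2^-1 (trig_sin (t + s))) (trig_scale 2^-1 (trig_sin (t - s))).
  by apply: trig_poly_eq H _ => y; rewrite dotvDl dotvBl sinD sinB; field.
- by apply: trig_poly_eq (trig_add H1 H2) _ => y; rewrite mulrDr.
- by apply: trig_poly_eq (trig_scale a H) _ => y; rewrite mulrCA.
Qed.

Let trig_mul_sin t h : trig_poly h -> trig_poly (fun y => sin (dotv t y) * h y).
Proof.
elim=> [s|s|g1 g2 _ H1 _ H2|a g _ H].
- by apply: trig_poly_eq (trig_mul_cos s (trig_sin t)) _ => y; rewrite mulrC.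
- have H := trig_sub (trig_scale 2^-1 (trig_cos (t - s))) (trig_scale 2^-1 (trig_cos (t + s))).
  by apply: trig_poly_eq H _ => y; rewrite dotvBl dotvDl cosB cosD; field.
- by apply: trig_poly_eq (trig_add H1 H2) _ => y; rewrite mulrDr.
- by apply: trig_poly_eq (trig_scale a H) _ => y; rewrite mulrCA.
Qed.

Lemma trig_mul g h : trig_poly g -> trig_poly h -> trig_poly (fun y => g y * h y).
Proof.
move=> tg th; elim: tg => [s|s|g1 g2 _ H1 _ H2|a g' _ H].
- exact: trig_mul_cos.
- exact: trig_mul_sin.
- by apply: trig_poly_eq (trig_add H1 H2) _ => y; rewrite mulrDl.
- by apply: trig_poly_eq (trig_scale a H) _ => y; rewrite mulrA.
Qed.

(** The expectation along the walk is a polynomial in the step probabilities, for any function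
    [phi]. With trigonometric probabilities, Bernstein polynomials become trigonometric ones. *)
Lemma trig_walk (u : cV -> cV) js phi : (forall j, trig_poly (fun y => u y j 0)) ->
  trig_poly (fun y => walk (u y) js phi).
Proof.
move=> tu; elim: js phi => /= [|j js IH] phi; first exact: trig_cst.
apply: trig_add; apply: trig_mul => //.
by apply: trig_sub => //; exact: trig_cst.
Qed.

Lemma trig_continuous h : trig_poly h -> continuous h.
Proof.
elim=> [t|t|g1 g2 _ H1 _ H2|a g _ H] y; last 2 first.
- by have C1 : g1 @ y --> g1 y := H1 y; have C2 : g2 @ y --> g2 y := H2 y; exact: cvgD C1 C2.
- by have C : g @ y --> g y := H y; exact: cvgMl_tmp C.
- by apply: continuous_comp; [exact: dotv_continuous|exact: continuous_cos].
- by apply: continuous_comp; [exact: dotv_continuous|exact: continuous_sin].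
Qed.

End trigonometric_polynomials.

Section uniform_continuity.
Context {R : realType} {d : nat}.
Local Notation cV := 'cV[R]_d.

Lemma compact_enorm_le (K : R) : compact [set y : cV | enorm y <= K].
Proof.
case: d => [|n].
  have [K0|K0] := leP 0 K; last first.
    rewrite (_ : [set _ | _] = set0); first exact: compact0.
    by apply/seteqP; split => // y /= yK; move: (le_lt_trans yK K0); rewrite ltNge enorm_ge0.
  rewrite (_ : [set _ | _] = [set 0]); first exact: compact_set1.
  apply/seteqP; split => [y _|_ ->] /=; first by apply/matrixP => -[].
  by rewrite /enorm dotv0r sqrtr0.
have -> : [set y : 'cV[R]_n.+1 | enorm y <= K] =
    (fun v : 'rV[R]_n.+1 => v^T) @` [set v | enorm v^T <= K].
  apply/seteqP; split => [v v1|_ [v v1 <-]//]; exists v^T => //=; rewrite ?trmxK//.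
apply: continuous_compact.
  by apply: continuous_subspaceT; exact: trmx_cV_continuous.
apply: bounded_closed_compact.
  exists K; split; rewrite ?num_real// => M M2 v /= v1.
  rewrite (le_trans _ (ltW M2))// [leLHS]/Num.norm/= mx_normrE.
  have K0 : 0 <= K by apply: le_trans v1; exact: enorm_ge0.
  apply/bigmax_leP; split => //= [[i j]] _ /=.
  by rewrite (ord1 i); have := normr_coord_le (v^T) j; rewrite mxE => /le_trans; apply.
have -> : [set v : 'rV[R]_n.+1 | enorm v^T <= K] = (fun v : 'rV[R]_n.+1 => enorm v^T) @^-1` [set r | r <= K] by [].
apply: closed_comp; last exact: closed_le.
move=> v _; apply: continuous_comp; first exact: trmx_cV_continuous.
exact: enorm_continuous.
Qed.

(** Only [x] is confined to the ball. Compactness enters as a near covering, with the displacement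
    [y - x] as the parameter tending to 0. *)
Lemma uniform_continuous_ball (f : cV -> R) (K e : R) : continuous f -> 0 < e ->
  exists2 delta : R, 0 < delta & forall x y : cV, enorm x <= K -> enorm (y - x) < delta ->
    `|f y - f x| <= e.
Proof.
move=> cf e0.
have e20 : 0 < e / 2 by rewrite divr_gt0.
have /compact_near_coveringP NC := @compact_enorm_le K.
have [|r r0 Hr] := @enorm_ball_in R d 0 _ (NC cV (nbhs (0 : cV))
  (fun h x => `|f (x + h) - f x| <= e) _ _).
  move=> x _; have /cvgrPdist_le /(_ _ e20) Hx := cf x.
  have [r r0 Hr] := enorm_ball_in Hx.
  have r20 : 0 < r / 2 by rewrite divr_gt0.
  have near_enorm (a : cV) : \forall z \near a, enorm (z - a) < r / 2.
    have Hc : (fun z : cV => enorm (z - a)) @ a --> (0 : R).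
      have -> : 0 = enorm (a - a) by rewrite subrr /enorm dotv0r sqrtr0.
      have Hs : (fun z : cV => z - a) @ a --> a - a.
        have Hi : (fun z : cV => z) @ a --> a by exact: cvg_id.
        have Hc : (fun _ : cV => a) @ a --> a by move=> A /nbhs_singleton Aa; apply: (@filterE _ (nbhs a) (nbhs_filter a)).
        exact: cvgB Hi Hc.
      exact: (continuous_cvg _ (@enorm_continuous R d (a - a)) Hs).
    by have /cvgr_lt/(_ _ r20) := Hc.
  near=> y h => /=.
  have Hy : enorm (y - x) < r / 2 by near: y; exact: near_enorm.
  have Hh : enorm (h - 0) < r / 2 by near: h; exact: near_enorm.
  rewrite subr0 in Hh.
  have H1 := Hr y; have H2 := Hr (y + h).
  have -> : f (y + h) - f y = (f x - f y) - (f x - f (y + h)) by ring.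
  rewrite (le_trans (ler_normB _ _))//.
  have : `|f x - f y| <= e / 2 by apply: H1; lra.
  have : `|f x - f (y + h)| <= e / 2.
    apply: H2; rewrite addrAC (le_lt_trans (ler_enormD _ _))//; lra.
  lra.
exists r => // x y xK yx; have H := Hr (y - x).
by rewrite subr0 in H; have := H yx x xK; rewrite (addrC x) subrK.
Unshelve. all: by end_near.
Qed.

End uniform_continuity.

Section trigonometric_approximation.
Context {R : realType} {d : nat}.
Local Notation cV := 'cV[R]_d.

Definition coord_steps n : seq 'I_d := flatten (nseq n (enum 'I_d)).

Lemma count_coord_steps n l : count_mem l (coord_steps n) = n.
Proof.
elim: n => //= n IH; rewrite /coord_steps/= count_cat -/(coord_steps n) IH.
by rewrite count_uniq_mem ?enum_uniq// mem_enum.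
Qed.

Variables (L : R).
Hypothesis L0 : 0 < L.

(** A bounded substitute for the identity: on a fixed ball it is within order [L ^- 2] of [y], and
    everywhere it stays in the ball of radius [d * L]. *)
Definition sin_coords (y : cV) : cV := \col_j (L * sin (y j 0 / L)).

Lemma sin_coords_dist (K : R) (y : cV) : enorm y <= K ->
  enorm (sin_coords y - y) <= d%:R * (K ^+ 3 / L ^+ 2).
Proof.
move=> yK; rewrite (le_trans (enorm_le_sum _))//.
apply: (@le_trans _ _ (\sum_(j < d) K ^+ 3 / L ^+ 2)); last first.
  by rewrite sumr_const card_ord [leRHS]mulr_natl.
apply: ler_sum => j _; rewrite !mxE.
have -> : L * sin (y j 0 / L) - y j 0 = L * (sin (y j 0 / L) - y j 0 / L) by field; rewrite gt_eqF.
rewrite normrM (gtr0_norm L0).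
apply: (@le_trans _ _ (L * `|y j 0 / L| ^+ 3)); first by rewrite ler_wpM2l ?(ltW L0)// sin_sub_id.
rewrite normrM normfV (gtr0_norm L0).
have -> : L * (`|y j 0| / L) ^+ 3 = `|y j 0| ^+ 3 / L ^+ 2 by field; rewrite gt_eqF.
rewrite ler_wpM2r ?invr_ge0 ?sqr_ge0// lerXn2r ?nnegrE//.
  by apply: le_trans yK; exact: enorm_ge0.
by rewrite (le_trans (normr_coord_le _ _)).
Qed.

Lemma enorm_sin_coords (y : cV) : enorm (sin_coords y) <= d%:R * L.
Proof.
rewrite (le_trans (enorm_le_sum _))//.
apply: (@le_trans _ _ (\sum_(j < d) L)); last by rewrite sumr_const card_ord [leRHS]mulr_natl.
apply: ler_sum => j _; rewrite !mxE normrM (gtr0_norm L0) ler_piMr ?(ltW L0)//.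
by rewrite ler_norml sin_geN1 sin_le1.
Qed.

(** Chosen so that after [n] steps per coordinate the rescaled endpoint [walk_point] has mean
    [sin_coords y]. *)
Definition step_prob (y : cV) : cV := \col_j ((1 + sin (y j 0 / L)) / 2).

Lemma step_prob01 y j : 0 <= step_prob y j 0 <= 1.
Proof.
rewrite mxE; have := sin_geN1 (y j 0 / L); have := sin_le1 (y j 0 / L) => H1 H2.
by apply/andP; split; lra.
Qed.

Lemma trig_step_prob j : trig_poly (fun y : cV => step_prob y j 0).
Proof.
have H := trig_add (trig_cst 2^-1) (trig_scale 2^-1 (trig_sin (L^-1 *: ebasis j))).
by apply: trig_poly_eq H _ => y; rewrite mxE dotvZl dotv_ebasis (mulrC L^-1); field.
Qed.

Definition walk_point n (x : cV) : cV := \col_j (L * (2 * x j 0 / n%:R - 1)).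

Lemma walk_pointB n (x y : cV) : (0 < n)%N -> enorm (walk_point n x - sin_coords y) ^+ 2 =
  (2 * L / n%:R) ^+ 2 * \sum_(l < d) (x l 0 - n%:R * step_prob y l 0) ^+ 2.
Proof.
move=> n0; have nn0 : (n%:R : R) != 0 by rewrite pnatr_eq0 -lt0n.
rewrite enorm_sqr /dotv mulr_sumr; apply: eq_bigr => l _; rewrite !mxE.
by field.
Qed.

End trigonometric_approximation.

(** Bernstein's proof of the Weierstrass theorem: [h y] averages [f] over the endpoint of a walk
    concentrated near [sin_coords y], itself near [y] on the ball. Being an average of values of
    [f], [h] keeps the bound [M] on all of R^d. *)
Lemma trig_approx (R : realType) (d : nat) (f : 'cV[R]_d -> R) (M K e : R) :
  continuous f -> (forall y, `|f y| <= M) -> 0 < e -> 0 <= K ->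
  exists h, [/\ trig_poly h, forall y, `|h y| <= M & forall y, enorm y <= K -> `|h y - f y| <= e].
Proof.
move=> cf fM e0 K0.
have e20 : 0 < e / 2 by rewrite divr_gt0.
have e40 : 0 < e / 4 by rewrite divr_gt0.
have M0 : 0 <= M by apply: le_trans (fM 0).
have [d1 d10 H1] := uniform_continuous_ball K cf e20.
(* Then [d * K ^+ 3 < d1 * L] and [L <= L ^+ 2], so the displacement in [sin_coords_dist] is below
   [d1]. *)
pose L := 1 + d%:R * K ^+ 3 / d1.
have L1 : 1 <= L by rewrite lerDl divr_ge0 ?mulr_ge0 ?exprn_ge0// ltW.
have L0 : 0 < L by exact: lt_le_trans L1.
have [d2 d20 H2] := uniform_continuous_ball (d%:R * L) cf e40.
(* Chebyshev constant: an endpoint farther than [d2] from its mean costs [2 * M], and the mean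
   squared distance is at most [(2 * L) ^+ 2 * d / n]. The number of steps [n] is chosen to make
   [C / n] at most [e / 4]. *)
pose C := 2 * M / d2 ^+ 2 * ((2 * L) ^+ 2 * d%:R).
have A0 : 0 <= 2 * M / d2 ^+ 2 by rewrite divr_ge0 ?sqr_ge0// mulr_ge0.
have C0 : 0 <= C by rewrite mulr_ge0// mulr_ge0// sqr_ge0.
have Ce0 : 0 <= C / (e / 4) by rewrite divr_ge0// ltW.
pose n := (Num.bound (C / (e / 4))).+1.
have n0 : 0 < n%:R :> R by rewrite ltr0n.
have Cn : C / n%:R <= e / 4.
  rewrite ler_pdivrMr// mulrC -ler_pdivrMr// ltW// (lt_trans (archi_boundP Ce0))//.
  by rewrite ltr_nat.
pose js := @coord_steps d n.
pose h (y : 'cV[R]_d) := walk (step_prob L y) js (fun x => f (walk_point L n x)).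
exists h; split.
- by apply: trig_walk => j; exact: trig_step_prob.
- move=> y; rewrite -[h y]subr0 -[leRHS](walk_cst (step_prob L y) js).
  apply: normr_walk_sub_le => [j|x]; first exact: step_prob01.
  by rewrite subr0.
move=> y yK.
have S1 : `|f (sin_coords L y) - f y| <= e / 2.
  apply: H1 => //; apply: (le_lt_trans (sin_coords_dist L0 yK)).
  rewrite mulrA ltr_pdivrMr ?exprn_gt0//.
  have : d%:R * K ^+ 3 < d1 * L by rewrite (_ : d1 * L = d1 + d%:R * K ^+ 3) ?ltrDr// /L; field; rewrite gt_eqF.
  move=> /lt_le_trans; apply; rewrite ler_wpM2l ?(ltW d10)// expr2 ler_peMl// ltW//.
suff S2 : `|h y - f (sin_coords L y)| <= e / 2.
  have -> : h y - f y = (h y - f (sin_coords L y)) + (f (sin_coords L y) - f y) by ring.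
  by rewrite (le_trans (ler_normD _ _))//; lra.
pose psi (x : 'cV[R]_d) : R := e / 4 + 2 * M / d2 ^+ 2 * ((2 * L / n%:R) ^+ 2 *
  \sum_(l < d) (x l 0 - n%:R * step_prob L y l 0) ^+ 2).
have HP : `|h y - f (sin_coords L y)| <= walk (step_prob L y) js psi.
  apply: normr_walk_sub_le => [j|x]; first exact: step_prob01.
  rewrite /psi -walk_pointB//.
  have [near|far] := ltP (enorm (walk_point L n x - sin_coords L y)) d2.
    apply: (le_trans (H2 _ _ (enorm_sin_coords L0 y) near)).
    by rewrite lerDl mulr_ge0// sqr_ge0.
  apply: (@le_trans _ _ (2 * M)).
    rewrite (le_trans (ler_normB _ _))//.
    by have := fM (walk_point L n x); have := fM (sin_coords L y); lra.
  apply: (@le_trans _ _ (2 * M / d2 ^+ 2 * d2 ^+ 2)); first by rewrite divfK// expf_neq0// gt_eqF.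
  apply: (@le_trans _ _ (2 * M / d2 ^+ 2 * enorm (walk_point L n x - sin_coords L y) ^+ 2)).
    rewrite ler_wpM2l//.
    by rewrite lerXn2r ?nnegrE ?enorm_ge0// ltW.
  by rewrite lerDr ltW.
apply: (le_trans HP); rewrite /psi walkD walk_cst !walkZ walk_sum.
under eq_bigr do rewrite walk_coord_sqr count_coord_steps subrr expr0n/= addr0.
have -> : e / 2 = e / 4 + e / 4 by field.
rewrite lerD2l; apply: le_trans Cn.
have -> : C / n%:R = 2 * M / d2 ^+ 2 * ((2 * L / n%:R) ^+ 2 * (n%:R * d%:R)).
  by rewrite /C; field; rewrite !gt_eqF.
rewrite ler_wpM2l// ler_wpM2l ?sqr_ge0//.
apply: (@le_trans _ _ (\sum_(l < d) n%:R)); last by rewrite sumr_const card_ord mulr_natr.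
apply: ler_sum => l _; rewrite ler_piMr//.
by have /andP[u0 u1] := step_prob01 L y l; nra.
Qed.

(** * Convergence in distribution *)

Section tails.
Context {R : realType} {d : nat}.
Local Notation cV := 'cV[R]_d.
Local Notation vec := (@vecB R d).

(** Written as a real function, so that tightness and convergence in probability become statements
    on expectations and combine linearly with other bounds. *)
Definition tail (K : R) (y : cV) : R := if K < enorm y then 1 else 0.

Lemma tail_ge0 K y : 0 <= tail K y. Proof. by rewrite /tail; case: ifP. Qed.

Lemma tail_le1 K y : tail K y <= 1. Proof. by rewrite /tail; case: ifP. Qed.

Lemma measurable_tail K : measurable_fun [set: vec] (fun y : vec => tail K y).
Proof.
apply: measurable_fun_if => //; apply: measurable_fun_ltr => //.
by apply: continuous_measurable; exact: enorm_continuous.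
Qed.

Lemma trig_bounded (h : cV -> R) : trig_poly h -> exists M : R, forall y, `|h y| <= M.
Proof.
elim=> [t|t|g1 g2 _ [M1 H1] _ [M2 H2]|a g _ [M H]].
- by exists 1 => y; rewrite ler_norml cos_geN1 cos_le1.
- by exists 1 => y; rewrite ler_norml sin_geN1 sin_le1.
- by exists (M1 + M2) => y; rewrite (le_trans (ler_normD _ _))// lerD.
- by exists (`|a| * M) => y; rewrite normrM ler_wpM2l.
Qed.

Section one_vector.
Context {dT : measure_display} {T : measurableType dT} (P : probability T R).
Variable X : T -> vec.
Hypothesis mX : measurable_fun [set: T] X.

Lemma bounded_rv_vec (f : cV -> R) : measurable_fun [set: vec] (fun y : vec => f y) ->
  (exists M : R, forall y, `|f y| <= M) -> bounded_rv (fun w => f (X w)).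
Proof.
move=> mf [M fM]; split; last by exists M => w; exact: fM.
exact: (measurableT_comp mf mX).
Qed.

Lemma bounded_rv_tail K : bounded_rv (fun w => tail K (X w)).
Proof.
apply: bounded_rv_vec; first exact: measurable_tail.
by exists 1 => y; rewrite ger0_norm ?tail_ge0// tail_le1.
Qed.

Lemma le_Rintegral_tail K K' : K <= K' -> \int[P]_w tail K' (X w) <= \int[P]_w tail K (X w).
Proof.
move=> KK; apply: le_Rintegral => //.
- exact: bounded_rv_integrable (bounded_rv_tail K').
- exact: bounded_rv_integrable (bounded_rv_tail K).
- move=> w _; rewrite /tail; case: ifPn => [/(le_lt_trans KK)->//|_].
  by case: ifP.
Qed.

Lemma tail_small (e : R) : 0 < e -> exists2 K : R, 0 <= K & \int[P]_w tail K (X w) <= e.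
Proof.
move=> e0.
have mf (n : nat) : measurable_fun [set: T] (fun w => tail n%:R (X w)) := (bounded_rv_tail n%:R).1.
have pt w : (fun n : nat => tail n%:R (X w)) @ \oo --> (0 : R).
  apply: cvg_near_cst; near=> n; rewrite /tail ltNge ifF//; apply/negbTE; rewrite negbK.
  by near: n; exact: nbhs_infty_ger.
have bnd (n : nat) w : `|tail n%:R (X w)| <= 1 by rewrite ger0_norm ?tail_ge0// tail_le1.
have I1 := bounded_rv_integrable P (bounded_rv_cst 1).
have [_] := dominated_convergence_real mf pt I1 bnd.
rewrite Rintegral_prob_cst => /cvgrPdist_le /(_ _ e0) [N _ HN].
exists N%:R => //; have := HN N (leqnn N); rewrite /= sub0r normrN.
by apply: le_trans; exact: ler_norm.
Unshelve. all: by end_near.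
Qed.

Lemma Rintegral_tail_dist (f h : cV -> R) (e M K : R) :
  bounded_rv (fun w => f (X w)) -> bounded_rv (fun w => h (X w)) ->
  (forall y, `|f y - h y| <= e + M * tail K y) ->
  `|\int[P]_w f (X w) - \int[P]_w h (X w)| <= e + M * \int[P]_w tail K (X w).
Proof.
move=> bf bh fh; have bt := bounded_rv_tail K.
have bd : bounded_rv (fun w => f (X w) + -1 * h (X w)).
  by apply: bounded_rvD => //; exact: bounded_rvZ.
have -> : \int[P]_w f (X w) - \int[P]_w h (X w) = \int[P]_w (f (X w) + -1 * h (X w)).
  by rewrite RintegralD_bounded//; [rewrite RintegralZ_bounded// mulN1r|exact: bounded_rvZ].
have be : bounded_rv (fun w => e + M * tail K (X w)).
  by apply: bounded_rvD; [exact: bounded_rv_cst|exact: bounded_rvZ].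
have -> : e + M * \int[P]_w tail K (X w) = \int[P]_w (e + M * tail K (X w)).
  rewrite RintegralD_bounded; [|exact: bounded_rv_cst|exact: bounded_rvZ].
  by rewrite RintegralZ_bounded// Rintegral_prob_cst.
rewrite (le_trans (le_normr_Rintegral measurableT (bounded_rv_integrable P bd)))//.
apply: le_Rintegral => //.
- exact: integrable_norm (bounded_rv_integrable P bd).
- exact: bounded_rv_integrable.
- by move=> w _; rewrite mulN1r; exact: fh.
Qed.

End one_vector.

Lemma cvg_distP (dT : measure_display) (T : measurableType dT) (P : probability T R)
  (dT' : measure_display) (T' : measurableType dT') (P' : probability T' R)
  (Z : nat -> T -> vec) (G : T' -> vec) :
  (forall n, measurable_fun [set: T] (Z n)) -> measurable_fun [set: T'] G ->
  cvg_dist P Z P' G <->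
  (forall f : cV -> R, continuous f -> (exists M : R, forall y, `|f y| <= M) ->
    (fun n => \int[P]_w f (Z n w)) @ \oo --> \int[P']_w f (G w)).
Proof.
move=> mZ mG.
have E (f : cV -> R) : continuous f -> (exists M : R, forall y, `|f y| <= M) ->
    (fun n => \int[P]_w (f (Z n w))%:E)%E = (fun n => (\int[P]_w f (Z n w))%:E) /\
    (\int[P']_w (f (G w))%:E = (\int[P']_w f (G w))%:E)%E.
  move=> cf fM.
  have mf : measurable_fun [set: vec] (fun y : vec => f y) by exact: continuous_measurable.
  split; last by rewrite (integral_Rintegral (bounded_rv_integrable P' (bounded_rv_vec mG mf fM))).
  by apply/funext => n; rewrite (integral_Rintegral (bounded_rv_integrable P (bounded_rv_vec (mZ n) mf fM))).
split => H f cf fM; have [E1 E2] := E f cf fM.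
  by have := H f cf fM; rewrite E1 E2 => /fine_cvg.
by rewrite E1 E2; apply: cvg_EFin; [exact: nearW|exact: H].
Qed.

(** * Levy's continuity theorem for tight sequences *)

Section levy.
Context {dT : measure_display} {T : measurableType dT} (P : probability T R).
Context {dT' : measure_display} {T' : measurableType dT'} (P' : probability T' R).
Variables (Z : nat -> T -> vec) (G : T' -> vec).
Hypothesis mZ : forall n, measurable_fun [set: T] (Z n).
Hypothesis mG : measurable_fun [set: T'] G.

Hypothesis tightZ : forall e : R, 0 < e -> exists K : R,
  \forall n \near \oo, \int[P]_w tail K (Z n w) <= e.

(** Convergence extends to trigonometric polynomials by linearity. A test function is replaced by
    one of these, close on the ball of radius [K] and with the same bound [M]; outside the ball the
    cost is [2 * M] times the tails of [Z n] and of [G]. *)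
Lemma levy_continuity :
  (forall t, (fun n => \int[P]_w cos (dotv t (Z n w))) @ \oo --> \int[P']_w cos (dotv t (G w))) ->
  (forall t, (fun n => \int[P]_w sin (dotv t (Z n w))) @ \oo --> \int[P']_w sin (dotv t (G w))) ->
  cvg_dist P Z P' G.
Proof.
move=> Hcos Hsin; apply/(cvg_distP P P' mZ mG) => f cf [M fM].
have Mge0 : 0 <= M by apply: le_trans (fM 0).
have mf : measurable_fun [set: vec] (fun y : vec => f y) by exact: continuous_measurable.
have mt h : trig_poly h -> measurable_fun [set: vec] (fun y : vec => h y).
  by move=> th; apply: continuous_measurable; exact: trig_continuous.
have bz h n (th : trig_poly h) := bounded_rv_vec (mZ n) (mt h th) (trig_bounded th).
have trig_cvg (h : cV -> R) : trig_poly h ->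
    (fun n => \int[P]_w h (Z n w)) @ \oo --> \int[P']_w h (G w).
  elim=> [t|t|g1 g2 t1 H1 t2 H2|a g t H]; [exact: Hcos|exact: Hsin| |].
    have b1 := bounded_rv_vec mG (mt _ t1) (trig_bounded t1).
    have b2 := bounded_rv_vec mG (mt _ t2) (trig_bounded t2).
    rewrite RintegralD_bounded//.
    rewrite (_ : (fun n => _) = (fun n => \int[P]_w g1 (Z n w) + \int[P]_w g2 (Z n w))); last first.
      by apply/funext => n; exact: RintegralD_bounded (bz _ n t1) (bz _ n t2).
    exact: cvgD.
  have b1 := bounded_rv_vec mG (mt _ t) (trig_bounded t).
  rewrite RintegralZ_bounded//.
  rewrite (_ : (fun n => _) = (fun n => a * \int[P]_w g (Z n w))); last first.
    by apply/funext => n; exact: RintegralZ_bounded (bz _ n t).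
  exact: cvgMl_tmp.
apply/cvgrPdist_le => e e0.
(* Dividing by [2 * M + 1] rather than [2 * M] covers [M = 0]. The budget is [e / 4] for each of the
   two replacements and [e / 4] for the convergence. *)
have M1 : 0 < 2 * M + 1 by rewrite ltr_wpDl// mulr_ge0.
have e1 : 0 < e / 8 by rewrite divr_gt0.
have e2 : 0 < e / 8 / (2 * M + 1) by rewrite divr_gt0.
have [K1 tK1] := tightZ e2.
have [K2 K20 tK2] := tail_small P' mG e2.
pose K := Num.max K1 K2.
have K1K : K1 <= K by rewrite le_max lexx.
have K2K : K2 <= K by rewrite le_max lexx orbT.
have [h [th hM hf]] := trig_approx cf fM e1 (le_trans K20 K2K).
have fh y : `|f y - h y| <= e / 8 + 2 * M * tail K y.
  rewrite /tail; case: ltP => [_|yK]; last by rewrite mulr0 addr0 distrC hf.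
  rewrite mulr1 (le_trans (ler_normB _ _))//; have := fM y; have := hM y; lra.
have small (t : R) : t <= e / 8 / (2 * M + 1) -> e / 8 + 2 * M * t <= e / 4.
  move=> te; have : 2 * M * t <= e / 8; last by lra.
  apply: (@le_trans _ _ (2 * M * (e / 8 / (2 * M + 1)))); first by rewrite ler_wpM2l// mulr_ge0.
  rewrite mulrCA ler_piMr ?(ltW e1)// ler_pdivrMr// mul1r; lra.
have bG := bounded_rv_vec mG mf (ex_intro _ M fM).
have bGh := bounded_rv_vec mG (mt _ th) (trig_bounded th).
have DG := Rintegral_tail_dist P' mG bG bGh fh.
have SG := small _ (le_trans (le_Rintegral_tail P' mG K2K) tK2).
have e40 : 0 < e / 4 by rewrite divr_gt0.
have /cvgrPdist_le /(_ _ e40) Hh := trig_cvg h th.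
near=> n.
have bZ := bounded_rv_vec (mZ n) mf (ex_intro _ M fM).
have DZ := Rintegral_tail_dist P (mZ n) bZ (bz h n th) fh.
have tZ : \int[P]_w tail K1 (Z n w) <= e / 8 / (2 * M + 1) by near: n.
have SZ := small _ (le_trans (le_Rintegral_tail P (mZ n) K1K) tZ).
have HZ : `|\int[P']_w h (G w) - \int[P]_w h (Z n w)| <= e / 4 by near: n.
rewrite [X in `|X|](_ : _ = (\int[P']_w f (G w) - \int[P']_w h (G w)) +
  ((\int[P']_w h (G w) - \int[P]_w h (Z n w)) - (\int[P]_w f (Z n w) - \int[P]_w h (Z n w)))); last by ring.
rewrite (le_trans (ler_normD _ _))//.
have := ler_normB (\int[P']_w h (G w) - \int[P]_w h (Z n w)) (\int[P]_w f (Z n w) - \int[P]_w h (Z n w)).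
have := le_trans DG SG; have := le_trans DZ SZ; lra.
Unshelve. all: by end_near.
Qed.

End levy.

(** Where [Z n] stays in a ball and [W n - Z n] is short, uniform continuity compares the two values
    of [f]; the two exceptional events are paid by tails. *)
Lemma slutsky (dT : measure_display) (T : measurableType dT) (P : probability T R)
  (dT' : measure_display) (T' : measurableType dT') (P' : probability T' R)
  (Z W : nat -> T -> vec) (G : T' -> vec) :
  (forall n, measurable_fun [set: T] (Z n)) -> (forall n, measurable_fun [set: T] (W n)) ->
  measurable_fun [set: T'] G ->
  (forall e : R, 0 < e -> exists K : R, \forall n \near \oo, \int[P]_w tail K (Z n w) <= e) ->
  (forall delta : R, 0 < delta ->
    (fun n => \int[P]_w tail delta (W n w - Z n w : cV)) @ \oo --> (0 : R)) ->
  cvg_dist P Z P' G -> cvg_dist P W P' G.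
Proof.
move=> mZ mW mG tightZ WZ ZG; apply/(cvg_distP P P' mW mG) => f cf fM'.
have H := (cvg_distP P P' mZ mG).1 ZG f cf fM'.
have [M fM] := fM'.
have Mge0 : 0 <= M by apply: le_trans (fM 0).
have mf : measurable_fun [set: vec] (fun y : vec => f y) by exact: continuous_measurable.
have mD n : measurable_fun [set: T] (fun w => W n w - Z n w : vec).
  apply: measurable_fun_vecB => j.
  rewrite (_ : (fun _ => _) = (fun w => (W n w : cV) j 0 - (Z n w : cV) j 0)); last first.
    by apply/funext => w; rewrite !mxE.
  apply: measurable_funB; first exact: measurableT_comp (measurable_entry j) (mW n).
  exact: measurableT_comp (measurable_entry j) (mZ n).
apply/cvgrPdist_le => e e0.
have e2 : 0 < e / 8 / (2 * M + 1) by rewrite divr_gt0 ?divr_gt0// ltr_wpDl// mulr_ge0.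
have e80 : 0 < e / 8 by rewrite divr_gt0.
have [K tK] := tightZ _ e2.
have [del del0 Hdel] := uniform_continuous_ball K cf e80.
have d2 : 0 < del / 2 by rewrite divr_gt0.
have /cvgrPdist_le /(_ _ e2) HWZ := WZ _ d2.
have /cvgrPdist_le /(_ _ e80) HZ := H.
have small (t : R) : t <= e / 8 / (2 * M + 1) -> 2 * M * t <= e / 8.
  move=> te; apply: (@le_trans _ _ (2 * M * (e / 8 / (2 * M + 1)))).
    by rewrite ler_wpM2l// mulr_ge0.
  rewrite mulrCA ler_piMr ?(ltW e80)// ler_pdivrMr ?mul1r; first lra.
  by rewrite ltr_wpDl// mulr_ge0.
near=> n.
have bZ := bounded_rv_vec (mZ n) mf fM'.
have bW := bounded_rv_vec (mW n) mf fM'.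
have bt := bounded_rv_tail (mZ n) K.
have bi := bounded_rv_tail (mD n) (del / 2).
have bd : bounded_rv (fun w => f (W n w) + -1 * f (Z n w)).
  by apply: bounded_rvD => //; exact: bounded_rvZ.
have Dist : `|\int[P]_w f (W n w) - \int[P]_w f (Z n w)| <=
   e / 8 + (2 * M * \int[P]_w tail (del / 2) (W n w - Z n w : cV) + 2 * M * \int[P]_w tail K (Z n w)).
  have -> : \int[P]_w f (W n w) - \int[P]_w f (Z n w) = \int[P]_w (f (W n w) + -1 * f (Z n w)).
    by rewrite RintegralD_bounded//; [rewrite RintegralZ_bounded// mulN1r|exact: bounded_rvZ].
  have b2 : bounded_rv (fun w => 2 * M * tail (del / 2) (W n w - Z n w : cV) + 2 * M * tail K (Z n w)).
    by apply: bounded_rvD; exact: bounded_rvZ.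
  have b1 : bounded_rv (fun w => e / 8 + (2 * M * tail (del / 2) (W n w - Z n w : cV) + 2 * M * tail K (Z n w))).
    by apply: bounded_rvD => //; exact: bounded_rv_cst.
  rewrite -!RintegralZ_bounded// -RintegralD_bounded; [|exact: bounded_rvZ|exact: bounded_rvZ].
  rewrite -[X in X + _](Rintegral_prob_cst P) -RintegralD_bounded//; last exact: bounded_rv_cst.
  rewrite (le_trans (le_normr_Rintegral measurableT (bounded_rv_integrable P bd)))//.
  apply: le_Rintegral => //.
  - exact: integrable_norm (bounded_rv_integrable P bd).
  - exact: bounded_rv_integrable.
  move=> w _; rewrite mulN1r {1}/tail {1}/tail.
  have MM : `|f (W n w) - f (Z n w)| <= 2 * M.
    by rewrite (le_trans (ler_normB _ _))//; have := fM (W n w); have := fM (Z n w); lra.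
  have M20 : 0 <= 2 * M by rewrite mulr_ge0.
  case: ltP => [_|HD]; first by case: ifP => _; rewrite ?mulr1 ?mulr0; lra.
  case: ltP => [_|HK]; first by rewrite ?mulr1 ?mulr0; lra.
  rewrite !mulr0 !addr0; apply: Hdel => //; apply: (le_lt_trans HD); lra.
have T1 : 2 * M * \int[P]_w tail (del / 2) (W n w - Z n w : cV) <= e / 8.
  apply: small; apply: le_trans (ler_norm _) _; rewrite -normrN -sub0r; near: n; exact: HWZ.
have T2 : 2 * M * \int[P]_w tail K (Z n w) <= e / 8 by apply: small; near: n.
have T3 : `|\int[P']_w f (G w) - \int[P]_w f (Z n w)| <= e / 8 by near: n.
rewrite [X in `|X|](_ : _ = (\int[P']_w f (G w) - \int[P]_w f (Z n w)) -
  (\int[P]_w f (W n w) - \int[P]_w f (Z n w))); last by ring.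
rewrite (le_trans (ler_normB _ _))//; lra.
Unshelve. all: by end_near.
Qed.

End tails.

(** * Characteristic function of a Gaussian vector *)

Section gaussian_characteristic.
Context {R : realType} {d : nat}.
Local Notation cV := 'cV[R]_d.
Local Notation vec := (@vecB R d).
Local Notation leb := (@lebesgue_measure R).
Local Notation g t := (expR (- (2^-1 * t ^+ 2))).

Lemma normal_integral_scale (sigma : R) (F : R -> R) : 0 < sigma ->
  measurable_fun [set: R] F -> (forall t, 0 <= F t) ->
  (\int[leb]_t (F t * normal_pdf 0 sigma t)%:E =
   ((Num.sqrt (2 * pi))^-1)%:E * \int[leb]_t (F (sigma * t) * g t)%:E)%E.
Proof.
move=> s0 mF F0; have sn0 : sigma != 0 by rewrite gt_eqF.
have spos : 0 < Num.sqrt (2 * pi) :> R by rewrite sqrtr_gt0 mulr_gt0// pi_gt0.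
have mH : measurable_fun [set: R] (fun t : R => (F t * normal_pdf 0 sigma t)%:E).
  by apply/measurable_EFinP; apply: measurable_funM => //; exact: measurable_normal_pdf.
have H0 (t : R) : (0 <= (F t * normal_pdf 0 sigma t)%:E)%E.
  by rewrite lee_fin mulr_ge0// normal_pdf_ge0.
rewrite (ge0_integral_affine 0 sn0 mH H0) gtr0_norm//.
have mS : measurable_fun [set: R] (fun t : R => sigma * t) by apply: measurable_funM.
have mG : measurable_fun [set: R] (fun t : R => (F (sigma * t) * g t)%:E).
  apply/measurable_EFinP; apply: measurable_funM; first exact: measurableT_comp mF mS.
  exact: measurable_gauss.
have m0S : measurable_fun [set: R] (fun t : R => 0 + sigma * t) by apply: measurable_funD.
rewrite -ge0_integralZl_EFin//; last 2 first.
- apply/measurable_EFinP; apply: measurable_funM; first exact: measurableT_comp mF m0S.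
  exact: measurableT_comp (measurable_normal_pdf 0 sigma) m0S.
- exact: ltW.
rewrite -ge0_integralZl_EFin//; last by move=> t _; rewrite lee_fin mulr_ge0 ?expR_ge0.
apply: eq_integral => t _; rewrite -!EFinM; congr EFin; rewrite add0r normal_pdfE// /normal_peak /normal_fun.
rewrite subr0.
have -> : Num.sqrt (sigma ^+ 2 * pi *+ 2) = sigma * Num.sqrt (2 * pi).
  rewrite -mulrnAr -mulr_natl sqrtrM ?sqr_ge0// sqrtr_sqr gtr0_norm//.
have -> : - (sigma * t) ^+ 2 / (sigma ^+ 2 *+ 2) = - (2^-1 * t ^+ 2) by field.
by field; rewrite gt_eqF//= gt_eqF.
Qed.

Lemma measurable_cos_scale s : measurable_fun [set: R] (fun t : R => cos (s * t)).
Proof.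
have mS : measurable_fun [set: R] (fun t : R => s * t) by apply: measurable_funM.
by apply: (measurableT_comp _ mS); apply: continuous_measurable_fun; exact: continuous_cos.
Qed.

Lemma measurable_sin_scale s : measurable_fun [set: R] (fun t : R => sin (s * t)).
Proof.
have mS : measurable_fun [set: R] (fun t : R => s * t) by apply: measurable_funM.
by apply: (measurableT_comp _ mS); apply: continuous_measurable_fun; exact: continuous_sin.
Qed.

(** [gaussian_vec] prescribes the law of each [dotv t (G w)], so only a one-dimensional Fourier
    integral is left. A direction of zero variance is a Dirac mass and is treated apart. *)
Lemma gaussian_char (dT : measure_display) (T : measurableType dT) (P : probability T R)
  (G : T -> cV) (C : 'M[R]_d) (t : cV) : gaussian_vec P G C ->
  let s2 := (t^T *m C *m t) 0 0 in 0 <= s2 ->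
  \int[P]_w cos (dotv t (G w)) = expR (- (2^-1 * s2)) /\ \int[P]_w sin (dotv t (G w)) = 0.
Proof.
move=> [mG law] s2 s20.
have mGv : measurable_fun [set: T] (G : T -> vec) by move=> _ A mA; rewrite setTI; exact: mG.
have mX : measurable_fun [set: T] (fun w => dotv t (G w) : measurableTypeR R).
  exact: measurableT_comp (measurable_dotv t) mGv.
have key (F : R -> R) : measurable_fun [set: R] F -> (forall x, 0 <= F x) ->
    (\int[P]_w (F (dotv t (G w)))%:E =
     if (s2 == 0)%R then (F 0%R)%:E else ((Num.sqrt (2 * pi))^-1)%:E *
       \int[leb]_x (F (Num.sqrt s2 * x) * g x)%:E)%E.
  move=> mF F0.
  have mEF : measurable_fun [set: measurableTypeR R] (EFin \o F) by exact/measurable_EFinP.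
  have F0' x : (0 <= (EFin \o F) x)%E by rewrite lee_fin.
  rewrite -(ge0_integral_image_measure P mX mEF F0').
  have lawE B : measurable B -> image_measure P mX B =
      if s2 == 0 then \d_(0 : R) B else normal_prob 0 (Num.sqrt s2) B.
    by move=> mB; exact: law.
  case: eqP lawE => [s2E|/eqP s2E] lawE.
    rewrite (@eq_measure_integral _ (measurableTypeR R) R setT (\d_(0 : measurableTypeR R))) //; last by move=> A mA _; exact: lawE.
    by rewrite integral_dirac// diracT mul1e.
  have spos : 0 < Num.sqrt s2 by rewrite sqrtr_gt0 lt_def s2E.
  rewrite -normal_integral_scale//.
  have mN := measurable_normal_pdf 0 (Num.sqrt s2).
  have N0 := normal_pdf_ge0 0 (Num.sqrt s2).
  rewrite (@eq_measure_integral _ (measurableTypeR R) R setT (@density_measure _ (measurableTypeR R) R leb _ mN N0)) //; last by move=> A mA _; exact: lawE.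
  exact: (@ge0_integral_density _ (measurableTypeR R) R leb _ mN N0 _ mEF F0').
have gInt : leb.-integrable [set: R] (EFin \o (fun x : R => g x)).
  by apply: integrable_gauss; rewrite invr_gt0.
have spi : 0 < Num.sqrt (2 * pi) :> R by rewrite sqrtr_gt0 mulr_gt0// pi_gt0.
(* [key] concerns nonnegative functions, so sine and cosine are raised by 1. The disjunction asks
   for the value at 0 only in the degenerate case. *)
have shift (F : R -> R) (m : R) : measurable_fun [set: R] F -> (forall x, `|F x| <= 1) -> F 0 = m \/ s2 != 0 ->
    (s2 != 0 -> \int[leb]_x (F (Num.sqrt s2 * x) * g x) = Num.sqrt (2 * pi) * m) ->
    measurable_fun [set: R] (fun x => F (Num.sqrt s2 * x)) ->
    \int[P]_w F (dotv t (G w)) = m.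
  move=> mF F1 F0m Hm mFs.
  have mF1 : measurable_fun [set: R] (fun x => 1 + F x) by apply: measurable_funD.
  have F10 x : 0 <= 1 + F x by have := F1 x; rewrite ler_norml => /andP[]; lra.
  have bF : bounded_rv (fun w => F (dotv t (G w))).
    split; last by exists 1 => w; exact: F1.
    exact: (measurableT_comp mF mX).
  have b1F : bounded_rv (fun w => 1 + F (dotv t (G w))).
    by apply: bounded_rvD => //; exact: bounded_rv_cst.
  have := key _ mF1 F10.
  rewrite (integral_Rintegral (bounded_rv_integrable P b1F)).
  rewrite RintegralD_bounded//; last exact: bounded_rv_cst.
  rewrite Rintegral_prob_cst.
  case: eqP => [s2E|/eqP s2E].
    by move=> -[] /addrI ->; case: F0m => //; rewrite s2E eqxx.
  have IF : leb.-integrable [set: R] (EFin \o (fun x : R => F (Num.sqrt s2 * x) * g x)).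
    apply: (@integrable_gauss_bounded R _ 1) => // x; rewrite mul1r (le_trans (F1 _))// lerDl sqr_ge0//.
  have I1F : leb.-integrable [set: R] (EFin \o (fun x : R => (1 + F (Num.sqrt s2 * x)) * g x)).
    apply: (@integrable_gauss_bounded R _ 2) => [|x]; first by apply: measurable_funD.
    rewrite (le_trans (ler_normD _ _))// normr1; have := F1 (Num.sqrt s2 * x); have := sqr_ge0 x; lra.
  rewrite (@integral_Rintegral _ (measurableTypeR R) R leb _ I1F) -EFinM => -[] H.
  have E : \int[leb]_x ((1 + F (Num.sqrt s2 * x)) * g x) = Num.sqrt (2 * pi) + Num.sqrt (2 * pi) * m.
    rewrite -(Hm s2E) -Rintegral_gauss.
    have H2 := @RintegralD _ (measurableTypeR R) R leb setT _ _ measurableT gInt IF.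
    apply: (eq_trans _ H2).
    by apply: eq_Rintegral => x _; rewrite mulrDl mul1r.
  move: H; rewrite E.
  have -> : Num.sqrt (2 * pi) + Num.sqrt (2 * pi) * m = Num.sqrt (2 * pi) * (1 + m) by ring.
  by rewrite mulKf ?gt_eqF// => /addrI.
have mc : measurable_fun [set: R] (@cos R) by apply: continuous_measurable_fun; exact: continuous_cos.
have ms : measurable_fun [set: R] (@sin R) by apply: continuous_measurable_fun; exact: continuous_sin.
split; apply: shift => //.
- by move=> x; rewrite ler_norml cos_geN1 cos_le1.
- by case: (eqVneq s2 0) => [->|_]; [left; rewrite mulr0 oppr0 expR0 cos0|right].
- by move=> _; rewrite -[in RHS](sqr_sqrtr s20); exact: Rintegral_cos_gauss.
- exact: measurable_cos_scale.
- by move=> x; rewrite ler_norml sin_geN1 sin_le1.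
- by left; exact: sin0.
- by move=> _; rewrite mulr0; exact: Rintegral_sin_gauss.
- exact: measurable_sin_scale.
Qed.

End gaussian_characteristic.

(** * Quotients whose denominator tends to 1, and Markov bounds *)

Section ratio.
Context {R : realType} {d : nat}.
Local Notation cV := 'cV[R]_d.
Local Notation vec := (@vecB R d).
Context {dT : measure_display} {T : measurableType dT} (P : probability T R).

Lemma dotvv_sum_ebasis (y : cV) : dotv y y = \sum_(j < d) dotv (ebasis j) y ^+ 2.
Proof. by apply: eq_bigr => j _; rewrite dotv_ebasis expr2. Qed.

Lemma tail_le_dotvv (K : R) (y : cV) : 0 < K -> tail K y <= K ^- 2 * dotv y y.
Proof.
move=> K0; rewrite /tail -enorm_sqr; case: ltP => [yK|_].
  by rewrite mulrC ler_pdivlMr ?exprn_gt0// mul1r lerXn2r ?nnegrE ?enorm_ge0 ?(ltW K0)// ltW.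
by rewrite mulr_ge0 ?sqr_ge0// invr_ge0 sqr_ge0.
Qed.

Lemma tailD (K : R) (y z : cV) : tail K (y + z) <= tail (K / 2) y + tail (K / 2) z.
Proof.
rewrite {1}/tail; case: ltP => [yK|_]; last by rewrite addr_ge0// tail_ge0.
have [yK2|yK2] := ltP (K / 2) (enorm y).
  by rewrite {1}/tail yK2 lerDl tail_ge0.
have zK2 : K / 2 < enorm z by have := ler_enormD y z; lra.
by rewrite [X in _ + X]/tail zK2 lerDr tail_ge0.
Qed.

Lemma measurable_dotv_rv (X : T -> vec) t : measurable_fun [set: T] X ->
  measurable_fun [set: T] (fun w => dotv t (X w)).
Proof. by move=> mX; exact: measurableT_comp (measurable_dotv t) mX. Qed.

Lemma measurable_vec_add (X Y : T -> vec) : measurable_fun [set: T] X -> measurable_fun [set: T] Y ->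
  measurable_fun [set: T] (fun w => X w + Y w : vec).
Proof.
move=> mX mY; apply: measurable_fun_vecB => j.
rewrite (_ : (fun _ => _) = (fun w => (X w : cV) j 0 + (Y w : cV) j 0)); last first.
  by apply/funext => w; rewrite mxE.
apply: measurable_funD; first exact: measurableT_comp (measurable_entry j) mX.
exact: measurableT_comp (measurable_entry j) mY.
Qed.

Lemma measurable_vec_scale (k : T -> R) (X : T -> vec) : measurable_fun [set: T] k ->
  measurable_fun [set: T] X -> measurable_fun [set: T] (fun w => k w *: (X w : cV) : vec).
Proof.
move=> mk mX; apply: measurable_fun_vecB => j.
rewrite (_ : (fun _ => _) = (fun w => k w * (X w : cV) j 0)); last first.
  by apply/funext => w; rewrite mxE.
apply: measurable_funM => //; exact: measurableT_comp (measurable_entry j) mX.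
Qed.

Lemma Rintegral_le_bounded (V W : T -> R) : bounded_rv V -> bounded_rv W ->
  (forall w, V w <= W w) -> \int[P]_w V w <= \int[P]_w W w.
Proof.
by move=> bV bW VW; apply: le_Rintegral => //; exact: bounded_rv_integrable.
Qed.

Lemma tail_markov (X : T -> vec) (K : R) : 0 < K -> measurable_fun [set: T] X ->
  bounded_rv (fun w => dotv (X w : cV) (X w)) ->
  \int[P]_w tail K (X w) <= K ^- 2 * \int[P]_w dotv (X w : cV) (X w).
Proof.
move=> K0 mX bX; rewrite -RintegralZ_bounded//.
apply: Rintegral_le_bounded; [exact: bounded_rv_tail|exact: bounded_rvZ|].
by move=> w; exact: tail_le_dotvv.
Qed.

Lemma tight_second_moment (A : nat -> T -> vec) (B : R) :
  (forall n, measurable_fun [set: T] (A n)) ->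
  (forall n, bounded_rv (fun w => dotv (A n w : cV) (A n w))) ->
  (\forall n \near \oo, \int[P]_w dotv (A n w : cV) (A n w) <= B) ->
  forall e : R, 0 < e -> exists K : R, \forall n \near \oo, \int[P]_w tail K (A n w) <= e.
Proof.
move=> mA bA HB e e0; exists (Num.sqrt ((`|B| + 1) / e)).
have q0 : 0 < (`|B| + 1) / e by rewrite divr_gt0// ltr_wpDl.
have K0 : 0 < Num.sqrt ((`|B| + 1) / e) by rewrite sqrtr_gt0.
apply: filterS HB => n HB; rewrite (le_trans (tail_markov K0 (mA n) (bA n)))//.
rewrite sqr_sqrtr ?(ltW q0)// invf_div mulrAC ler_pdivrMr; last by rewrite ltr_wpDl.
by rewrite ler_wpM2l ?(ltW e0)// (le_trans HB)// (le_trans (ler_norm B))// lerDl.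
Qed.

(** Either [D n w] is at least [eta] away from 1, an event controlled by the L2 convergence of [D],
    or [D n w >= 1/2] and the difference has norm at most [2 * eta * enorm (A n w)], controlled by
    the second moment of [A]. The possible value [D n w = 0], where the inverse is a default, falls
    in the first case because [eta <= 1/2]. *)
Lemma ratio_tail (D : nat -> T -> R) (A : nat -> T -> vec) (B : R) :
  (forall n, bounded_rv (D n)) -> (forall n, measurable_fun [set: T] (A n)) ->
  (forall n, bounded_rv (fun w => dotv (A n w : cV) (A n w))) ->
  (\forall n \near \oo, \int[P]_w dotv (A n w : cV) (A n w) <= B) ->
  (fun n => \int[P]_w (D n w - 1) ^+ 2) @ \oo --> (0 : R) ->
  forall delta : R, 0 < delta ->
  (fun n => \int[P]_w tail delta ((D n w)^-1 *: (A n w : cV) - A n w)) @ \oo --> (0 : R).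
Proof.
move=> bD mA bA HB HD delta d0.
have pw (eta : R) n w : 0 < eta <= 2^-1 -> tail delta ((D n w)^-1 *: (A n w : cV) - A n w) <=
    eta ^- 2 * (D n w - 1) ^+ 2 + (2 * eta / delta) ^+ 2 * dotv (A n w : cV) (A n w).
  move=> /andP[eta0 eta2].
  have p1 : 0 <= eta ^- 2 * (D n w - 1) ^+ 2 by rewrite mulr_ge0 ?sqr_ge0// invr_ge0 sqr_ge0.
  have p2 : 0 <= (2 * eta / delta) ^+ 2 * dotv (A n w : cV) (A n w).
    by rewrite mulr_ge0 ?sqr_ge0 ?dotvv_ge0.
  have [far|near] := leP eta `|D n w - 1|.
    apply: (@le_trans _ _ 1); first exact: tail_le1.
    apply: (@le_trans _ _ (eta ^- 2 * (D n w - 1) ^+ 2)); last by rewrite lerDl.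
    rewrite mulrC ler_pdivlMr ?exprn_gt0// mul1r -[leRHS]ger0_norm ?sqr_ge0// normrX.
    by rewrite lerXn2r ?nnegrE ?(ltW eta0).
  have D2 : 2^-1 <= D n w by move: near; rewrite ltr_norml => /andP[]; lra.
  have Dpos : 0 < D n w by lra.
  have dist : enorm ((D n w)^-1 *: (A n w : cV) - A n w) <= 2 * eta * enorm (A n w : cV).
    rewrite -[X in _ - X]scale1r -scalerBl enormZ ler_wpM2r ?enorm_ge0//.
    have -> : (D n w)^-1 - 1 = - ((D n w - 1) / D n w) by field; rewrite gt_eqF.
    rewrite normrN normrM normfV (gtr0_norm Dpos) ler_pdivrMr//.
    by rewrite (le_trans (ltW near))//; nra.
  rewrite /tail; case: ltP => [H|_]; last by rewrite addr_ge0.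
  apply: (@le_trans _ _ ((2 * eta / delta) ^+ 2 * dotv (A n w : cV) (A n w))); last by rewrite lerDr.
  rewrite -enorm_sqr -exprMn mulrAC -[leLHS](expr1n R 2) lerXn2r ?nnegrE//.
    by rewrite divr_ge0 ?mulr_ge0 ?enorm_ge0// ltW.
  by rewrite ler_pdivlMr// mul1r ltW// (lt_le_trans H).
have bD1 n : bounded_rv (fun w => (D n w - 1) ^+ 2).
  rewrite (_ : (fun w => _) = (fun w => (D n w + -1) * (D n w + -1))); last by apply/funext => w; rewrite expr2.
  by apply: bounded_rvM; apply: bounded_rvD => //; exact: bounded_rv_cst.
have mW n : measurable_fun [set: T] (fun w => (D n w)^-1 *: (A n w : cV) - A n w : vec).
  rewrite (_ : (fun w => _) = (fun w => (D n w)^-1 *: (A n w : cV) + -1 *: (A n w : cV))); last first.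
    by apply/funext => w; rewrite scaleN1r.
  apply: measurable_vec_add; apply: measurable_vec_scale => //.
  exact: measurableT_comp measurable_invr (bD n).1.
apply/cvgrPdist_le => e e0.
(* Solves [c ^+ 2 * (|B| + 1) = e / 2]; [eta] is then small enough for [2 * eta / delta <= c]. *)
pose c := Num.sqrt (e / 2 / (`|B| + 1)).
have B1 : 0 < `|B| + 1 by rewrite ltr_wpDl.
have c0 : 0 < c by rewrite sqrtr_gt0 !divr_gt0.
pose eta := Num.min 2^-1 (c * delta / 2).
have eta0 : 0 < eta by rewrite lt_min invr_gt0 ltr0n/= divr_gt0// mulr_gt0.
have eta2 : 0 < eta <= 2^-1 by rewrite eta0 ge_min lexx.
have ec : 2 * eta / delta <= c.
  have : eta <= c * delta / 2 by rewrite ge_min lexx orbT.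
  by rewrite ler_pdivrMr//; lra.
have ee : 0 < e / 2 * eta ^+ 2 by rewrite mulr_gt0 ?divr_gt0// exprn_gt0.
have /cvgrPdist_le /(_ _ ee) HD' := HD.
near=> n.
rewrite sub0r normrN ger0_norm; last by apply: Rintegral_ge0 => w _; exact: tail_ge0.
have bT : bounded_rv (fun w => eta ^- 2 * (D n w - 1) ^+ 2 + (2 * eta / delta) ^+ 2 * dotv (A n w : cV) (A n w)).
  by apply: bounded_rvD; exact: bounded_rvZ.
apply: le_trans (Rintegral_le_bounded (bounded_rv_tail (mW n) delta) bT (fun w => pw eta n w eta2)) _.
rewrite RintegralD_bounded; [|exact: bounded_rvZ|exact: bounded_rvZ].
rewrite !RintegralZ_bounded//.
have T1 : eta ^- 2 * \int[P]_w (D n w - 1) ^+ 2 <= e / 2.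
  rewrite mulrC ler_pdivrMr ?exprn_gt0//; apply: le_trans (ler_norm _) _.
  by rewrite -normrN -sub0r; near: n.
have T2 : (2 * eta / delta) ^+ 2 * \int[P]_w dotv (A n w : cV) (A n w) <= e / 2.
  have I0 : 0 <= \int[P]_w dotv (A n w : cV) (A n w) by apply: Rintegral_ge0 => w _; exact: dotvv_ge0.
  have IB : \int[P]_w dotv (A n w : cV) (A n w) <= `|B| + 1.
    have : \int[P]_w dotv (A n w : cV) (A n w) <= B by near: n.
    by have := ler_norm B; lra.
  apply: (@le_trans _ _ (c ^+ 2 * (`|B| + 1))); last by rewrite sqr_sqrtr ?divfK ?gt_eqF// ltW// !divr_gt0.
  apply: ler_pM => //; first exact: sqr_ge0.
  by rewrite lerXn2r ?nnegrE ?(ltW c0)// divr_ge0 ?mulr_ge0 ?(ltW eta0)// ltW.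
lra.
Unshelve. all: by end_near.
Qed.

Lemma cvg_prob_tail (X : nat -> T -> vec) (c : cV) : (forall n, measurable_fun [set: T] (X n)) ->
  (forall delta : R, 0 < delta -> (fun n => \int[P]_w tail delta (X n w - c : cV)) @ \oo --> (0 : R)) ->
  cvg_prob P X c.
Proof.
(* [cvg_prob] uses a non-strict inequality and [tail] a strict one; halving [eps] bridges the
   two. *)
move=> mX H eps e0; have e2 : 0 < eps / 2 by rewrite divr_gt0.
have mXc n : measurable_fun [set: T] (fun w => X n w - c : vec).
  by apply: measurable_vec_add.
have mS n : measurable [set w | eps <= enorm (X n w - c : cV)].
  have me : measurable_fun [set: T] (fun w => enorm (X n w - c : cV)).
    have m1 : measurable_fun [set: vec] (fun y : vec => enorm (y : cV)).
      by apply: continuous_measurable; exact: enorm_continuous.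
    exact: measurableT_comp m1 (mXc n).
  rewrite -[X in measurable X]setTI (_ : [set w | _] = (fun w => enorm (X n w - c : cV)) @^-1` `[eps, +oo[%classic).
    exact: me.
  by apply/seteqP; split => w /=; rewrite in_itv/= andbT.
have lim0 : (fun n => (\int[P]_w tail (eps / 2) (X n w - c : cV))%:E) @ \oo --> 0%E.
  by apply: cvg_EFin; [exact: nearW|exact: H].
apply: (squeeze_cvge _ (cvg_cst 0%E) lim0); apply: nearW => n; apply/andP; split => //.
rewrite -(integral_Rintegral (bounded_rv_integrable P (bounded_rv_tail (mXc n) (eps / 2)))).
have -> : P [set w | eps <= enorm (X n w - c : cV)] = (\int[P]_w (\1_[set w | eps <= enorm (X n w - c : cV)] w)%:E)%E.
  by rewrite integral_indic// setIT.
apply: ge0_le_integral => //.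
- by apply/measurable_EFinP; exact: measurable_indic.
- by apply/measurable_EFinP; exact: (bounded_rv_tail (mXc n) (eps / 2)).1.
move=> w _; rewrite lee_fin indicE /tail; case: (boolP (w \in _)) => [|_]; last by case: ifP.
by rewrite inE/= => H1; rewrite ifT//; lra.
Qed.

End ratio.

Lemma bounded_rv_bigsum (R : realType) (dT : measure_display) (T : measurableType dT) (I : Type)
  (r : seq I) (W : I -> T -> R) : (forall i, bounded_rv (W i)) ->
  bounded_rv (fun w => \sum_(i <- r) W i w).
Proof.
move=> bW; elim: r => [|i r IH].
  rewrite (_ : (fun _ => _) = fun=> 0); first exact: bounded_rv_cst.
  by apply/funext => w; rewrite big_nil.
rewrite (_ : (fun _ => _) = (fun w => W i w + \sum_(j <- r) W j w)); first exact: bounded_rvD.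
by apply/funext => w; rewrite big_cons.
Qed.

Lemma cvg_bigsum (R : realType) (I : Type) (r : seq I) (u : I -> nat -> R) (l : I -> R) :
  (forall i, u i @ \oo --> l i) -> (fun n => \sum_(i <- r) u i n) @ \oo --> \sum_(i <- r) l i.
Proof.
move=> ul; elim: r => [|i r IH].
  rewrite big_nil (_ : (fun _ => _) = fun=> 0); first exact: cvg_cst.
  by apply/funext => n; rewrite big_nil.
rewrite big_cons (_ : (fun _ => _) = (fun n => u i n + \sum_(j <- r) u j n)); first exact: cvgD.
by apply/funext => n; rewrite big_cons.
Qed.

(** * Attention *)

Section attention_core.
Context {R : realType} {d : nat}.
Local Notation cV := 'cV[R]_d.
Local Notation vec := (@vecB R d).
Local Notation cv z := (z : 'cV[R]_d).
Hypothesis d_gt0 : (0 < d)%N.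
Variables (q : cV) (rho : cV -> R).
Hypothesis hq : sphere q.
Hypothesis hC2 : exists U : set cV, [/\ open U, sphere `<=` U & C2_on U rho].
Hypothesis rho_ge0 : forall y, sphere y -> 0 <= rho y.
Hypothesis rho_gt0 : 0 < rho q.
Variables (V : 'M[R]_d) (beta : nat -> R).
Hypothesis beta_gt0 : forall n, 0 < beta n.
Context {dT : measure_display} {T : measurableType dT} (P : probability T R).
Variable x : nat -> T -> cV.
Hypothesis hxS : forall i w, sphere (x i w).
Hypothesis hxmeas : forall i A, borelRd A -> measurable (x i @^-1` A).
Hypothesis hxlaw : forall i A, borelRd A ->
  P (x i @^-1` A) = sphere_int (fun y => ((\1_A y) * rho y)%:E).
Hypothesis hxindep : forall (I : seq nat) (A : nat -> set cV), uniq I ->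
  (forall k, k \in I -> borelRd (A k)) ->
  P (\bigcap_(k in [set k | k \in I]) (x k @^-1` A k)) = (\prod_(k <- I) P (x k @^-1` A k))%E.
Hypothesis beta_oo : beta @ \oo --> +oo.

Let s n := (Num.sqrt (beta n))^-1.
(** A cap of radius of order [s n] around [q] holds on average a number of samples of order
    [n * s n ^+ d.-1]; this number has to tend to infinity. *)
Hypothesis sparse : (fun n => (n%:R * s n ^+ d.-1)^-1) @ \oo --> (0 : R).
Variables (a : nat -> R) (mu v : R).
Hypothesis a_mean : (fun n => a n * s n ^+ 2) @ \oo --> mu.
Hypothesis a_var : (fun n => a n ^+ 2 * s n ^+ 4 / (n%:R * s n ^+ d.+1)) @ \oo --> v.

Let s_gt0 n : 0 < s n. Proof. by rewrite invr_gt0 sqrtr_gt0. Qed.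

Let s_sqr n : (s n ^+ 2)^-1 = beta n.
Proof. by rewrite /s exprVn invrK sqr_sqrtr// ltW. Qed.

Let s_cvg0 : s @ \oo --> (0 : R).
Proof.
have H : (fun n => (beta n)^-1) @ \oo --> (0 : R) by apply/gtr0_cvgV0 => //; exact: nearW.
rewrite (_ : s = (fun n => Num.sqrt ((beta n)^-1))); last by apply/funext => n; rewrite sqrtrV// ltW.
rewrite -(sqrtr0 R); apply: continuous_cvg => //; exact: sqrt_continuous.
Qed.

Let sqrt2_gt0 : 0 < Num.sqrt 2 :> R. Proof. by rewrite sqrtr_gt0. Qed.
(** The width belonging to [2 * beta]. A squared attention weight is the weight at [2 * beta], so
    the second moments are Laplace limits along [s'], whence the powers of [Num.sqrt 2]. *)
Let s' n := s n / Num.sqrt 2.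
Let s'_gt0 n : 0 < s' n. Proof. by rewrite divr_gt0. Qed.
Let s'_sqr n : (s' n ^+ 2)^-1 = 2 * beta n.
Proof. by rewrite /s' expr_div_n sqr_sqrtr// invf_div -s_sqr. Qed.
Let s'_cvg0 : s' @ \oo --> (0 : R).
Proof. by rewrite -[X in _ --> X](mul0r (Num.sqrt 2)^-1); exact: cvgMr_tmp. Qed.

Let mx i : measurable_fun [set: T] (x i : T -> vec).
Proof. by move=> _ A mA; rewrite setTI; exact: hxmeas. Qed.

Let indep (I : seq nat) (A : nat -> set vec) : uniq I -> (forall k, k \in I -> measurable (A k)) ->
  P (\bigcap_(k in [set k | k \in I]) (x k @^-1` A k)) = (\prod_(k <- I) P (x k @^-1` A k))%E.
Proof. by move=> uI mA; exact: hxindep. Qed.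

Let law i (A : set vec) : measurable A -> P (x i @^-1` A) = P (x 0%N @^-1` A).
Proof. by move=> mA; rewrite (hxlaw i mA) (hxlaw 0%N mA). Qed.

Let e n (y : vec) : R := attention q (beta n) (cv y).
Let h n (u : cV) (y : vec) : R := attention q (beta n) (cv y) * dotv u (cv y - q).
Let p n := \int[P]_w e n (x 0%N w).
Let b n u := \int[P]_w h n u (x 0%N w).
Let kappa := rho q * Num.sqrt (2 * pi) ^+ d.-1.
Let tang (u : cV) : cV := u - dotv u q *: q.

Let kappa_gt0 : 0 < kappa.
Proof. by rewrite mulr_gt0// exprn_gt0// sqrtr_gt0 mulr_gt0// pi_gt0. Qed.

Let attention_sqr n y : attention q (beta n) y ^+ 2 = attention q (2 * beta n) y.
Proof. by rewrite /attention -expRM_natl; congr expR; ring. Qed.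

Let p_cvg : (fun n => p n / s n ^+ d.-1) @ \oo --> kappa.
Proof.
have := laplace_mass d_gt0 hq hC2 rho_ge0 (hxmeas 0%N) (hxlaw 0%N) (hxS 0%N) s_gt0 s_cvg0.
by under eq_fun do rewrite s_sqr.
Qed.

Let b_cvg u : (fun n => b n u / s n ^+ d.+1) @ \oo --> kappa * dotv u (Ylim rho q).
Proof.
have := laplace_first_moment d_gt0 hq hC2 rho_ge0 (hxmeas 0%N) (hxlaw 0%N) (hxS 0%N) s_gt0 s_cvg0 (u := u) rho_gt0.
by under eq_fun do rewrite s_sqr; rewrite /kappa mulrAC.
Qed.

Let h2_cvg u : (fun n => \int[P]_w (h n u (x 0%N w) ^+ 2) / s n ^+ d.+1) @ \oo -->
  kappa * dotv (tang u) (tang u) / Num.sqrt 2 ^+ d.+1.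
Proof.
have := laplace_square d_gt0 hq hC2 rho_ge0 (hxmeas 0%N) (hxlaw 0%N) (hxS 0%N) s'_gt0 s'_cvg0 (u := u).
under eq_fun do rewrite s'_sqr.
move=> H; rewrite (_ : (fun n => _) = (fun n =>
  \int[P]_w (attention q (2 * beta n) (x 0%N w) * dotv u (x 0%N w - q) ^+ 2) / s' n ^+ d.+1 / Num.sqrt 2 ^+ d.+1)).
  by rewrite /kappa (mulrAC (rho q)); exact: cvgMr_tmp H.
apply/funext => n.
have -> : \int[P]_w (h n u (x 0%N w) ^+ 2) =
    \int[P]_w (attention q (2 * beta n) (x 0%N w) * dotv u (x 0%N w - q) ^+ 2).
  by apply: eq_Rintegral => w _; rewrite /h exprMn attention_sqr.
rewrite /s' expr_div_n; move: (\int[P]_w _) => I.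
by field; rewrite !expf_neq0// gt_eqF.
Qed.

Let e2_cvg : (fun n => \int[P]_w (e n (x 0%N w) ^+ 2) / s n ^+ d.-1) @ \oo --> kappa / Num.sqrt 2 ^+ d.-1.
Proof.
have := laplace_mass d_gt0 hq hC2 rho_ge0 (hxmeas 0%N) (hxlaw 0%N) (hxS 0%N) s'_gt0 s'_cvg0.
under eq_fun do rewrite s'_sqr.
move=> H; rewrite (_ : (fun n => _) = (fun n =>
  \int[P]_w (attention q (2 * beta n) (x 0%N w)) / s' n ^+ d.-1 / Num.sqrt 2 ^+ d.-1)).
  exact: cvgMr_tmp H.
apply/funext => n.
have -> : \int[P]_w (e n (x 0%N w) ^+ 2) = \int[P]_w (attention q (2 * beta n) (x 0%N w)).
  by apply: eq_Rintegral => w _; rewrite /e attention_sqr.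
rewrite /s' expr_div_n; move: (\int[P]_w _) => I.
by field; rewrite !expf_neq0// gt_eqF.
Qed.

Let p_pos : \forall n \near \oo, 0 < p n.
Proof.
have /cvgr_gt/(_ _ kappa_gt0) := p_cvg; apply: filterS => n.
by rewrite pmulr_lgt0// invr_gt0 exprn_gt0.
Qed.

Let me n : measurable_fun [set: vec] (e n). Proof. exact: measurable_attention. Qed.

Let mh n u : measurable_fun [set: vec] (h n u).
Proof.
apply: measurable_funM; first exact: measurable_attention.
rewrite (_ : (fun _ => _) = (fun y : vec => dotv u (cv y) - dotv u q)); last first.
  by apply/funext => y; rewrite dotvBr.
by apply: measurable_funB => //; exact: measurable_dotv.
Qed.

Let e_le1 n i w : `|e n (x i w)| <= 1.
Proof. by rewrite ger0_norm ?expR_ge0// attention_le1// ltW. Qed.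

(** On the sphere [|y - q| ^+ 2 = 2 t] with [t = 1 - dotv q y], and
    [2 t * expR (- 2 beta t) <= 1 / beta]. The bound of order [s n], instead of the diameter of the
    sphere, is what makes the summands negligible. *)
Let h_le n u i w : `|h n u (x i w)| <= enorm u * s n.
Proof.
have xs := hxS i w; set y := x i w in xs *.
rewrite normrM (ger0_norm (expR_ge0 _)).
apply: (@le_trans _ _ (enorm u * (attention q (beta n) y * enorm (y - q)))).
  by rewrite mulrCA ler_wpM2l ?expR_ge0// normr_dotv_le.
rewrite ler_wpM2l ?enorm_ge0//.
rewrite -[leLHS]ger0_norm ?mulr_ge0 ?expR_ge0 ?enorm_ge0// -[leRHS]ger0_norm ?(ltW (s_gt0 n))//.
rewrite -ler_sqr ?nnegrE// !real_normK ?num_real// exprMn attention_sqr enorm_sqr.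
have -> : dotv (y - q) (y - q) = 2 * (1 - dotv q y).
  by rewrite dotvBr !dotvBl (dotvv_sphere xs) (dotvv_sphere hq) (dotvC y q); ring.
have -> : s n ^+ 2 = (beta n)^-1 by rewrite -s_sqr invrK.
rewrite /attention; set t := 1 - dotv q y.
have t0 : 0 <= 2 * beta n * t.
  have := dotv_le_enorm q y; rewrite (hq : enorm q = 1) (xs : enorm y = 1) mulr1 -subr_ge0 => H.
  by rewrite mulr_ge0// mulr_ge0// ltW.
rewrite -[leRHS]mul1r ler_pdivlMr// mulNr expRN.
have E1 := expR_ge1Dx (2 * beta n * t).
rewrite -mulrA ler_pdivrMl ?expR_gt0// mulr1; apply: le_trans E1.
by rewrite (_ : 2 * t * beta n = 2 * beta n * t); [rewrite lerDr|ring].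
Qed.

Let be n i : bounded_rv (fun w => e n (x i w)).
Proof. by apply: (bounded_rv_comp mx) => //; exists 1. Qed.
Let bh n u i : bounded_rv (fun w => h n u (x i w)).
Proof. by apply: (bounded_rv_comp mx) => //; exists (enorm u * s n). Qed.

Let np n := n%:R * p n.
Let mass n w := Zsum q beta x n w / np n.
(** The random normalisation [Zsum] is replaced by its mean [np n], which leaves a sum of
    independent vectors; dividing by [mass] undoes the replacement. *)
Let wsum n w : vec := (a n / np n) *: (V *m \sum_(j < n) (e n (x j w) *: (x j w - q))).

Let massE n w : mass n w = (np n)^-1 * \sum_(j < n) e n (x j w).
Proof. by rewrite mulrC. Qed.

Let bmass n : bounded_rv (mass n).
Proof.
rewrite (_ : mass n = (fun w => (np n)^-1 * \sum_(j < n) e n (x j w))); last exact/funext/massE.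
by apply: bounded_rvZ; exact: (bounded_rv_sum n (be n)).
Qed.

Let dotv_wsum t n w : dotv t (cv (wsum n w)) = a n / np n * \sum_(j < n) h n (V^T *m t) (x j w).
Proof.
rewrite dotvZr dotv_mulmx dotv_sumr; congr (_ * _); apply: eq_bigr => j _.
by rewrite dotvZr.
Qed.

Let bdotv_wsum t n : bounded_rv (fun w => dotv t (cv (wsum n w))).
Proof.
rewrite (_ : (fun w => _) = (fun w => a n / np n * \sum_(j < n) h n (V^T *m t) (x j w))); last first.
  exact/funext/dotv_wsum.
by apply: bounded_rvZ; exact: (bounded_rv_sum n (bh n (V^T *m t))).
Qed.

Let mwsum n : measurable_fun [set: T] (wsum n).
Proof.
apply: measurable_fun_vecB => j.
rewrite (_ : (fun _ => _) = (fun w => dotv (ebasis j) (cv (wsum n w)))); last first.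
  by apply/funext => w; rewrite dotv_ebasis.
exact: (bdotv_wsum _ n).1.
Qed.

Let np_pos : \forall n \near \oo, 0 < np n.
Proof.
near=> n; rewrite mulr_gt0 ?ltr0n//; last by near: n; exact: p_pos.
by near: n; exact: nbhs_infty_gt.
Unshelve. all: by end_near.
Qed.

Let bsqr (W : T -> R) : bounded_rv W -> bounded_rv (fun w => W w ^+ 2).
Proof.
move=> bW; rewrite (_ : (fun w => _) = (fun w => W w * W w)); first exact: bounded_rvM.
by apply/funext => w; rewrite expr2.
Qed.

Let variance_sum (g : vec -> R) (M k : R) n : measurable_fun [set: vec] g ->
  (forall i w, `|g (x i w)| <= M) ->
  \int[P]_w (\sum_(j < n) k * (g (x j w) - \int[P]_w g (x 0%N w))) ^+ 2 =
  n%:R * (k ^+ 2 * (\int[P]_w (g (x 0%N w) ^+ 2) - (\int[P]_w g (x 0%N w)) ^+ 2)).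
Proof.
move=> mg gM; set m := \int[P]_w g (x 0%N w).
have bg i : bounded_rv (fun w => g (x i w)) by apply: (bounded_rv_comp mx) => //; exists M.
have mf : measurable_fun [set: vec] (fun y => k * (g y - m)).
  by apply: measurable_funM => //; apply: measurable_funB.
have fM i w : `|k * (g (x i w) - m)| <= `|k| * (M + `|m|).
  by rewrite normrM ler_wpM2l// (le_trans (ler_normB _ _))// lerD2r.
rewrite (Rintegral_sum_sqr mx indep law mf fM); last first.
  rewrite RintegralZ_bounded; last first.
    by apply: bounded_rvD => //; exact: bounded_rv_cst.
  by rewrite RintegralD_bounded//; [rewrite Rintegral_prob_cst subrr mulr0|exact: bounded_rv_cst].
congr (_ * _).
rewrite (_ : (fun w => _) = (fun w => k ^+ 2 * (g (x 0%N w) ^+ 2 + (- (2 * m) * g (x 0%N w) + m ^+ 2)))); last first.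
  by apply/funext => w; ring.
have b2 := bsqr (bg 0%N).
have b3 : bounded_rv (fun w => - (2 * m) * g (x 0%N w) + m ^+ 2).
  by apply: bounded_rvD; [exact: bounded_rvZ|exact: bounded_rv_cst].
rewrite RintegralZ_bounded; last exact: bounded_rvD.
rewrite RintegralD_bounded// RintegralD_bounded; [|exact: bounded_rvZ|exact: bounded_rv_cst].
by rewrite RintegralZ_bounded// Rintegral_prob_cst -/m; congr (_ * _); ring.
Qed.

Let p2V_cvg : (fun n => ((p n / s n ^+ d.-1) ^+ 2)^-1) @ \oo --> (kappa ^+ 2)^-1.
Proof. by apply: cvgV; [rewrite expf_neq0// gt_eqF|exact: cvg_exprn]. Qed.

(** The variance is at most the mean of [e ^+ 2] over [n * p n ^+ 2]. Both this mean and [p n] are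
    of order [s n ^+ d.-1], so the quotient is of the order of [sparse]. *)
Let mass_cvg : (fun n => \int[P]_w (mass n w - 1) ^+ 2) @ \oo --> (0 : R).
Proof.
have H : (fun n => (n%:R * s n ^+ d.-1)^-1 *
    ((\int[P]_w (e n (x 0%N w) ^+ 2) / s n ^+ d.-1) / (p n / s n ^+ d.-1) ^+ 2)) @ \oo --> (0 : R).
  rewrite -[X in _ --> X](mul0r (kappa / Num.sqrt 2 ^+ d.-1 / kappa ^+ 2)).
  exact: cvgM sparse (cvgM e2_cvg p2V_cvg).
apply: (squeeze_cvgr _ (cvg_cst 0) H); near=> n.
have n0 : 0 < np n by near: n; exact: np_pos.
have p0 : 0 < p n by near: n; exact: p_pos.
have nn0 : 0 < n%:R :> R by move: n0; rewrite /np pmulr_lgt0.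
have -> : \int[P]_w (mass n w - 1) ^+ 2 =
    \int[P]_w (\sum_(j < n) (np n)^-1 * (e n (x j w) - p n)) ^+ 2.
  apply: eq_Rintegral => w _; congr (_ ^+ 2); rewrite massE -mulr_sumr sumrB sumr_const card_ord.
  by rewrite mulrBr -[p n *+ n]mulr_natl mulVf// gt_eqF.
have snd : 0 < s n ^+ d.-1 by rewrite exprn_gt0.
apply/andP; split; first by apply: Rintegral_ge0 => w _; exact: sqr_ge0.
rewrite (variance_sum _ _ (me n) (e_le1 n)) -/(p n).
have -> : (n%:R * s n ^+ d.-1)^-1 * ((\int[P]_w (e n (x 0%N w) ^+ 2) / s n ^+ d.-1) / (p n / s n ^+ d.-1) ^+ 2) =
    n%:R * ((np n)^-1 ^+ 2 * \int[P]_w (e n (x 0%N w) ^+ 2)).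
  by rewrite /np; field; rewrite !gt_eqF.
by rewrite ler_wpM2l// ler_wpM2l ?sqr_ge0// gerBl sqr_ge0.
Unshelve. all: by end_near.
Qed.

Let drift n t := a n / p n * b n (V^T *m t).
Let ylim t := dotv (V^T *m t) (Ylim rho q).
Let covar t := v * (kappa * dotv (tang (V^T *m t)) (tang (V^T *m t)) / Num.sqrt 2 ^+ d.+1 / kappa ^+ 2).

Let drift_cvg t : (fun n => drift n t) @ \oo --> mu * ylim t.
Proof.
have H : (fun n => a n * s n ^+ 2 * (b n (V^T *m t) / s n ^+ d.+1 / (p n / s n ^+ d.-1))) @ \oo --> mu * ylim t.
  have -> : mu * ylim t = mu * (kappa * ylim t / kappa) by rewrite mulrAC divff ?mul1r// gt_eqF.
  have pV : (fun n => (p n / s n ^+ d.-1)^-1) @ \oo --> kappa^-1 by apply: cvgV => //; rewrite gt_eqF.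
  have Hb := @b_cvg (V^T *m t).
  exact: cvgM a_mean (cvgM Hb pV).
apply: cvg_trans H; apply: near_eq_cvg; near=> n.
have p0 : 0 < p n by near: n; exact: p_pos.
have -> : s n ^+ d.+1 = s n ^+ d.-1 * s n ^+ 2 by rewrite -exprD addn2 prednK.
by rewrite /drift; field; rewrite !gt_eqF ?exprn_gt0.
Unshelve. all: by end_near.
Qed.

Let f n t (y : vec) : R := a n / np n * (h n (V^T *m t) y - b n (V^T *m t)).

Let mf n t : measurable_fun [set: vec] (f n t).
Proof. by apply: measurable_funM => //; apply: measurable_funB. Qed.

Let delta n t := `|a n / np n| * (2 * (enorm (V^T *m t) * s n)).

Let f_le n t i w : `|f n t (x i w)| <= delta n t.
Proof.
rewrite /f normrM ler_wpM2l// (le_trans (ler_normB _ _))// mulr_natl mulr2n lerD//.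
by apply: normr_Rintegral_le => // w'; exact: h_le.
Qed.

Let f_mean n t : \int[P]_w f n t (x 0%N w) = 0.
Proof.
rewrite RintegralZ_bounded; last by apply: bounded_rvD => //; exact: bounded_rv_cst.
by rewrite RintegralD_bounded//; [rewrite Rintegral_prob_cst subrr mulr0|exact: bounded_rv_cst].
Qed.

Let dotv_wsum_drift n t w : 0 < np n ->
  dotv t (cv (wsum n w)) = drift n t + \sum_(j < n) f n t (x j w).
Proof.
move=> n0; rewrite dotv_wsum /f -mulr_sumr sumrB sumr_const card_ord mulrBr.
rewrite [X in _ + (_ - X)](_ : _ = drift n t); first by ring.
rewrite /drift -[X in _ * X]mulr_natl /np; have := n0; rewrite /np => n0'.
have p0 : p n != 0 by apply: contraTneq n0' => ->; rewrite mulr0 ltxx.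
have nn0 : (n%:R : R) != 0 by apply: contraTneq n0' => ->; rewrite mul0r ltxx.
by field; rewrite p0.
Qed.

Let sum_var n t := n%:R * \int[P]_w (f n t (x 0%N w) ^+ 2).

(** Centring subtracts [drift n t ^+ 2 / n], which vanishes because the drift converges; only the
    uncentred second moment of [h] survives. *)
Let sum_var_cvg t : (fun n => sum_var n t) @ \oo --> covar t.
Proof.
have ninv : (fun n : nat => (n%:R : R)^-1) @ \oo --> (0 : R).
  by apply/gtr0_cvgV0; [near=> n; rewrite ltr0n; near: n; exact: nbhs_infty_gt|exact: cvgr_idn].
have H : (fun n => a n ^+ 2 * s n ^+ 4 / (n%:R * s n ^+ d.+1) *
   (\int[P]_w (h n (V^T *m t) (x 0%N w) ^+ 2) / s n ^+ d.+1 / (p n / s n ^+ d.-1) ^+ 2) -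
   drift n t ^+ 2 / n%:R) @ \oo --> covar t.
  rewrite -[covar t]subr0 -[X in _ - X](mulr0 ((mu * ylim t) ^+ 2)).
  have Hh := @h2_cvg (V^T *m t).
  have Hd := cvg_exprn (k := 2) (drift_cvg (t := t)).
  exact: cvgB (cvgM a_var (cvgM Hh p2V_cvg)) (cvgM Hd ninv).
apply: cvg_trans H; apply: near_eq_cvg; near=> n.
have n0 : 0 < np n by near: n; exact: np_pos.
have p0 : 0 < p n by near: n; exact: p_pos.
have nn0 : 0 < n%:R :> R by move: n0; rewrite /np pmulr_lgt0.
have E := variance_sum (a n / np n) n (mh n (V^T *m t)) (h_le n (V^T *m t)).
rewrite /sum_var -(Rintegral_sum_sqr mx indep law (mf n t) (f_le n t) n (f_mean n t)) E -/(b n _).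
have -> : s n ^+ d.+1 = s n ^+ d.-1 * s n ^+ 2 by rewrite -exprD addn2 prednK.
rewrite /drift /np; move: (\int[P]_w _) => I.
by field; rewrite !gt_eqF ?exprn_gt0.
Unshelve. all: by end_near.
Qed.

Let c : cV := mu *: (V *m Ylim rho q).

Let dotv_c t : dotv t c = mu * ylim t.
Proof. by rewrite dotvZr dotv_mulmx. Qed.

(** Squared bias plus variance. It yields convergence in L2 when [v = 0], and otherwise the second
    moment bound behind tightness. *)
Let wsum_sqr t : (fun n => \int[P]_w (dotv t (cv (wsum n w) - c)) ^+ 2) @ \oo --> covar t.
Proof.
have H : (fun n => (drift n t - dotv t c) ^+ 2 + sum_var n t) @ \oo --> covar t.
  rewrite -[X in _ --> X]add0r; apply: cvgD; last exact: sum_var_cvg.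
  rewrite (_ : 0 = (mu * ylim t - dotv t c) ^+ 2); last by rewrite dotv_c subrr expr0n.
  by apply: cvg_exprn; apply: cvgB; [exact: drift_cvg|exact: cvg_cst].
apply: cvg_trans H; apply: near_eq_cvg; near=> n.
have n0 : 0 < np n by near: n; exact: np_pos.
pose S w := \sum_(j < n) f n t (x j w).
have bS : bounded_rv S.
  apply: (bounded_rv_sum n (W := fun j w => f n t (x j w))) => j.
  by apply: (bounded_rv_comp mx) => //; exists (delta n t).
have S0 : \int[P]_w S w = 0.
  rewrite /S Rintegral_sum; last first.
    move=> j; apply: bounded_rv_integrable; apply: (bounded_rv_comp mx) => //; exists (delta n t); exact: f_le.
  rewrite big1// => j _; rewrite (Rintegral_law mx law j (mf n t)) ?f_mean//.
  by exists (delta n t) => i w; exact: f_le.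
rewrite /sum_var -(Rintegral_sum_sqr mx indep law (mf n t) (f_le n t) n (f_mean n t)).
set k := drift n t - dotv t c.
rewrite [RHS](_ : _ = \int[P]_w (S w ^+ 2 + (2 * k * S w + k ^+ 2))); last first.
  by apply: eq_Rintegral => w _; rewrite dotvBr dotv_wsum_drift// -/(S w) /k; ring.
rewrite RintegralD_bounded; [|exact: bsqr|by apply: bounded_rvD; [exact: bounded_rvZ|exact: bounded_rv_cst]].
rewrite RintegralD_bounded; [|exact: bounded_rvZ|exact: bounded_rv_cst].
by rewrite RintegralZ_bounded// S0 mulr0 add0r Rintegral_prob_cst addrC.
Unshelve. all: by end_near.
Qed.

(** [delta n t ^+ 2] factors into the quantity of [a_var], which converges, the quantity of
    [sparse], which vanishes, and a convergent normalisation. This is the uniform negligibility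
    required by [char_sum_gauss]. *)
Let delta_cvg t : (fun n => delta n t) @ \oo --> (0 : R).
Proof.
have H2 : (fun n => delta n t ^+ 2) @ \oo --> (0 : R).
  have H : (fun n => 4 * enorm (V^T *m t) ^+ 2 * ((a n ^+ 2 * s n ^+ 4 / (n%:R * s n ^+ d.+1)) *
      ((n%:R * s n ^+ d.-1)^-1 * ((p n / s n ^+ d.-1) ^+ 2)^-1))) @ \oo --> (0 : R).
    rewrite (_ : 0 = 4 * enorm (V^T *m t) ^+ 2 * (v * (0 * (kappa ^+ 2)^-1))); last by rewrite mul0r !mulr0.
    by apply: cvgMl_tmp; exact: (cvgM a_var (cvgM sparse p2V_cvg)).
  apply: cvg_trans H; apply: near_eq_cvg; near=> n.
  have n0 : 0 < np n by near: n; exact: np_pos.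
  have p0 : 0 < p n by near: n; exact: p_pos.
  have nn0 : 0 < n%:R :> R by move: n0; rewrite /np pmulr_lgt0.
  rewrite /delta [RHS]exprMn real_normK ?num_real//.
  have -> : s n ^+ d.+1 = s n ^+ d.-1 * s n ^+ 2 by rewrite -exprD addn2 prednK.
  by rewrite /np; field; rewrite !gt_eqF ?exprn_gt0.
have -> : (fun n => delta n t) = (fun n => Num.sqrt (delta n t ^+ 2)).
  apply/funext => n; rewrite sqrtr_sqr ger0_norm// mulr_ge0// mulr_ge0// mulr_ge0 ?enorm_ge0//.
  by rewrite ltW.
rewrite -(sqrtr0 R); apply: continuous_cvg => //; exact: sqrt_continuous.
Unshelve. all: by end_near.
Qed.

Let char_cvg t :
  (fun n => \int[P]_w cos (dotv t (cv (wsum n w)))) @ \oo --> cos (dotv t c) * expR (- (2^-1 * covar t)) /\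
  (fun n => \int[P]_w sin (dotv t (cv (wsum n w)))) @ \oo --> sin (dotv t c) * expR (- (2^-1 * covar t)).
Proof.
pose C n := \int[P]_w cos (\sum_(j < n) f n t (x j w)).
pose S n := \int[P]_w sin (\sum_(j < n) f n t (x j w)).
have bnd n := char_sum_gauss mx indep law (mf n t) (f_le n t) n (f_le n t) (f_mean n t) erefl.
have err0 : (fun n => sum_var n t * (2 * delta n t ^+ 2 + delta n t)) @ \oo --> (0 : R).
  have Hd : (fun n => delta n t) @ \oo --> (0 : R) by exact: delta_cvg.
  have Hd2 := cvg_exprn (k := 2) Hd.
  rewrite (_ : 0 = covar t * (2 * 0 ^+ 2 + 0)); last by rewrite expr0n/= mulr0 addr0 mulr0.
  apply: cvgM; first exact: sum_var_cvg.
  by apply: cvgD => //; exact: cvgMl_tmp.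
have err0' : (fun n => sum_var n t * delta n t) @ \oo --> (0 : R).
  by rewrite -[X in _ --> X](mulr0 (covar t)); apply: cvgM; [exact: sum_var_cvg|exact: delta_cvg].
have Ccvg : C @ \oo --> expR (- (2^-1 * covar t)).
  have E : (fun n => expR (- (2^-1 * sum_var n t))) @ \oo --> expR (- (2^-1 * covar t)).
    have Hv := sum_var_cvg (t := t).
    by apply: continuous_cvg; [exact: continuous_expR|apply: cvgN; exact: cvgMl_tmp].
  have D : (fun n => C n - expR (- (2^-1 * sum_var n t))) @ \oo --> (0 : R).
    by apply/norm_cvg0P; apply: (squeeze_cvgr _ (cvg_cst 0) err0); apply: nearW => n;
       rewrite normr_ge0 (bnd n).1.
  rewrite -[X in _ --> X]add0r (_ : C = (fun n => C n - expR (- (2^-1 * sum_var n t)) + expR (- (2^-1 * sum_var n t)))).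
    exact: cvgD.
  by apply/funext => n; rewrite subrK.
have Scvg : S @ \oo --> (0 : R).
  apply/norm_cvg0P; apply: (squeeze_cvgr _ (cvg_cst 0) err0'); apply: nearW => n.
  by rewrite normr_ge0 (bnd n).2.
have kc : (fun n => cos (drift n t)) @ \oo --> cos (dotv t c).
  by rewrite dotv_c; apply: continuous_cvg; [exact: continuous_cos|exact: drift_cvg].
have ks : (fun n => sin (drift n t)) @ \oo --> sin (dotv t c).
  by rewrite dotv_c; apply: continuous_cvg; [exact: continuous_sin|exact: drift_cvg].
have mS n : measurable_fun [set: T] (fun w => \sum_(j < n) f n t (x j w)).
  apply: (bounded_rv_sum n (W := fun j w => f n t (x j w)) _).1 => j.
  by apply: (bounded_rv_comp mx) => //; exists (delta n t).
have bc n := bounded_rv_cos (mS n).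
have bs n := bounded_rv_sin (mS n).
split.
  have H : (fun n => cos (drift n t) * C n - sin (drift n t) * S n) @ \oo --> cos (dotv t c) * expR (- (2^-1 * covar t)).
    rewrite -[X in _ --> X]subr0 -[X in _ --> _ - X](mulr0 (sin (dotv t c))).
    by apply: cvgB; exact: cvgM.
  apply: cvg_trans H; apply: near_eq_cvg; near=> n.
  have n0 : 0 < np n by near: n; exact: np_pos.
  rewrite -!RintegralZ_bounded// -mulN1r -RintegralZ_bounded; last exact: bounded_rvZ.
  rewrite -RintegralD_bounded; [|exact: bounded_rvZ|by apply: bounded_rvZ; exact: bounded_rvZ].
  by apply: eq_Rintegral => w _; rewrite dotv_wsum_drift// cosD mulN1r.
have H : (fun n => sin (drift n t) * C n + cos (drift n t) * S n) @ \oo --> sin (dotv t c) * expR (- (2^-1 * covar t)).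
  rewrite -[X in _ --> X]addr0 -[X in _ --> _ + X](mulr0 (cos (dotv t c))).
  by apply: cvgD; exact: cvgM.
apply: cvg_trans H; apply: near_eq_cvg; near=> n.
have n0 : 0 < np n by near: n; exact: np_pos.
rewrite -!RintegralZ_bounded// -RintegralD_bounded; [|exact: bounded_rvZ|exact: bounded_rvZ].
by apply: eq_Rintegral => w _; rewrite dotv_wsum_drift// sinD.
Unshelve. all: by end_near.
Qed.

Let bdist n : bounded_rv (fun w => dotv (cv (wsum n w) - c) (cv (wsum n w) - c)).
Proof.
rewrite (_ : (fun w => _) = (fun w => \sum_(j < d) dotv (ebasis j) (cv (wsum n w) - c) ^+ 2)); last first.
  by apply/funext => w; rewrite dotvv_sum_ebasis.
apply: bounded_rv_bigsum => j; apply: bsqr.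
rewrite (_ : (fun w => _) = (fun w => dotv (ebasis j) (cv (wsum n w)) + - dotv (ebasis j) c)); last first.
  by apply/funext => w; rewrite dotvBr.
by apply: bounded_rvD => //; exact: bounded_rv_cst.
Qed.

Let bnorm n : bounded_rv (fun w => dotv (cv (wsum n w)) (cv (wsum n w))).
Proof.
rewrite (_ : (fun w => _) = (fun w => \sum_(j < d) dotv (ebasis j) (cv (wsum n w)) ^+ 2)); last first.
  by apply/funext => w; rewrite dotvv_sum_ebasis.
by apply: bounded_rv_bigsum => j; exact: bsqr.
Qed.

Let dist_cvg : (fun n => \int[P]_w dotv (cv (wsum n w) - c) (cv (wsum n w) - c)) @ \oo -->
  \sum_(j < d) covar (ebasis j).
Proof.
rewrite (_ : (fun n => _) = (fun n => \sum_(j < d) \int[P]_w (dotv (ebasis j) (cv (wsum n w) - c)) ^+ 2)).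
  by apply: cvg_bigsum => j; exact: wsum_sqr.
apply/funext => n; rewrite -Rintegral_sum.
  by apply: eq_Rintegral => w _; rewrite dotvv_sum_ebasis.
move=> j; apply: bounded_rv_integrable; apply: bsqr.
rewrite (_ : (fun w => _) = (fun w => dotv (ebasis j) (cv (wsum n w)) + - dotv (ebasis j) c)); last first.
  by apply/funext => w; rewrite dotvBr.
by apply: bounded_rvD => //; exact: bounded_rv_cst.
Qed.

Let norm_bounded : exists B, \forall n \near \oo, \int[P]_w dotv (cv (wsum n w)) (cv (wsum n w)) <= B.
Proof.
set W := \sum_(j < d) covar (ebasis j).
exists (2 * (W + 1) + 2 * dotv c c).
have W1 : W < W + 1 by rewrite ltrDl.
have /cvgr_lt/(_ _ W1) := dist_cvg; apply: filterS => n Hn.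
have b2 : bounded_rv (fun w => 2 * dotv (cv (wsum n w) - c) (cv (wsum n w) - c) + 2 * dotv c c).
  by apply: bounded_rvD; [exact: bounded_rvZ|exact: bounded_rv_cst].
apply: le_trans (Rintegral_le_bounded P (bnorm n) b2 _) _.
  (* With [y] for the value of [wsum], [2 |y - c| ^+ 2 + 2 |c| ^+ 2 - |y| ^+ 2] is exactly
     [|y - 2 c| ^+ 2]. *)
  move=> w; have H := dotvv_ge0 (cv (wsum n w) - c - c).
  by move: H; rewrite !(dotvBr, dotvBl) (dotvC c (wsum n w)); lra.
rewrite RintegralD_bounded; [|exact: bounded_rvZ|exact: bounded_rv_cst].
by rewrite RintegralZ_bounded// Rintegral_prob_cst lerD2r ler_wpM2l// ltW.
Qed.

Let ratio_cvg delta' : 0 < delta' ->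
  (fun n => \int[P]_w tail delta' ((mass n w)^-1 *: cv (wsum n w) - wsum n w)) @ \oo --> (0 : R).
Proof. by have [B HB] := norm_bounded; exact: (ratio_tail bmass mwsum bnorm HB mass_cvg). Qed.

Let mratio n : measurable_fun [set: T] (fun w => (mass n w)^-1 *: cv (wsum n w) : vec).
Proof.
apply: measurable_vec_scale => //.
exact: measurableT_comp measurable_invr (bmass n).1.
Qed.

(** The weights sum to 1, so [q] can be moved inside the sum. Stated for large [n], since [Zsum] is
    empty at [n = 0] and positivity of [np n] is drawn from a limit. *)
Let ratioE : \forall n \near \oo, forall w, a n *: Yn q V beta x n w = (mass n w)^-1 *: cv (wsum n w).
Proof.
near=> n => w.
have n0 : 0 < np n by near: n; exact: np_pos.
have Z0 : 0 < Zsum q beta x n w.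
  have nn0 : (0 < n)%N by near: n; exact: nbhs_infty_gt.
  rewrite /Zsum (bigD1 (Ordinal nn0))//=; apply: ltr_pwDl; first exact: expR_gt0.
  by apply: sumr_ge0 => j _; exact: expR_ge0.
have -> : (mass n w)^-1 *: cv (wsum n w) = (a n / Zsum q beta x n w) *:
    (V *m \sum_(j < n) (e n (x j w) *: (x j w - q))).
  by rewrite /wsum scalerA /mass; congr (_ *: _); field; rewrite !gt_eqF.
rewrite -scalerA; congr (_ *: _); rewrite /Yn /ATT -mulmxBr scalemxAr; congr (_ *m _).
have -> : \sum_(j < n) (e n (x j w) *: (x j w - q)) =
    \sum_(j < n) (e n (x j w) *: x j w) - Zsum q beta x n w *: q.
  by rewrite /Zsum scaler_suml -sumrB; apply: eq_bigr => j _; rewrite scalerBr.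
rewrite scalerBr scalerA mulVf ?gt_eqF// scale1r; congr (_ - _).
rewrite scaler_sumr; apply: eq_bigr => j _; rewrite scalerA /attw mulrC.
by [].
Unshelve. all: by end_near.
Qed.

(** With vanishing limit variance [wsum] converges to [c] in L2, and [ratio_cvg] removes the random
    normalisation. *)
Lemma attention_cvg_prob : v = 0 -> cvg_prob P (fun n w => a n *: Yn q V beta x n w) c.
Proof.
move=> v0.
have Z : \sum_(j < d) covar (ebasis j) = 0 by rewrite big1// => j _; rewrite /covar v0 mul0r.
have L2 := dist_cvg; rewrite Z in L2.
have mwc n : measurable_fun [set: T] (fun w => cv (wsum n w) - c : vec).
  by apply: measurable_vec_add.
have mrw n : measurable_fun [set: T] (fun w => (mass n w)^-1 *: cv (wsum n w) - wsum n w : vec).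
  rewrite (_ : (fun w => _) = (fun w => (mass n w)^-1 *: cv (wsum n w) + -1 *: cv (wsum n w))); last first.
    by apply/funext => w; rewrite scaleN1r.
  by apply: measurable_vec_add => //; exact: measurable_vec_scale.
have H : cvg_prob P (fun n w => (mass n w)^-1 *: cv (wsum n w)) c.
  apply: (cvg_prob_tail mratio) => delta' d0; have d20 : 0 < delta' / 2 by rewrite divr_gt0.
  have B : (fun n => \int[P]_w tail (delta' / 2) ((mass n w)^-1 *: cv (wsum n w) - wsum n w) +
      (delta' / 2) ^- 2 * \int[P]_w dotv (cv (wsum n w) - c) (cv (wsum n w) - c)) @ \oo --> (0 : R).
    rewrite -[X in _ --> X]addr0 -[X in _ --> _ + X](mulr0 ((delta' / 2) ^- 2)).
    by apply: cvgD; [exact: ratio_cvg|exact: cvgMl_tmp].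
  apply: (squeeze_cvgr _ (cvg_cst 0) B); apply: nearW => n; apply/andP; split.
    by apply: Rintegral_ge0 => w _; exact: tail_ge0.
  have b1 := bounded_rv_tail (mrw n) (delta' / 2).
  have b2 := bounded_rv_tail (mwc n) (delta' / 2).
  have mrc : measurable_fun [set: T] (fun w => (mass n w)^-1 *: cv (wsum n w) - c : vec).
    by apply: measurable_vec_add.
  apply: (@le_trans _ _ (\int[P]_w (tail (delta' / 2) ((mass n w)^-1 *: cv (wsum n w) - wsum n w) +
     tail (delta' / 2) (cv (wsum n w) - c)))).
    apply: Rintegral_le_bounded; [exact: bounded_rv_tail|exact: bounded_rvD|] => w.
    apply: le_trans (tailD _ _ _); rewrite (_ : _ - _ + _ = (mass n w)^-1 *: cv (wsum n w) - c)//.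
    by rewrite addrA subrK.
  rewrite RintegralD_bounded// lerD2l.
  exact: (tail_markov P d20 (mwc n) (bdist n)).
move=> eps e0; apply: cvg_trans (H eps e0); apply: near_eq_cvg.
by apply: filterS ratioE => n En; congr (P _); apply/seteqP; split => w /=; rewrite En.
Qed.

(** The drift supplies the constant [c] and the centred sum the Gaussian part; second moments of
    [wsum] give the tightness asked for by [levy_continuity] and [slutsky]. *)
Lemma attention_cvg_dist (dT' : measure_display) (T' : measurableType dT') (P' : probability T' R)
  (G : T' -> cV) (C : 'M[R]_d) : gaussian_vec P' G C ->
  (forall t, (t^T *m C *m t) 0 0 = covar t) -> 0 <= v ->
  cvg_dist P (fun n w => a n *: Yn q V beta x n w) P' (fun w => c + G w).
Proof.
move=> gG CE v0.
have mG : measurable_fun [set: T'] (G : T' -> vec) by move=> _ A mA; rewrite setTI; exact: gG.1.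
have mcG : measurable_fun [set: T'] (fun w => c + G w : vec) by apply: measurable_vec_add.
have cov0 t : 0 <= covar t.
  rewrite /covar mulr_ge0// divr_ge0 ?sqr_ge0// divr_ge0 ?exprn_ge0 ?sqrtr_ge0//.
  by rewrite mulr_ge0 ?dotvv_ge0// ltW.
have chr t : \int[P']_w cos (dotv t (G w)) = expR (- (2^-1 * covar t)) /\ \int[P']_w sin (dotv t (G w)) = 0.
  by have := gaussian_char (t := t) gG; rewrite /= CE => /(_ (cov0 t)).
have mtG t : measurable_fun [set: T'] (fun w => dotv t (G w)).
  exact: measurable_dotv_rv mG.
have bc t := bounded_rv_cos (mtG t).
have bs t := bounded_rv_sin (mtG t).
have Hlevy : cvg_dist P wsum P' (fun w => c + G w).
  apply: levy_continuity => //.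
  - by have [B HB] := norm_bounded; exact: tight_second_moment HB.
  - move=> t; rewrite (_ : \int[P']_w _ = cos (dotv t c) * expR (- (2^-1 * covar t))); first exact: (char_cvg t).1.
    transitivity (\int[P']_w (cos (dotv t c) * cos (dotv t (G w)) + - sin (dotv t c) * sin (dotv t (G w)))).
      by apply: eq_Rintegral => w _; rewrite dotvDr cosD mulNr.
    rewrite RintegralD_bounded; [|exact: bounded_rvZ|exact: bounded_rvZ].
    by rewrite !RintegralZ_bounded// (chr t).1 (chr t).2 mulr0 addr0.
  - move=> t; rewrite (_ : \int[P']_w _ = sin (dotv t c) * expR (- (2^-1 * covar t))); first exact: (char_cvg t).2.
    transitivity (\int[P']_w (sin (dotv t c) * cos (dotv t (G w)) + cos (dotv t c) * sin (dotv t (G w)))).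
      by apply: eq_Rintegral => w _; rewrite dotvDr sinD.
    rewrite RintegralD_bounded; [|exact: bounded_rvZ|exact: bounded_rvZ].
    by rewrite !RintegralZ_bounded// (chr t).1 (chr t).2 mulr0 addr0.
have Hr : cvg_dist P (fun n w => (mass n w)^-1 *: cv (wsum n w)) P' (fun w => c + G w).
  apply: (slutsky mwsum mratio mcG _ ratio_cvg Hlevy).
  by have [B HB] := norm_bounded; exact: tight_second_moment HB.
move=> fn cfn fM; apply: cvg_trans (Hr fn cfn fM); apply: near_eq_cvg.
by apply: filterS ratioE => n En; apply: eq_integral => w _; rewrite En.
Qed.

End attention_core.

(** * Exponents and constants of the statement in terms of s *)

Section powers.
Context {R : realType} (d : nat).
Hypothesis d2 : (2 <= d)%N.
Let m : R := (d%:R - 1) / 2.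

Lemma natr_pred_dim : (d.-1%:R : R) = d%:R - 1.
Proof. by rewrite -[in RHS](prednK (ltnW d2)) -natr1 addrK. Qed.

Lemma alpha_d_inv : (alpha_d R d)^-1 = m.
Proof. by rewrite /alpha_d invf_div. Qed.

Let dim_gt0 : 0 < d%:R - 1 :> R.
Proof. by rewrite -natr_pred_dim ltr0n; case: d d2 => [|[]]. Qed.

Lemma powR_half_dim (y : R) : 0 <= y -> y `^ m = Num.sqrt y ^+ d.-1.
Proof.
move=> y0; rewrite /m mulrC powRrM -powR12_sqrt// -natr_pred_dim powR_mulrn//.
exact: powR_ge0.
Qed.

Lemma powR_alpha_half (y : R) : 0 <= y -> (y `^ (- alpha_d R d)) `^ m = y^-1.
Proof.
move=> y0; rewrite -powRrM (_ : _ * m = -1); first by rewrite powR_inv1.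
by rewrite /alpha_d /m; field; rewrite gt_eqF.
Qed.

Lemma sqrt_exp_cvg0 (u : nat -> R) : u @ \oo --> (0 : R) -> (fun n => Num.sqrt (u n) ^+ d.-1) @ \oo --> (0 : R).
Proof.
move=> u0; have -> : 0 = Num.sqrt 0 ^+ d.-1 :> R.
  by rewrite sqrtr0 expr0n; case: d d2 => [|[]].
by apply: cvg_exprn; apply: continuous_cvg => //; exact: sqrt_continuous.
Qed.

(** As [alpha_d * m = 1], the [m]-th power of [b * n ^ (- alpha)] is [b ^ m / n]. At [n = 0] both
    sides are 0 by convention. *)
Lemma sparse_rate (b : R) (n : nat) : 0 < b ->
  (n%:R * (Num.sqrt b)^-1 ^+ d.-1)^-1 = Num.sqrt (b * n%:R `^ (- alpha_d R d)) ^+ d.-1.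
Proof.
move=> b0; rewrite -powR_half_dim; last by rewrite mulr_ge0 ?powR_ge0// ltW.
rewrite powRM ?powR_ge0 ?(ltW b0)// powR_alpha_half// powR_half_dim ?(ltW b0)//.
by rewrite exprVn invfM invrK mulrC.
Qed.

(** Here [(1 + alpha_d) * m = m + 1]: the rate separating the three regimes is, up to the power [m],
    the variance scale [1 / (n * s ^+ d.+1)]. *)
Lemma critical_rate (b : R) (n : nat) : 0 < b ->
  (n%:R * (Num.sqrt b)^-1 ^+ d.+1)^-1 =
  Num.sqrt (b `^ (1 + alpha_d R d) * n%:R `^ (- alpha_d R d)) ^+ d.-1.
Proof.
move=> b0; rewrite -powR_half_dim; last by rewrite mulr_ge0 ?powR_ge0.
rewrite powRM ?powR_ge0// powR_alpha_half// -powRrM.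
have -> : (1 + alpha_d R d) * m = m + 1 by rewrite /alpha_d /m; field; rewrite gt_eqF.
rewrite powRD; last by rewrite (gt_eqF b0) implybT.
rewrite powRr1 ?(ltW b0)// powR_half_dim ?(ltW b0)// exprVn invfM invrK mulrC.
congr (_ / _); rewrite -[X in _ = _ * X](sqr_sqrtr (ltW b0)) -exprD addn2.
by rewrite prednK// ltnW.
Qed.

Lemma third_rate (b : R) : 0 < b -> b `^ (1 - (alpha_d R d)^-1) = b * (Num.sqrt b)^-1 ^+ d.-1.
Proof.
move=> b0; rewrite alpha_d_inv powRD; last by rewrite (gt_eqF b0) implybT.
by rewrite powRr1 ?(ltW b0)// powRN powR_half_dim ?(ltW b0)// exprVn.
Qed.

(** The origin of [c_d]: the factor [2 ^ (- m - 1)] of the doubled [beta] and [(2 pi) ^ (- m)] of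
    the normalisation combine to [2 ^ (- d) * pi ^ (- m)], since [2 m + 1 = d]. *)
Lemma gaussian_constant (r : R) : 0 < r ->
  let kappa := r * Num.sqrt (2 * pi) ^+ d.-1 in
  kappa / Num.sqrt 2 ^+ d.+1 / kappa ^+ 2 = c_d R d / r.
Proof.
move=> r0 kappa.
have s2 : 0 < Num.sqrt 2 :> R by rewrite sqrtr_gt0.
have sp : 0 < Num.sqrt pi :> R by rewrite sqrtr_gt0 pi_gt0.
have E : kappa = r * (Num.sqrt 2 ^+ d.-1 * Num.sqrt pi ^+ d.-1) by rewrite /kappa sqrtrM// exprMn.
rewrite /c_d -/m powR_half_dim ?pi_ge0// E.
have -> : 2 ^+ d = Num.sqrt 2 ^+ d.-1 * Num.sqrt 2 ^+ d.+1 :> R.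
  rewrite -exprD -[in LHS](@sqr_sqrtr R 2)// -exprM; congr (_ ^+ _).
  by rewrite addnS -addSn prednK ?mul2n ?addnn// ltnW.
by field; rewrite !gt_eqF ?exprn_gt0.
Qed.

End powers.

(** For the orthogonal projector [projT q], the quadratic form at [u] is the squared length of the
    projection of [u]. *)
Lemma covariance_form (R : realType) (d : nat) (q : 'cV[R]_d) (rho : 'cV[R]_d -> R) (V : 'M[R]_d) (t : 'cV[R]_d) :
  sphere q -> let u := V^T *m t in let w := u - dotv u q *: q in
  (t^T *m (V *m Sigmaq rho q *m V^T) *m t) 0 0 = c_d R d / rho q * dotv w w.
Proof.
move=> hq u w.
have -> : t^T *m (V *m Sigmaq rho q *m V^T) *m t = u^T *m (Sigmaq rho q *m u).
  by rewrite /u trmx_mul trmxK !mulmxA.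
rewrite -dotv_mxE /Sigmaq -scalemxAl dotvZr projT_mulmx (dotvC q u); congr (_ * _).
by rewrite /w !(dotvBr, dotvBl) !(dotvZr, dotvZl) (dotvv_sphere hq) (dotvC q u); ring.
Qed.

Theorem mainTheorem6 (R : realType) (d : nat) (hd : (2 <= d)%N)
  (q : 'cV[R]_d) (hq : sphere q)
  (rho : 'cV[R]_d -> R)
  (hrhoC2 : exists U : set 'cV[R]_d, [/\ open U, sphere `<=` U & C2_on U rho])
  (hrho0 : forall y, sphere y -> 0 <= rho y)
  (hrho1 : sphere_int (fun y => (rho y)%:E) = 1%E)
  (hrhoq : 0 < rho q)
  (V : 'M[R]_d) (beta : nat -> R) (hbeta : forall n, 0 < beta n)
  (dT : measure_display) (T : measurableType dT) (P : probability T R)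
  (x : nat -> T -> 'cV[R]_d)
  (hxS : forall i w, sphere (x i w))
  (hxmeas : forall i A, borelRd A -> measurable (x i @^-1` A))
  (hxlaw : forall i A, borelRd A ->
     P (x i @^-1` A) = sphere_int (fun y => ((\1_A y) * rho y)%:E))
  (hxindep : forall (I : seq nat) (A : nat -> set 'cV[R]_d), uniq I ->
     (forall k, k \in I -> borelRd (A k)) ->
     P (\bigcap_(k in [set k | k \in I]) (x k @^-1` A k)) =
       (\prod_(k <- I) P (x k @^-1` A k))%E)
  (hbinf : beta @ \oo --> +oo)
  (hbn : (fun n => beta n * n%:R `^ (- alpha_d R d)) @ \oo --> 0) :
  let a := alpha_d R d in
  let r := fun n => beta n `^ (1 + a) * n%:R `^ (- a) in
  let Y := fun n w => Yn q V beta x n w in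
  let Cov := V *m Sigmaq rho q *m V^T in
  (* (1) *)
  (r @ \oo --> 0 ->
     cvg_prob P (fun n w => beta n *: Y n w) (V *m Ylim rho q)) /\
  (* (2) *)
  (forall tau : R, 0 < tau -> r @ \oo --> tau ->
     forall (dT' : measure_display) (T' : measurableType dT')
            (P' : probability T' R) (G : T' -> 'cV[R]_d),
       gaussian_vec P' G (tau `^ a^-1 *: Cov) ->
       cvg_dist P (fun n w => beta n *: Y n w) P' (fun w => V *m Ylim rho q + G w)) /\
  (* (3) *)
  (r @ \oo --> +oo ->
     forall (dT' : measure_display) (T' : measurableType dT')
            (P' : probability T' R) (G : T' -> 'cV[R]_d),
       gaussian_vec P' G Cov ->
       cvg_dist P (fun n w => Num.sqrt (n%:R * beta n `^ (1 - a^-1)) *: Y n w) P' G) /\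
  (* in all three cases *)
  ((r @ \oo --> 0 \/ (exists tau : R, 0 < tau /\ r @ \oo --> tau) \/ r @ \oo --> +oo) ->
     cvg_prob P Y 0 /\ cvg_prob P (ATT q V beta x) (V *m q)).
Proof.
move=> a r Y Cov.
have d0 : (0 < d)%N by exact: ltnW.
pose s n := (Num.sqrt (beta n))^-1.
have s_gt0 n : 0 < s n by rewrite invr_gt0 sqrtr_gt0.
have s2 n : s n ^+ 2 = (beta n)^-1 by rewrite /s exprVn sqr_sqrtr// ltW.
have sparse : (fun n => (n%:R * s n ^+ d.-1)^-1) @ \oo --> (0 : R).
  rewrite (_ : (fun n => _) = (fun n => Num.sqrt (beta n * n%:R `^ (- alpha_d R d)) ^+ d.-1)).
    exact: sqrt_exp_cvg0.
  by apply/funext => n; exact: sparse_rate.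
have s2_cvg0 : (fun n => s n ^+ 2) @ \oo --> (0 : R).
  rewrite (_ : (fun n => _) = (fun n => (beta n)^-1)); last exact/funext.
  by apply/gtr0_cvgV0 => //; exact: nearW.
have crit n : (n%:R * s n ^+ d.+1)^-1 = Num.sqrt (r n) ^+ d.-1 by exact: critical_rate.
have prob mu c := @attention_cvg_prob R d d0 q rho hq hrhoC2 hrho0 hrhoq V beta hbeta dT T P x
  hxS hxmeas hxlaw hxindep hbinf sparse c mu 0.
have dist c mu v := @attention_cvg_dist R d d0 q rho hq hrhoC2 hrho0 hrhoq V beta hbeta dT T P x
  hxS hxmeas hxlaw hxindep hbinf sparse c mu v.
have beta_mean : (fun n => beta n * s n ^+ 2) @ \oo --> (1 : R).
  rewrite (_ : (fun n => _) = fun=> 1); first exact: cvg_cst.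
  by apply/funext => n; rewrite s2 divff// gt_eqF.
(* For the normalisation [beta], [beta ^+ 2 * s ^+ 4 = 1], so the variance scale is the power
   [m = 1 / alpha] of [r n]. Its limit is 0 in the first regime and [tau ^ (1 / alpha)] in the
   second. *)
have beta_var (v : R) : (fun n => Num.sqrt (r n) ^+ d.-1) @ \oo --> v ->
    (fun n => beta n ^+ 2 * s n ^+ 4 / (n%:R * s n ^+ d.+1)) @ \oo --> v.
  rewrite (_ : (fun n => beta n ^+ 2 * _ / _) = (fun n => Num.sqrt (r n) ^+ d.-1))//.
  apply/funext => n; rewrite crit (_ : 4%N = (2 * 2)%N)// exprM s2.
  by rewrite -exprMn divff ?expr1n ?mul1r// gt_eqF.
have cov_form t k : (t^T *m (k *: Cov) *m t) 0 0 = k * (rho q * Num.sqrt (2 * pi) ^+ d.-1 *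
    dotv (V^T *m t - dotv (V^T *m t) q *: q) (V^T *m t - dotv (V^T *m t) q *: q) /
    Num.sqrt 2 ^+ d.+1 / (rho q * Num.sqrt (2 * pi) ^+ d.-1) ^+ 2).
  rewrite -scalemxAr -scalemxAl mxE covariance_form// -(gaussian_constant hd hrhoq).
  by congr (_ * _); set K := rho q * _; ring.
split; last split; last split.
- move=> r0; have := prob 1 beta beta_mean (@beta_var 0 (sqrt_exp_cvg0 hd r0)) erefl.
  by rewrite scale1r.
- move=> tau tau0 rtau dT' T' P' G gG.
  have lim : (fun n => Num.sqrt (r n) ^+ d.-1) @ \oo --> tau `^ a^-1.
    rewrite /a alpha_d_inv powR_half_dim ?(ltW tau0)//.
    by apply: cvg_exprn; apply: continuous_cvg => //; exact: sqrt_continuous.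
  have := dist beta 1 (tau `^ a^-1) beta_mean (@beta_var _ lim) dT' T' P' G _ gG
    (fun t => cov_form t _) (powR_ge0 _ _).
  by rewrite scale1r.
- move=> roo dT' T' P' G gG.
  pose b n := Num.sqrt (n%:R * beta n `^ (1 - a^-1)).
  have b2 n : b n ^+ 2 = n%:R * (beta n * s n ^+ d.-1).
    by rewrite /b sqr_sqrtr ?mulr_ge0 ?powR_ge0// third_rate.
  have b_ge0 n : 0 <= b n by exact: sqrtr_ge0.
  have dS n : s n ^+ d.+1 = s n ^+ d.-1 * s n ^+ 2 by rewrite -exprD addn2 prednK.
  (* The square of this quantity is [n * s n ^+ d.+1], the inverse of the power [m] of [r n]. It
     vanishes in the third regime, so the drift disappears from the limit. *)
  have b_mean : (fun n => b n * s n ^+ 2) @ \oo --> (0 : R).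
    have rV : (fun n => (r n)^-1) @ \oo --> (0 : R).
      apply/gtr0_cvgV0 => //; near=> n.
      by rewrite mulr_gt0 ?powR_gt0// ltr0n; near: n; exact: nbhs_infty_gt.
    have H : (fun n => Num.sqrt (Num.sqrt ((r n)^-1) ^+ d.-1)) @ \oo --> (0 : R).
      rewrite -[X in _ --> X](sqrtr0 R).
      by apply: continuous_cvg; [exact: sqrt_continuous|exact: sqrt_exp_cvg0].
    rewrite (_ : (fun n => _) = (fun n => Num.sqrt (Num.sqrt ((r n)^-1) ^+ d.-1)))//.
    apply/funext => n.
    have r_ge0 : 0 <= r n by rewrite mulr_ge0 ?powR_ge0.
    have -> : Num.sqrt ((r n)^-1) ^+ d.-1 = n%:R * s n ^+ d.+1.
      by rewrite (sqrtrV r_ge0) exprVn -crit invrK.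
    have bs : 0 <= b n * s n ^+ 2 by rewrite mulr_ge0 ?b_ge0 ?sqr_ge0.
    rewrite -[LHS](ger0_norm bs) -sqrtr_sqr exprMn b2; congr Num.sqrt.
    by rewrite dS -exprM (exprM _ 2 2) s2; field; rewrite gt_eqF.
  have b_var : (fun n => b n ^+ 2 * s n ^+ 4 / (n%:R * s n ^+ d.+1)) @ \oo --> (1 : R).
    apply: cvg_near_cst; near=> n.
    have nn0 : (0 : R) < n%:R by rewrite ltr0n; near: n; exact: nbhs_infty_gt.
    rewrite b2 dS (exprM _ 2 2) s2; field.
    by rewrite !gt_eqF ?exprn_gt0.
  have := dist b 0 1 b_mean b_var dT' T' P' G Cov gG.
  rewrite scale0r (_ : (fun w => 0 + G w) = G); last by apply/funext => w; rewrite add0r.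
  apply; last exact: ler01.
  by move=> t; rewrite -cov_form scale1r.
move=> _.
(* With normalisation 1 the variance scale is [s n ^+ 2] times the quantity of [sparse]. It vanishes
   whatever [r] does, so the law of large numbers is the same in all three cases. *)
have one_var : (fun n => 1 ^+ 2 * s n ^+ 4 / (n%:R * s n ^+ d.+1)) @ \oo --> (0 : R).
  rewrite (_ : (fun n => _) = (fun n => s n ^+ 2 * (n%:R * s n ^+ d.-1)^-1)).
    by rewrite -[X in _ --> X](mulr0 0); exact: cvgM.
  apply/funext => n; rewrite expr1n mul1r -[d.+1]/(d.+1) (_ : d.+1 = (d.-1 + 2)%N); last by rewrite addn2 prednK.
  rewrite (exprD _ d.-1 2) (exprD _ 2 2) !invfM.
  have S0 : s n ^+ 2 != 0 by rewrite expf_neq0// gt_eqF.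
  rewrite -mulrA; congr (_ * _); rewrite mulrCA; congr (_ * _).
  by rewrite -invfM -expr2 mulrCA divff// mulr1.
have one_mean : (fun n => 1 * s n ^+ 2) @ \oo --> (0 : R) by under eq_fun do rewrite mul1r.
have HY : cvg_prob P Y 0.
  have := prob 0 (fun=> 1) one_mean one_var erefl.
  by rewrite scale0r (_ : (fun n w => 1 *: Yn q V beta x n w) = Y)//; apply/funext => n; apply/funext => w; rewrite scale1r.
split => // eps e0; have := HY eps e0.
rewrite (_ : (fun n => P [set w | eps <= enorm (Y n w - 0)]) =
  (fun n => P [set w | eps <= enorm (ATT q V beta x n w - V *m q)]))//.
by apply/funext => n; congr (P _); apply/seteqP; split => w /=; rewrite subr0.
Unshelve. all: by end_near.
Qed.
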